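(* The zero locus in $OG(2,13)$ of a general global section of the spinor bundle $\mathcal{S}$ is the disjoint union of two copies of $Fl_3$.
   Context: Over $\mathbb{C}$. $OG(2,13)$ is the orthogonal Grassmannian of isotropic planes $U$ in $V=\mathbb{C}^{13}$ with a non-degenerate quadratic form. $\Delta$ is the $64$-dimensional spin representation of $Spin_{13}$, with Clifford action $V\otimes\Delta\to\Delta$. The spinor bundle $\mathcal{S}$ is the homogeneous bundle on $OG(2,13)$ of rank $16$ whose fiber at $[U]$ is the cokernel of $U\otimes\Delta\to\Delta$; $H^0(\mathcal{S})=\Delta$. $Fl_3$ denotes the adjoint variety of $SL_3$, i.e. the incidence variety of pairs (point, line containing it) in $\mathbb{P}^2\times\check{\mathbb{P}}^2$. *)

(* Defs.v *)
From HB Require Import structures.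
From mathcomp Require Import all_boot all_order all_algebra.
From mathcomp Require Import boolp classical_sets reals.
From mathcomp Require Import complex.
From mathcomp Require mpoly.

Set Implicit Arguments.
Unset Strict Implicit.
Unset Printing Implicit Defensive.

Import Order.TTheory GRing.Theory Num.Theory.
Local Open Scope classical_set_scope.
Local Open Scope ring_scope.

(* Schemes over k are handled through their functors of points
   (commutative k-algebras) -> (sets), so that a morphism of schemes is a
   natural transformation.  A [comAlgType] is a nonzero ring; the zero ring, whose
   spectrum is empty, carries no information and is left out. *)
Record kfunctor (k : fieldType) := KFunctor {
  pt : comAlgType k -> Type;
  pull : forall A B : comAlgType k, {lrmorphism A -> B} -> pt A -> pt B;
  pull_id : forall (A : comAlgType k) (x : pt A),
    pull (idfun : {lrmorphism A -> A}) x = x;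
  pull_comp : forall (A B D : comAlgType k) (g : {lrmorphism A -> B})
    (h : {lrmorphism B -> D}) (x : pt A),
    pull (h \o g : {lrmorphism A -> D}) x = pull h (pull g x) }.

Definition kiso (k : fieldType) (X Y : kfunctor k) : Prop :=
  exists F : forall A : comAlgType k, pt X A -> pt Y A,
    (forall A : comAlgType k, bijective (F A)) /\
    (forall (A B : comAlgType k) (g : {lrmorphism A -> B}) (x : pt X A),
       F B (pull g x) = pull g (F A x)).

Record subkfunctor (k : fieldType) (X : kfunctor k) := SubKFunctor {
  subpt : forall A : comAlgType k, set (pt X A);
  subpt_pull : forall (A B : comAlgType k) (g : {lrmorphism A -> B})
    (x : pt X A), subpt x -> subpt (pull g x) }.

Section SubFunctor.
Variables (k : fieldType) (X : kfunctor k) (Y : subkfunctor X).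

Definition sub_pull (A B : comAlgType k) (g : {lrmorphism A -> B})
    (x : {x : pt X A | subpt Y x}) : {x : pt X B | subpt Y x} :=
  exist _ (pull g (sval x)) (subpt_pull g (svalP x)).

Fact sub_pull_id (A : comAlgType k) (x : {x : pt X A | subpt Y x}) :
  sub_pull (idfun : {lrmorphism A -> A}) x = x.
Proof. by case: x => x Yx; apply: eq_exist; rewrite /= pull_id. Qed.

Fact sub_pull_comp (A B D : comAlgType k) (g : {lrmorphism A -> B})
    (h : {lrmorphism B -> D}) (x : {x : pt X A | subpt Y x}) :
  sub_pull (h \o g : {lrmorphism A -> D}) x = sub_pull h (sub_pull g x).
Proof. by case: x => x Yx; apply: eq_exist; rewrite /= pull_comp. Qed.

Definition sub_kfunctor : kfunctor k := KFunctor sub_pull_id sub_pull_comp.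

End SubFunctor.

Coercion sub_kfunctor : subkfunctor >-> kfunctor.

(* The idempotent e cuts out the open and closed subscheme of Spec A over which
   the point x of X(A) = Hom(Spec A, X) lies in Y1, and 1 - e the one over
   which x lies in Y2. *)
Definition disjoint_union (k : fieldType) (X : kfunctor k)
    (Y1 Y2 : subkfunctor X) : Prop :=
  forall (A : comAlgType k) (x : pt X A),
  exists e : A, e * e = e /\
    forall (B : comAlgType k) (g : {lrmorphism A -> B}),
      (subpt Y1 (pull g x) <-> g e = 1) /\ (subpt Y2 (pull g x) <-> g e = 0).

Section Product.
Variables (k : fieldType) (X Y : kfunctor k).

Definition prod_pull (A B : comAlgType k) (g : {lrmorphism A -> B})
  (x : pt X A * pt Y A) : pt X B * pt Y B := (pull g x.1, pull g x.2).

Fact prod_pull_id (A : comAlgType k) (x : pt X A * pt Y A) :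
  prod_pull (idfun : {lrmorphism A -> A}) x = x.
Proof. by case: x => x y; rewrite /prod_pull !pull_id. Qed.

Fact prod_pull_comp (A B D : comAlgType k) (g : {lrmorphism A -> B})
    (h : {lrmorphism B -> D}) (x : pt X A * pt Y A) :
  prod_pull (h \o g : {lrmorphism A -> D}) x = prod_pull h (prod_pull g x).
Proof. by rewrite /prod_pull !pull_comp. Qed.

Definition prod_kfunctor : kfunctor k := KFunctor prod_pull_id prod_pull_comp.

End Product.

(* Submodule generated by S, written as the linear combinations M *m a of the
   columns of matrices M all of whose columns lie in S. *)
Definition lin_span (A : comNzRingType) (n : nat) (S : set 'cV[A]_n)
    : set 'cV[A]_n :=
  [set w | exists (m : nat) (M : 'M[A]_(n, m)) (a : 'cV[A]_m),
     (forall j, S (col j M)) /\ w = M *m a].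

(* U is a direct summand of A^n (the image of an idempotent E) whose rank is r
   at every point of Spec A. *)
Definition rank_summand (A : comNzRingType) (r n : nat) (U : set 'cV[A]_n)
    : Prop :=
  exists E : 'M[A]_n, [/\ E *m E = E, U = [set v | E *m v = v] &
    forall (K : fieldType) (psi : {rmorphism A -> K}),
      \rank (map_mx psi E) = r].

(* The image of the tensor product of U with B in B^n. *)
Definition base_change (A B : comNzRingType) (n : nat)
    (g : {rmorphism A -> B}) (U : set 'cV[A]_n) : set 'cV[B]_n :=
  lin_span (map_mx g @` U).

Lemma lin_span_sub (A : comNzRingType) n (E : 'M[A]_n) (S : set 'cV[A]_n) w :
  (forall v, S v -> E *m v = v) -> lin_span S w -> E *m w = w.
Proof.
move=> ES [m [M [a [SM ->]]]]; rewrite mulmxA; congr (_ *m _).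
apply/matrixP => i j; have /colP/(_ i) := ES _ (SM j).
by rewrite colE mulmxA -colE -[in RHS]colE !mxE.
Qed.

Lemma base_changeE (A B : comNzRingType) n (g : {rmorphism A -> B})
    (E : 'M[A]_n) : E *m E = E ->
  base_change g [set v | E *m v = v] = [set v | map_mx g E *m v = v].
Proof.
move=> EE; apply/seteqP; split=> w.
  by apply: lin_span_sub => _ [v /= Ev <-]; rewrite -map_mxM Ev.
move=> /= Ew; exists n, (map_mx g E), w; split=> // j.
by exists (col j E); rewrite ?map_col //= [in LHS]colE mulmxA EE -colE.
Qed.

Lemma rank_summand_base_change (A B : comNzRingType) r n
    (g : {rmorphism A -> B}) (U : set 'cV[A]_n) :
  rank_summand r U -> rank_summand r (base_change g U).
Proof.
move=> [E [EE -> rE]]; exists (map_mx g E); split.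
- by rewrite -map_mxM EE.
- by rewrite base_changeE.
- by move=> K psi; rewrite -map_mx_comp; apply: (rE _ (psi \o g)).
Qed.

Section Grassmannian.
Variables (k : fieldType) (r n : nat).

Definition grass_pt (A : comAlgType k) : Type :=
  {U : set 'cV[A]_n | rank_summand r U}.

Definition grass_pull (A B : comAlgType k) (g : {lrmorphism A -> B})
    (U : grass_pt A) : grass_pt B :=
  exist _ (base_change g (sval U)) (rank_summand_base_change g (svalP U)).

Fact grass_pull_id (A : comAlgType k) (U : grass_pt A) :
  grass_pull (idfun : {lrmorphism A -> A}) U = U.
Proof.
case: U => U rU; apply: eq_exist => /=; case: rU => E [EE -> _].
by rewrite base_changeE // map_mx_id.
Qed.

Fact grass_pull_comp (A B D : comAlgType k) (g : {lrmorphism A -> B})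
    (h : {lrmorphism B -> D}) (U : grass_pt A) :
  grass_pull (h \o g : {lrmorphism A -> D}) U = grass_pull h (grass_pull g U).
Proof.
case: U => U rU; apply: eq_exist => /=; case: rU => E [EE -> _].
have gEE : map_mx g E *m map_mx g E = map_mx g E by rewrite -map_mxM EE.
by rewrite !base_changeE // -map_mx_comp.
Qed.

Definition grassmannian : kfunctor k := KFunctor grass_pull_id grass_pull_comp.

End Grassmannian.

(* Flags (point, line containing it) in P^2, seen as L <= H <= A^3 with
   L of rank 1 and H of rank 2. *)
Section Fl3.
Variable k : fieldType.

Definition fl3_pt (A : comAlgType k)
    : set (pt (prod_kfunctor (grassmannian k 1 3) (grassmannian k 2 3)) A) :=
  [set LH | sval LH.1 `<=` sval LH.2].

Fact fl3_pull (A B : comAlgType k) (g : {lrmorphism A -> B})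
    (x : pt (prod_kfunctor (grassmannian k 1 3) (grassmannian k 2 3)) A) :
  fl3_pt x -> fl3_pt (pull g x).
Proof.
move=> LH w [m [M [a [LM ->]]]]; exists m, M, a; split=> // j.
by have [v Lv <-] := LM j; exists v => //; apply: LH.
Qed.

Definition Fl3 := SubKFunctor fl3_pull.

End Fl3.

(* A quadratic form is given by its Gram matrix Q: it is v |-> v^T Q v. *)
Definition qform (A : comNzRingType) (n : nat) (Q : 'M[A]_n) (v : 'cV[A]_n)
  : A := (v^T *m Q *m v) 0 0.

Definition nondegenerate_gram (k : fieldType) (n : nat) (Q : 'M[k]_n) : Prop :=
  Q^T = Q /\ Q \in unitmx.

Section OrthogonalGrassmannian.
Variables (k : numFieldType) (r n : nat) (Q : 'M[k]_n).

Definition og_pt (A : comAlgType k) : set (pt (grassmannian k r n) A) :=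
  [set U | forall u, sval U u -> qform (map_mx (in_alg A) Q) u = 0].

Fact og_pull (A B : comAlgType k) (g : {lrmorphism A -> B})
    (U : pt (grassmannian k r n) A) : og_pt U -> og_pt (pull g U).
Proof.
case: U => U rU; rewrite /og_pt /=; case: (rU) => E [EE -> _] isoU w.
rewrite base_changeE //= => Ew.
have gQ : map_mx g (map_mx (in_alg A) Q) = map_mx (in_alg B) Q.
  by apply/matrixP => i j; rewrite !mxE rmorph_alg.
pose F : 'M[A]_n := E^T *m map_mx (in_alg A) Q *m E.
have F0 (x : 'cV_n) : (x^T *m F *m x) 0 0 = 0.
  have : E *m (E *m x) = E *m x by rewrite mulmxA EE.
  by move/isoU; rewrite /qform trmx_mul /F !mulmxA.
have Fij i j : F i j + F j i = 0.
  have e1 i1 j1 : ((delta_mx i1 0 : 'cV[A]_n)^T *m F *m (delta_mx j1 0 : 'cV[A]_n)) 0 0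
                  = F i1 j1.
    by rewrite -colE trmx_delta -rowE !mxE.
  have := F0 (delta_mx i 0 + delta_mx j 0).
  rewrite [(_ + _)^T]raddfD mulmxDl mulmxDr !mulmxDl mxE [X in X + _]mxE.
  by rewrite [X in _ + X]mxE !e1 -[F i i]e1 -[F j j]e1 !F0 add0r addr0 addrC.
have FT : F^T = - F.
  apply/matrixP => i j; rewrite mxE [RHS]mxE; apply/eqP.
  by rewrite -addr_eq0 Fij.
set G := map_mx (in_alg B) Q; set gF := map_mx g F.
have wG : w^T *m G *m w = w^T *m gF *m w.
  rewrite -{1 2}Ew trmx_mul /gF /F !map_mxM gQ -/G map_trmx !mulmxA.
  by [].
have S2 : (w^T *m gF *m w)^T = - (w^T *m gF *m w).
  have gFT : gF^T = map_mx g F^T by apply/matrixP => i j; rewrite !mxE.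
  rewrite !trmx_mul trmxK gFT FT.
  have -> : map_mx g (- F) = - gF by apply/matrixP=> i j; rewrite !mxE rmorphN.
  by rewrite mulNmx mulmxN mulmxA.
rewrite /qform -/G wG; move/matrixP/(_ 0 0): S2.
set s : 'M_1 := _ *m _ *m _; rewrite mxE [RHS]mxE => /eqP; rewrite -addr_eq0 => /eqP ss.
have: in_alg B (2%:R^-1) * (s 0 0 + s 0 0) = 0 by rewrite ss mulr0.
rewrite -mulr2n -[s 0 0 *+ 2]mulr_natl mulrA -(rmorph_nat (in_alg B)) -rmorphM.
by rewrite mulVf ?pnatr_eq0 // rmorph1 mul1r.
Qed.

Definition orthogonal_grassmannian := SubKFunctor og_pull.

End OrthogonalGrassmannian.

(* The fundamental relation v . (v . s) = q(v) s.  For n = 13 the Clifford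
   algebra over the complex numbers is M_64 x M_64 and its even part is M_64,
   so for N = 64 the module is the spin representation. *)
Definition clifford_action (k : fieldType) (n N : nat) (Q : 'M[k]_n)
    (c : {linear 'cV[k]_n -> 'M[k]_N}) : Prop :=
  forall v, c v *m c v = (qform Q v)%:M.

Section Spinor.
Variables (k : numFieldType) (n N : nat) (Q : 'M[k]_n).
Variable c : {linear 'cV[k]_n -> 'M[k]_N}.

Definition clifford_ext (A : comAlgType k) (v : 'cV[A]_n) : 'M[A]_N :=
  \sum_i v i 0 *: map_mx (in_alg A) (c (delta_mx i 0)).

(* The fiber of the spinor bundle at U is the quotient of A^N by this image. *)
Definition clifford_image (A : comAlgType k) (U : set 'cV[A]_n)
    : set 'cV[A]_N :=
  lin_span [set w | exists u s, U u /\ w = clifford_ext u *m s].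

Variable delta : 'cV[k]_N.

Definition zero_pt (A : comAlgType k)
    : set (pt (orthogonal_grassmannian 2 Q) A) :=
  [set U | clifford_image (sval (sval U)) (map_mx (in_alg A) delta)].

Fact zero_pull (A B : comAlgType k) (g : {lrmorphism A -> B})
    (U : pt (orthogonal_grassmannian 2 Q) A) :
  zero_pt U -> zero_pt (pull g U).
Proof.
have gin p q (M : 'M[k]_(p, q)) :
    map_mx g (map_mx (in_alg A) M) = map_mx (in_alg B) M.
  by apply/matrixP => i j; rewrite !mxE rmorph_alg.
move=> [m [M [a [UM dE]]]]; exists m, (map_mx g M), (map_mx g a); split.
  move=> j; have [u [s [Uu sE]]] := UM j.
  exists (map_mx g u), (map_mx g s); split.
    exists 1%N, (map_mx g u), 1%:M; rewrite mulmx1; split=> // i.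
    by exists u => //; rewrite -map_col; congr map_mx; apply/colP=> l; rewrite !mxE ord1.
  rewrite -map_col sE map_mxM; congr (_ *m _).
  rewrite /clifford_ext raddf_sum; apply: eq_bigr => i _.
  apply/matrixP => p q; rewrite !mxE.
  by apply: (etrans (rmorphM g _ _)); congr (_ * _); apply: rmorph_alg.
by rewrite -map_mxM -dE gin.
Qed.

(* Zero scheme of the section of the spinor bundle on OG(2, n) defined by
   delta: the pullback of the section to Spec A vanishes. *)
Definition zero_locus := SubKFunctor zero_pull.

End Spinor.

Definition zariski_open (k : fieldType) (N : nat) (O : set 'cV[k]_N) : Prop :=
  exists P : set (mpoly.mpoly N k),
    O = [set x | exists2 p, P p & mpoly.meval (fun i => x i 0) p != 0].

Definition general (k : fieldType) (N : nat) (P : 'cV[k]_N -> Prop) : Prop :=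
  exists O : set 'cV[k]_N, [/\ zariski_open O, O !=set0 & O `<=` P].

(* Main.v *)
Require Import Defs.
From HB Require Import structures.
From mathcomp Require Import fingroup perm.
From mathcomp Require Import all_boot all_order all_algebra closed_field ring.
From mathcomp Require Import boolp classical_sets reals.
From mathcomp Require Import complex.
From mathcomp Require mpoly.
Import (canonicals, coercions) mpoly.

Set Implicit Arguments.
Unset Strict Implicit.
Unset Printing Implicit Defensive.

Import Order.TTheory GRing.Theory Num.Theory.
Local Open Scope ring_scope.

(* A spinor delta vanishes at an isotropic plane U iff u u' delta = 0 for all u, u'
   in U.  Split V as X1 + Y1 + X2 + Y2 + <n>, where the isotropic spaces Xi and Yi
   have dimension 3 and are dual to each other.  Call this frame adapted to delta if
   delta is invariant under sl(X1) x sl(X2), so that products x y delta with x in Xi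
   and y in Yi only depend on the scalar product of x and y, while the other products
   of two frame vectors applied to delta are, together with delta, h1 delta, h2 delta
   and h1 h2 delta (h1, h2 being products of a dual pair from either block), a basis
   of the spin module.  Then u u' delta = 0 kills all components of the bivector of U
   outside the two spaces Xi (x) Yi, hence U is locally of the form L + M with L in
   Xi and M in Yi orthogonal to L, which is the flag of L in M^perp in Xi.

   It remains to see that the spinors with an adapted frame contain a nonempty open
   set.  One of them is written down in the Fock model.  Through each of them and in
   the direction of each vector of the basis above there is a line almost all of
   whose points are again such spinors: 1 + s a b lies in the spin group, and
   delta, h1 delta, h2 delta, h1 h2 delta span invariant spinors.  A polynomial
   vanishing on them thus has derivatives vanishing on them too, hence is 0 by
   induction on the degree.  So they are dense, and they are constructible by
   quantifier elimination. *)

(** * Dense definable subsets of affine space *)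

(** Two obstacles shape the argument. The claim concerns schemes, so a point is a direct summand
    over an arbitrary, possibly non-reduced algebra, and its rank is given only at residue fields.
    No local bases are chosen: a summand is handled through a projector [E], whose exterior powers
    are again idempotent, so that the minors beyond the rank vanish exactly and the trace is exactly
    the rank. The other obstacle is that the spin group alone cannot carry one spinor to a general
    one. The space so(V) delta is spanned by the sixty products and by h1 delta - delta/2 and h2
    delta - delta/2, of dimension 62 in a space of dimension 64. Therefore being adapted is, for a
    fixed frame, a linear condition on delta together with the nonvanishing of one determinant:
    delta can then also move along the four invariant directions while the frame stays put. The
    numbers fit because 78 pairs of frame vectors less 2 * 9 pairs in the spaces Xi (x) Yi leave 60,
    and 60 + 4 = 64, so that independence is the invertibility of a single square matrix. *)

Section LineDerivative.
Variables (K : fieldType) (n : nat) (y d : 'I_n -> K).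

Definition restrict_line (p : mpoly.mpoly n K) : {poly K} :=
  mpoly.mmap polyC (fun j => (y j)%:P + d j *: 'X) p.

Lemma restrict_line_horner p s :
  (restrict_line p).[s] = mpoly.meval (fun j => y j + s * d j) p.
Proof.
elim/mpoly.mpolyind: p => [|c m p _ _ IH].
  by rewrite /restrict_line mpoly.mmap0 horner0 mpoly.meval0.
rewrite /restrict_line mpoly.mmapD hornerD -/(restrict_line p) IH mpoly.mevalD.
congr (_ + _); rewrite mpoly.mmapZ mpoly.mevalZ hornerCM; congr (_ * _).
rewrite mpoly.mmapX mpoly.mevalX /mpoly.mmap1 horner_prod.
apply: eq_bigr => i _; rewrite horner_exp; congr (_ ^+ _).
by rewrite !hornerE mulrC.
Qed.

(** Chain rule. The identity is stable under products ([DM]), so the monomials reduce to the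
    variables. *)
Lemma deriv_restrict_line p :
  (restrict_line p)^`().[0] = \sum_j d j * mpoly.meval y (mpoly.mderiv j p).
Proof.
pose D (p : mpoly.mpoly n K) := (restrict_line p)^`().[0] =
  \sum_j d j * mpoly.meval y (mpoly.mderiv j p).
have r0 q : (restrict_line q).[0] = mpoly.meval y q.
  by rewrite restrict_line_horner; apply: mpoly.meval_eq => j; rewrite mul0r addr0.
have DM u q : D u -> D q -> D (u * q).
  rewrite /D /restrict_line rmorphM derivM hornerD !hornerM -!/(restrict_line _).
  move=> -> ->; rewrite !r0 mulr_suml mulr_sumr -big_split; apply: eq_bigr => j _ /=.
  by rewrite mpoly.mderivM mpoly.mevalD !mpoly.mevalM mulrDr !mulrA (mulrC (mpoly.meval y u)).
have D1 : D 1.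
  rewrite /D /restrict_line rmorph1 derivC horner0 big1 // => j _.
  by rewrite mpoly.mderivC mpoly.meval0 mulr0.
have DX i : D (mpoly.mpolyX K (mpoly.mnm1 i)).
  rewrite /D /restrict_line mpoly.mmapX mpoly.mmap1U derivD derivC derivZ derivX.
  rewrite !hornerE (bigD1 i) //= big1 ?addr0 => [|j ji]; rewrite mpoly.mderivX.
    rewrite mpoly.mevalZ mpoly.mnm1E eqxx.
    rewrite mpoly.mevalX big1 ?mulr1 // => k _.
    by rewrite mpoly.mnmBE subnn expr0.
  by rewrite mpoly.mnm1E eq_sym (negPf ji) scale0r mpoly.meval0 mulr0.
elim/mpoly.mpolyind: p => [|c m p _ _ IH].
  rewrite /restrict_line mpoly.mmap0 deriv0 horner0 big1 // => j _.
  by rewrite mpoly.mderiv0 mpoly.meval0 mulr0.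
rewrite /restrict_line mpoly.mmapD derivD hornerD [X in _ + X]IH.
have -> : \sum_j d j * mpoly.meval y (mpoly.mderiv j (c *: mpoly.mpolyX K m + p)) =
  c * (\sum_j d j * mpoly.meval y (mpoly.mderiv j (mpoly.mpolyX K m)))
   + \sum_j d j * mpoly.meval y (mpoly.mderiv j p).
  rewrite mulr_sumr -big_split; apply: eq_bigr => j _ /=.
  by rewrite mpoly.mderivD mpoly.mderivZ mpoly.mevalD mpoly.mevalZ mulrDr mulrCA.
congr (_ + _); rewrite mpoly.mmapZ mul_polyC derivZ hornerZ; congr (_ * _).
rewrite mpoly.mpolyXE_id -/(D _).
elim/big_ind: _ => // i _; elim: (m i) => [|k IHk]; first by rewrite expr0.
by rewrite exprS; apply: DM.
Qed.

End LineDerivative.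

Section Density.
Variables (K : numClosedFieldType) (n : nat).

(** A nonconstant monomial survives in some partial derivative, with its coefficient multiplied by a
    positive exponent; characteristic zero makes this multiple nonzero. *)
Lemma mderiv_eq0 (p : mpoly.mpoly n K) :
  (forall j, mpoly.mderiv j p = 0) -> exists c, p = mpoly.mpolyC n c.
Proof.
move=> dp; exists (mpoly.mcoeff (@mpoly.mnm0 n) p); apply/mpoly.mpolyP => m.
rewrite mpoly.mcoeffC; have [->|m0] := eqVneq m (@mpoly.mnm0 n); first by rewrite mulr1.
rewrite mulr0; have [i mi] : exists i, (m i != 0)%N.
  apply/existsP; rewrite -negb_forall; apply: contra m0 => /forallP m0.
  by apply/eqP/mpoly.mnmP => i; rewrite mpoly.mnm0E; apply/eqP; rewrite m0.
have := congr1 (mpoly.mcoeff (mpoly.mnm_sub m (mpoly.mnm1 i))) (dp i).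
rewrite mpoly.mcoeff_mderiv mpoly.mcoeff0 mpoly.submK; last first.
  by rewrite mpoly.lep1mP.
by move/eqP; rewrite mulrn_eq0 /= => /eqP.
Qed.

Lemma msize_mderiv_lt j (p : mpoly.mpoly n K) : p != 0 ->
  (mpoly.msize (mpoly.mderiv j p) < mpoly.msize p)%N.
Proof.
move=> p0; have [->|d0] := eqVneq (mpoly.mderiv j p) 0.
  by rewrite mpoly.msize0 lt0n mpoly.msize_poly_eq0.
rewrite mpoly.msizeE.
have p1 : (0 < mpoly.msize p)%N by rewrite lt0n mpoly.msize_poly_eq0.
rewrite -[X in (_ < X)%N](prednK p1) ltnS.
apply/bigmax_leqP_seq => m; rewrite mpoly.mcoeff_msupp mpoly.mcoeff_mderiv => h _.
rewrite -ltnS prednK //.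
have := @mpoly.msize_mdeg_lt _ _ p (mpoly.mnm_add m (mpoly.mnm1 j)).
rewrite mpoly.mcoeff_msupp mpoly.mdegD mpoly.mdeg1 addn1; apply.
by apply: contra h => /eqP ->; rewrite mul0rn.
Qed.

Lemma dense_of_lines (S : set 'cV[K]_n) : (exists y, S y) ->
  (forall y, S y -> exists2 B : 'M[K]_n, B \in unitmx & forall j,
     exists2 q : {poly K}, q != 0 & forall s, q.[s] != 0 -> S (y + s *: col j B)) ->
  forall p : mpoly.mpoly n K,
  (forall x : 'cV[K]_n, S x -> mpoly.meval (fun i => x i 0) p = 0) -> p = 0.
Proof.
move=> [y0 Sy0] lineS p.
have [k] := ubnP (mpoly.msize p); elim: k p => // k IH p pk pS.
have [//|p0] := eqVneq p 0.
have dp j : mpoly.mderiv j p = 0.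
  apply: IH => [|y Sy]; first by apply: leq_trans (msize_mderiv_lt j p0) _.
  have [B Bu Bline] := lineS y Sy.
  pose g : 'rV[K]_n := \row_j mpoly.meval (fun i => y i 0) (mpoly.mderiv j p).
  suff gB : g *m B = 0.
    have : g = 0 by rewrite -[g](mulmxK Bu) gB mul0mx.
    by move/rowP/(_ j); rewrite !mxE.
  apply/rowP => l; have [q q0 qS] := Bline l.
  pose r := restrict_line (fun i => y i 0) (fun i => B i l) p.
  (* Where [q] does not vanish the line lies in [S], so [r] vanishes there; thus [r * q] has every
     scalar as a root. This gives the derivative at [y] itself although [S] need not contain a
     neighbourhood of [y]. *)
  have r0 : r * q = 0.
    apply/eqP; apply: contraT => /closed_nonrootP[s]; rewrite rootE hornerM.
    rewrite mulf_eq0 negb_or => /andP[rs /qS Sys].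
    have := pS _ Sys; rewrite (@mpoly.meval_eq _ _ _ (fun i => y i 0 + s * B i l)).
      by rewrite -restrict_line_horner -/r => rs0; rewrite rs0 eqxx in rs.
    by move=> i; rewrite !mxE.
  have {}r0 : r = 0 by move/eqP: r0; rewrite mulf_eq0 (negPf q0) orbF => /eqP.
  have := deriv_restrict_line (fun i => y i 0) (fun i => B i l) p.
  rewrite -/r r0 deriv0 horner0 !mxE => /esym; apply: etrans.
  by apply: eq_bigr => i _; rewrite !mxE mulrC.
have [c pc] := mderiv_eq0 dp.
by have := pS _ Sy0; rewrite pc mpoly.mevalC => ->; rewrite mpoly.mpolyC0.
Qed.

End Density.

(** * Quantifier elimination and dense constructible sets *)

Section Definable.
Variables (K : numClosedFieldType) (n : nat).

Definition env (x : 'cV[K]_n) : seq K := [seq x i 0 | i <- enum 'I_n].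

(** Variables beyond [n] become 0 because reading past the end of [env x] yields 0. The value at
    [Inv] is arbitrary: [rterm] excludes it. *)
Fixpoint mpoly_of_term (t : GRing.term K) : mpoly.mpoly n K :=
  match t with
  | GRing.Var i => if insub i is Some j then mpoly.mpolyX K (mpoly.mnm1 j) else 0
  | GRing.Const c => mpoly.mpolyC n c
  | GRing.NatConst m => m%:R
  | GRing.Add a b => mpoly_of_term a + mpoly_of_term b
  | GRing.Opp a => - mpoly_of_term a
  | GRing.NatMul a m => mpoly_of_term a *+ m
  | GRing.Mul a b => mpoly_of_term a * mpoly_of_term b
  | GRing.Inv a => 0
  | GRing.Exp a m => mpoly_of_term a ^+ m
  end.

Lemma nth_env (x : 'cV[K]_n) (i : 'I_n) : (env x)`_i = x i 0.
Proof. by rewrite (nth_map i) ?nth_ord_enum // size_enum_ord. Qed.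

Lemma mpoly_of_termE t (x : 'cV[K]_n) : GRing.rterm t ->
  mpoly.meval (fun i => x i 0) (mpoly_of_term t) = GRing.eval (env x) t.
Proof.
elim: t => //=.
- move=> i _; case: insubP => [j _ <-|]; first by rewrite mpoly.mevalXU nth_env.
  by rewrite -leqNgt => ni; rewrite mpoly.meval0 nth_default // size_map size_enum_ord.
- by move=> c _; rewrite mpoly.mevalC.
- by move=> m _; rewrite rmorph_nat.
- by move=> a IHa b IHb /andP[/IHa <- /IHb <-]; rewrite mpoly.mevalD.
- by move=> a IHa /IHa <-; rewrite mpoly.mevalN.
- by move=> a IHa m /IHa <-; rewrite mpoly.mevalMn.
- by move=> a IHa b IHb /andP[/IHa <- /IHb <-]; rewrite mpoly.mevalM.
- by move=> a IHa m /IHa <-; rewrite rmorphXn.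
Qed.

(** After quantifier elimination the set is a finite union of clauses, each given by equations and
    inequations. If some clause has only trivial equations and no inequation with zero polynomial,
    the product of its inequations defines the open set. Otherwise the whole set lies in a
    hypersurface, against density. *)
Lemma definable_dense_open (f : GRing.formula K) : GRing.rformula f ->
  (forall p : mpoly.mpoly n K, (forall x : 'cV[K]_n, GRing.holds (env x) f ->
     mpoly.meval (fun i => x i 0) p = 0) -> p = 0) ->
  general (fun x : 'cV[K]_n => GRing.holds (env x) f).
Proof.
move=> rf dense.
pose qe := GRing.quantifier_elim (@ClosedFieldQE.ex_elim K) f.
have /andP[qf rq] : GRing.qf_form qe && GRing.rformula qe.
  exact: (GRing.quantifier_elim_wf (@ClosedFieldQE.wf_ex_elim K)).
have holdsE e : reflect (GRing.holds e f) (GRing.qf_eval e qe).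
  apply: GRing.quantifier_elim_rformP => //; first exact: ClosedFieldQE.wf_ex_elim.
  exact: (ClosedFieldQE.holds_ex_elim (@GRing.solve_monicpoly K)).
pose dnf := GRing.qf_to_dnf qe false.
have dnfr : all (@GRing.dnf_rterm _) dnf by apply: GRing.qf_to_dnf_rterm.
pose polys (bc : seq (GRing.term K) * seq (GRing.term K)) :=
  (map mpoly_of_term bc.1, map mpoly_of_term bc.2).
pose ev (x : 'cV[K]_n) (q : mpoly.mpoly n K) := mpoly.meval (fun i => x i 0) q.
have dnfE x : reflect (GRing.holds (env x) f)
    (has (fun bc => all (fun q => ev x q == 0) bc.1 &&
                    all (fun q => ev x q != 0) bc.2) (map polys dnf)).
  suff -> : has (fun bc => all (fun q => ev x q == 0) bc.1 &&
     all (fun q => ev x q != 0) bc.2) (map polys dnf) = GRing.qf_eval (env x) qe by [].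
  rewrite -(GRing.qf_to_dnfP (env x)) ?qf ?rq // -/dnf.
  elim: dnf dnfr => //= bc s IH /andP[/andP[r1 r2] rs].
  rewrite IH //; congr (_ || _); rewrite /polys /=; congr (_ && _).
    elim: bc.1 r1 => //= t l IHl /andP[rt rl].
    by rewrite IHl // /ev mpoly_of_termE.
  elim: bc.2 r2 => //= t l IHl /andP[rt rl].
  by rewrite IHl // /ev mpoly_of_termE.
pose good (bc : seq (mpoly.mpoly n K) * seq (mpoly.mpoly n K)) :=
  all (fun q => q == 0) bc.1 && all (fun q => q != 0) bc.2.
case gd : (has good (map polys dnf)); last first.
  exfalso; move/negbT/hasPn: gd => bad.
  (* A nonzero equation of the clause if there is one, and 1 otherwise. In the second case a bad
     clause contains the inequation of the zero polynomial and has no points, so in both cases the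
     product of the [pc bc] vanishes on the set. *)
  pose pc (bc : seq (mpoly.mpoly n K) * seq (mpoly.mpoly n K)) :=
    head 1 [seq q <- bc.1 | q != 0].
  have pc0 bc : pc bc != 0.
    rewrite /pc; have := filter_all (fun q => q != 0) bc.1.
    by case: filter => [|q s] /=; [rewrite oner_eq0|case/andP].
  have : \prod_(bc <- map polys dnf) pc bc = 0.
    apply: dense => x /dnfE/hasP[bc bcd /andP[/allP a1 /allP a2]].
    rewrite rmorph_prod; apply/eqP; rewrite prodf_seq_eq0; apply/hasP; exists bc => //=.
    have := bad _ bcd; rewrite /good negb_and => /orP[/allPn[q q1 q0]|/allPn[q q1]].
      have : pc bc \in [seq q <- bc.1 | q != 0].
        have : q \in [seq q <- bc.1 | q != 0] by rewrite mem_filter q0.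
        by rewrite /pc; case: filter => //= u s _; rewrite mem_head.
      by rewrite mem_filter => /andP[_]; apply: a1.
    by rewrite negbK => /eqP q0; have := a2 _ q1; rewrite /ev q0 mpoly.meval0 eqxx.
  by apply/eqP; rewrite prodf_seq_neq0; apply/allP => bc _; rewrite pc0 implybT.
have [bc bcd /andP[/allP g1 /allP g2]] := hasP gd.
pose q := \prod_(u <- bc.2) u.
have q0 : q != 0 by rewrite prodf_seq_neq0; apply/allP => u u2; apply: g2.
exists [set x | exists2 p, p = q & mpoly.meval (fun i => x i 0) p != 0]%classic; split.
- by exists [set q]%classic.
(* Density serves a second time: if the open set were empty, [q] would vanish at all points, hence
   be zero. *)
- apply/set0P; apply: contra_neq q0 => O0; apply: dense => x _.
  apply/eqP; apply: contraT => qx.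
  have : (set0 : set 'cV[K]_n) x by rewrite -O0; exists q.
  by [].
- move=> x [_ -> qx]; apply/dnfE/hasP; exists bc => //; apply/andP; split.
    by apply/allP => u /g1/eqP u0; rewrite /ev u0 mpoly.meval0.
  apply/allP => u u2; apply: contra qx => /eqP ux.
  by rewrite /q rmorph_prod prodf_seq_eq0; apply/hasP; exists u => //; apply/eqP.
Qed.

End Definable.

(** * Idempotent matrices of constant rank *)

Section ResidueField.
Variables (A : comNzRingType) (m : idealr A).
Hypothesis maxm : forall x, x \notin m -> exists y, 1 - x * y \in m.

(** The type carries the proof that [m] is maximal, which lets the field structure be attached to it
    as a canonical instance. *)
Definition residue_field of (forall x, x \notin m -> exists y, 1 - x * y \in m) :=
  {ideal_quot m}.
Notation k := (residue_field maxm).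
HB.instance Definition _ := GRing.ComNzRing.on k.

Definition residue : A -> k := fun x => \pi_{ideal_quot m}%qT x.

Fact residue_zmod : zmod_morphism residue.
Proof. by move=> x y; rewrite /residue rmorphB. Qed.
Fact residue_monoid : monoid_morphism residue.
Proof. by split=> [|x y]; rewrite /residue ?rmorph1 ?rmorphM. Qed.
HB.instance Definition _ := GRing.isZmodMorphism.Build A k residue residue_zmod.
HB.instance Definition _ := GRing.isMonoidMorphism.Build A k residue residue_monoid.

Lemma residue_eq0 x : (residue x == 0) = (x \in m).
Proof.
rewrite -(rmorph0 residue) /residue.
by rewrite -[in RHS](subr0 x) -Quotient.equivE -Quotient.idealrBE.
Qed.

Fact residue_inv (x : k) : exists y, if x == 0 then y = 0 else y * x = 1.
Proof.
have [_|x0] := eqVneq x 0; first by exists 0.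
have [a xE] : exists a, residue a = x by exists (generic_quotient.repr x); apply: reprK.
have [|y] := @maxm a; first by rewrite -residue_eq0 xE.
rewrite -residue_eq0 rmorphB rmorph1 rmorphM /= xE subr_eq0 => /eqP xy.
by exists (residue y); rewrite mulrC.
Qed.

Definition inv_residue (x : k) : k := projT1 (cid (residue_inv x)).

Fact mul_inv_residue (x : k) : x != 0 -> inv_residue x * x = 1.
Proof. by rewrite /inv_residue; case: cid => y /=; case: ifP. Qed.
Fact inv_residue0 : inv_residue 0 = 0.
Proof. by rewrite /inv_residue; case: cid => y /=; rewrite eqxx. Qed.

HB.instance Definition _ :=
  GRing.ComNzRing_isField.Build k mul_inv_residue inv_residue0.

End ResidueField.

Local Open Scope classical_set_scope.

(** A non-unit lies in a maximal ideal, found by Zorn, and dies in the residue field. *)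
Lemma unit_of_residues (A : comNzRingType) (d : A) :
  (forall (K : fieldType) (psi : {rmorphism A -> K}), psi d != 0) ->
  exists d', d * d' = 1.
Proof.
move=> dK; apply: contrapT => dN.
(* Proper ideals containing [d], together with the empty set: the first clause says that [X]
   contains [d] as soon as it is inhabited. This admits the union of the empty chain; maximality
   then makes [M] inhabited, since the multiples of [d] form a larger candidate. *)
pose P (X : set A) := [/\ forall x, X x -> X d, forall x y, X x -> X y -> X (x + y),
  forall a x, X x -> X (a * x) & ~ X 1].
have [F FP Ftot|M [[Md MD MM M1] Mmax]] := @Zorn_bigcup A P.
  split.
  - by move=> x [X FX Xx]; exists X => //; have [+ _ _ _] := FP _ FX; apply; apply: Xx.
  - move=> x y [X FX Xx] [Y FY Yy]; have [XY|YX] := Ftot _ _ FX FY.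
      by exists Y => //; have [_ + _ _] := FP _ FY; apply => //; apply: XY.
    by exists X => //; have [_ + _ _] := FP _ FX; apply => //; apply: YX.
  - by move=> a x [X FX Xx]; exists X => //; have [_ _ + _] := FP _ FX; apply.
  - by move=> [X FX X1]; have [_ _ _] := FP _ FX; apply.
have [x Mx] : exists x, M x.
  apply: contrapT => M0; apply: (Mmax [set x | exists y, x = d * y]).
    split=> [x Mx|]; first by case: M0; exists x.
    by move=> /(_ d) h; apply: M0; exists d; apply: h; exists 1; rewrite mulr1.
  split.
  - by move=> *; exists 1; rewrite mulr1.
  - by move=> _ _ [x ->] [y ->]; exists (x + y); rewrite mulrDr.
  - by move=> a _ [x ->]; exists (a * x); rewrite mulrCA.
  - by move=> [y dy]; apply: dN; exists y.
pose S : pred A := fun x => `[<M x>].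
have SP u : reflect (M u) (u \in S) by apply: asboolP.
have M0 : M 0 by rewrite -(mul0r x); apply: MM.
have Sideal : idealr_closed S.
  split=> [||a u v /SP Mu /SP Mv]; [by apply/SP|by apply/negP => /SP|].
  by apply/SP/MD => //; apply: MM.
pose sI := isIdealr.Build A S Sideal.
pose I : idealr A := HB.pack S sI.
(* Otherwise M + uA would be a strictly larger proper ideal. *)
have maxI u : u \notin I -> exists y, 1 - u * y \in I.
  move=> /SP uM; apply: contrapT => uN.
  apply: (Mmax [set v | exists2 w, M w & exists y, v = w + u * y]).
    split=> [v Mv|h]; first by exists v => //; exists 0; rewrite mulr0 addr0.
    by apply: uM; apply: h; exists 0 => //; exists 1; rewrite mulr1 add0r.
  split.
  - move=> *; exists d; first exact: Md Mx.
    by exists 0; rewrite mulr0 addr0.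
  - move=> _ _ [w1 Mw1 [y1 ->]] [w2 Mw2 [y2 ->]]; exists (w1 + w2); first exact: MD.
    by exists (y1 + y2); rewrite mulrDr addrACA.
  - move=> a _ [w Mw [y ->]]; exists (a * w); first exact: MM.
    by exists (a * y); rewrite mulrDr (mulrCA a u).
  - by move=> [w Mw [y wy]]; apply: uN; exists y; apply/SP; rewrite wy addrK.
have := dK _ (residue maxI : {rmorphism A -> residue_field maxI}).
by rewrite residue_eq0 => /SP; apply; apply: Md Mx.
Qed.

Local Close Scope classical_set_scope.

(* A finite idempotent matrix with entries in the Jacobson radical vanishes,
   because det (1 - F) is a unit killing F. *)
Lemma idempotent_eq0 (A : comNzRingType) n (F : 'M[A]_n) : F *m F = F ->
  (forall (K : fieldType) (psi : {rmorphism A -> K}), map_mx psi F = 0) -> F = 0.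
Proof.
move=> FF F0; have [K psi|d' dd'] := @unit_of_residues A (\det (1%:M - F)).
  by rewrite -det_map_mx map_mxB F0 subr0 map_mx1 det1 oner_eq0.
have F1 : (1%:M - F) *m F = 0 by rewrite mulmxBl mul1mx FF subrr.
have dF : \det (1%:M - F) *: F = 0.
  by rewrite -mul_scalar_mx -mul_adj_mx -mulmxA F1 mulmx0.
by rewrite -[F]scale1r -dd' mulrC -scalerA dF scaler0.
Qed.

(* Cauchy-Binet, summing over all maps instead of the increasing ones. *)
Lemma det_mulmx_sum (A : comNzRingType) r n (B : 'M[A]_(r, n)) (C : 'M[A]_(n, r)) :
  \sum_(u : {ffun 'I_r -> 'I_n}) \det (colsub u B) * \det (rowsub u C)
  = \det (B *m C) *+ r`!.
Proof.
have detBC : \det (B *m C) =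
    \sum_(u : {ffun 'I_r -> 'I_n}) (\prod_i B i (u i)) * \det (rowsub u C).
  rewrite /determinant.
  under eq_bigr => s _.
    under eq_bigr => i _ do rewrite mxE.
    rewrite bigA_distr_bigA mulr_sumr /=.
    over.
  rewrite exchange_big; apply: eq_bigr => u _ /=.
  rewrite mulr_sumr; apply: eq_bigr => s _; rewrite mulrCA; congr (_ * _).
  rewrite -big_split /=; apply: eq_bigr => i _; by rewrite !mxE.
have -> : \det (B *m C) *+ r`! = \sum_(s : 'S_r) \det (B *m C).
  by rewrite sumr_const card_Sn.
under [RHS]eq_bigr => s _ do rewrite detBC.
transitivity (\sum_(u : {ffun 'I_r -> 'I_n}) \sum_(s : 'S_r)
   (\prod_i B i (u (s i))) * ((-1) ^+ s * \det (rowsub u C))).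
  apply: eq_bigr => u _; rewrite /(\det (colsub _ _)) mulr_suml.
  apply: eq_bigr => s _; rewrite -mulrA mulrCA; congr (_ * _).
  by apply: eq_bigr => i _; rewrite mxE.
rewrite exchange_big /=; apply: eq_bigr => s _.
pose h (u : {ffun 'I_r -> 'I_n}) := [ffun i => u (s i)].
have hb : bijective h.
  exists (fun u : {ffun 'I_r -> 'I_n} => [ffun i => u ((s^-1)%g i)]) => u;
    apply/ffunP => i; by rewrite !ffunE ?permK ?permKV.
rewrite [RHS](reindex h) /=; last exact: onW_bij.
apply: eq_bigr => u _; congr (_ * _).
  by apply: eq_bigr => i _; rewrite ffunE.
have -> : rowsub (h u) C = row_perm s (rowsub u C).
  by apply/matrixP => i j; rewrite !mxE ffunE.
by rewrite row_permE det_mulmx det_perm.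
Qed.

Section Summand.
Variables (k : numFieldType) (A : comAlgType k).

Lemma natr_unit n : exists a : A, n.+1%:R * a = 1.
Proof.
exists (in_alg A n.+1%:R^-1); rewrite -(rmorph_nat (in_alg A)) -rmorphM.
by rewrite mulfV ?rmorph1 ?pnatr_eq0.
Qed.

Lemma mulrSn_eq0 (n : nat) (a : A) : a *+ n.+1 = 0 -> a = 0.
Proof.
have [b nb] := natr_unit n => an; rewrite -[a]mul1r -nb mulrAC mulr_natl an.
by rewrite mul0r.
Qed.

(** The minors of size [r.+1], indexed by all maps and divided by (r+1)!, form a matrix [F] that is
    idempotent by Cauchy-Binet: it represents the exterior power of [E]. At residue fields it
    vanishes because the rank is [r], and an idempotent with this property is zero, even over a
    non-reduced ring. *)
Lemma summand_minors r n (E : 'M[A]_n) : E *m E = E ->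
  (forall (K : fieldType) (psi : {rmorphism A -> K}), \rank (map_mx psi E) = r) ->
  forall f g : 'I_r.+1 -> 'I_n, \det (mxsub f g E) = 0.
Proof.
move=> EE rE f g.
pose T : finType := {ffun 'I_r.+1 -> 'I_n}.
have [w ww] := natr_unit (r.+1`!).-1; rewrite prednK ?fact_gt0 // in ww.
pose F : 'M[A]_#|T| :=
  \matrix_(i, j) (w * \det (mxsub (enum_val i : T) (enum_val j : T) E)).
have FF : F *m F = F.
  apply/matrixP => i j; rewrite !mxE.
  rewrite (reindex (@enum_rank T)) /=; last exact/onW_bij/enum_rank_bij.
  transitivity (w * w * \sum_(u : T) \det (colsub u (rowsub (enum_val i : T) E)) *
      \det (rowsub u (colsub (enum_val j : T) E))).
    rewrite mulr_sumr; apply: eq_bigr => u _; rewrite !mxE enum_rankK mulrACA.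
    congr (_ * (_ * _)).
      by congr (\det _); apply/matrixP => a b; rewrite !mxE.
    by congr (\det _); apply/matrixP => a b; rewrite !mxE.
  rewrite det_mulmx_sum -mulr_natl !mulrA -(mulrA w) [w * _%:R]mulrC ww mulr1.
  congr (_ * \det _); rewrite -[in RHS]EE.
  by apply/matrixP => a b; rewrite !mxE; apply: eq_bigr => l _; rewrite !mxE.
have F0 : F = 0.
  apply: idempotent_eq0 => // K psi; apply/matrixP => i j; rewrite !mxE rmorphM.
  rewrite -det_map_mx; set M := map_mx _ _.
  suff -> : \det M = 0 by rewrite mulr0.
  apply/eqP; rewrite -[_ == 0]negbK -unitfE -unitmxE -row_free_unit /row_free.
  rewrite neq_ltn ltnS -[X in (_ <= X)%N](rE K psi).
  have -> : M = rowsub (enum_val i : T) (col_base (map_mx psi E)) *m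
                colsub (enum_val j : T) (row_base (map_mx psi E)).
    apply/matrixP => a b; rewrite !mxE.
    have /matrixP/(_ (enum_val i a) (enum_val j b)) := mulmx_base (map_mx psi E).
    by rewrite !mxE => <-; apply: eq_bigr => l _; rewrite !mxE.
  by rewrite (leq_trans (mxrankM_maxl _ _)) ?rank_leq_col.
have := congr1 (fun M : 'M_#|T| => M (enum_rank (finfun f : T)) (enum_rank (finfun g : T))) F0.
rewrite !mxE !enum_rankK => wd.
rewrite -[LHS]mul1r -ww -mulrA.
have -> : mxsub f g E = mxsub (finfun f : T) (finfun g : T) E.
  by apply/matrixP => a b; rewrite !mxE !ffunE.
by rewrite wd mulr0.
Qed.

Lemma residue_natr_inj (K : fieldType) (psi : {rmorphism A -> K}) m n :
  m%:R = n%:R :> K -> m = n.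
Proof.
wlog mn : m n / (m <= n)%N => [th|].
  by have [/th//|/ltnW/th h /esym/h] := leqP m n.
move=> /esym/eqP; rewrite -subr_eq0 -natrB //.
case d : (n - m)%N => [|l]; first by move/eqP: d; rewrite subn_eq0 => nm _; apply/eqP; rewrite eqn_leq mn.
have [a la] := natr_unit l; move=> /eqP l0.
have := congr1 psi la; rewrite rmorphM rmorph_nat l0 mul0r rmorph1 => /esym/eqP.
by rewrite oner_eq0.
Qed.

Lemma mxtrace_idem (K : fieldType) n (E : 'M[K]_n) :
  E *m E = E -> \tr E = (\rank E)%:R.
Proof.
(* For a full rank factorization E = C R with one-sided inverses C' and R', cancelling in C' E E R'
   = C' E R' turns idempotence into R C = 1, whose trace is the rank. *)
move=> EE; have key r (C : 'M[K]_(n, r)) (R : 'M_(r, n)) C' R' : C *m R = E ->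
    C' *m C = 1%:M -> R *m R' = 1%:M -> R *m C = 1%:M.
  move=> CR CC RR; transitivity (C' *m (C *m R) *m (C *m R) *m R').
    by rewrite !mulmxA CC mul1mx -!mulmxA RR mulmx1.
  by rewrite CR -(mulmxA C') EE -CR !mulmxA CC mul1mx RR.
rewrite -{1}(mulmx_base E) mxtrace_mulC.
rewrite (key _ _ _ _ _ (mulmx_base E) (mulVpmx (col_base_full E))
  (mulmxVp (row_base_free E))).
by rewrite mxtrace1.
Qed.

Lemma rank_of_trace r n (E : 'M[A]_n) : E *m E = E -> \tr E = r%:R ->
  forall (K : fieldType) (psi : {rmorphism A -> K}), \rank (map_mx psi E) = r.
Proof.
move=> EE trE K psi; apply: (residue_natr_inj psi).
rewrite -mxtrace_idem -?map_mxM ?EE // -(rmorph_nat psi) -trE.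
by rewrite /mxtrace rmorph_sum; apply: eq_bigr => i _; rewrite mxE.
Qed.

Lemma det_mx2 (M : 'M[A]_2) : \det M = M 0 0 * M 1 1 - M 0 1 * M 1 0.
Proof.
rewrite (expand_det_row _ 0) !big_ord_recl big_ord0 addr0 /cofactor !det_mx11 !mxE.
rewrite !(add0n, expr0, expr1, mul1r, mulN1r, mulrN).
by congr (_ * M _ _ - M _ _ * M _ _); apply: val_inj.
Qed.

Lemma det_mx3 (M : 'M[A]_3) : \det M =
  M 0 0 * (M 1 1 * M 2 2 - M 1 2 * M 2 1) - M 0 1 * (M 1 0 * M 2 2 - M 1 2 * M 2 0)
  + M 0 2 * (M 1 0 * M 2 1 - M 1 1 * M 2 0).
Proof.
rewrite (expand_det_row _ 0) !big_ord_recl big_ord0 addr0 /cofactor !det_mx2 !mxE.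
rewrite !(add0n, expr0, expr1, expr2, mul1r, mulN1r, mulrN, opprK).
rewrite addrA; congr (_ * (M _ _ * M _ _ - M _ _ * M _ _) - M _ _ *
  (M _ _ * M _ _ - M _ _ * M _ _) + M _ _ *
  (M _ _ * M _ _ - M _ _ * M _ _)); exact: val_inj.
Qed.

End Summand.

Section SummandTrace.
Variables (k : numFieldType) (A : comAlgType k) (n : nat).
Implicit Types E : 'M[A]_n.

Lemma residue_trace r E : E *m E = E ->
  (forall (K : fieldType) (psi : {rmorphism A -> K}), \rank (map_mx psi E) = r) ->
  forall (K : fieldType) (psi : {rmorphism A -> K}), psi (\tr E) = r%:R.
Proof.
move=> EE rE K psi; rewrite -(rE K psi) -mxtrace_idem -?map_mxM ?EE //.
by rewrite /mxtrace rmorph_sum; apply: eq_bigr => i _; rewrite mxE.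
Qed.

Lemma mul_eq0_residue (x y : A) : x * y = 0 ->
  (forall (K : fieldType) (psi : {rmorphism A -> K}), psi y != 0) -> x = 0.
Proof.
move=> xy /unit_of_residues[y' yy']; by rewrite -[x]mulr1 -yy' mulrA xy mul0r.
Qed.

Lemma tr_mulmxE (B C : 'M[A]_n) : \tr (B *m C) = \sum_i \sum_j B i j * C j i.
Proof. by apply: eq_bigr => i _; rewrite mxE. Qed.

Lemma rank1_minors E : E *m E = E ->
  (forall (K : fieldType) (psi : {rmorphism A -> K}), \rank (map_mx psi E) = 1%N) ->
  forall i j a b, E i a * E j b = E i b * E j a.
Proof.
move=> EE rE i j a b.
have := summand_minors EE rE (fun p => if p == 0 then i else j)
  (fun p => if p == 0 then a else b).
by rewrite det_mx2 !mxE /= => /eqP; rewrite subr_eq0 => /eqP.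
Qed.

(** Summing the vanishing 2 x 2 minors and using that [E] is idempotent gives t * t = t for the
    trace [t], which is a unit since its residues are all 1. *)
Lemma rank1_trace E : E *m E = E ->
  (forall (K : fieldType) (psi : {rmorphism A -> K}), \rank (map_mx psi E) = 1%N) ->
  \tr E = 1.
Proof.
move=> EE rE; apply/eqP; rewrite -subr_eq0; apply/eqP.
apply: (@mul_eq0_residue _ (\tr E)) => [|K psi]; last first.
  by rewrite (residue_trace EE rE) oner_eq0.
suff tt : \tr E * \tr E = \tr E by rewrite mulrBl mul1r tt subrr.
rewrite -[RHS](congr1 mxtrace EE) tr_mulmxE mulr_suml; apply: eq_bigr => i _.
by rewrite mulr_sumr; apply: eq_bigr => j _; apply: rank1_minors.
Qed.

(** The sum over all indices of the vanishing principal 3 x 3 minors is t^3 - 3 t^2 + 2 t = (t - 2)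
    * (t * (t - 1)), where t is the trace. The last factor has residue 2 everywhere, hence is a
    unit. *)
Lemma rank2_trace E : E *m E = E ->
  (forall (K : fieldType) (psi : {rmorphism A -> K}), \rank (map_mx psi E) = 2%N) ->
  \tr E = 2%:R.
Proof.
move=> EE rE; apply/eqP; rewrite -subr_eq0; apply/eqP; set t := \tr E.
apply: (@mul_eq0_residue _ (t * (t - 1))) => [|K psi]; last first.
  rewrite rmorphM rmorphB rmorph1 (residue_trace EE rE).
  rewrite -(natrB _ (n:=1)) // mulr1 -[X in _ != X](rmorph0 psi) -(rmorph_nat psi).
  have [a a1] := natr_unit A 1; apply/eqP => /(congr1 (fun x => x * psi a)).
  by rewrite rmorph0 mul0r -rmorphM a1 rmorph1 => /eqP; rewrite oner_eq0.
have minor i j l :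
  E i i * (E j j * E l l - E j l * E l j) - E i j * (E j i * E l l - E j l * E l i)
  + E i l * (E j i * E l j - E j j * E l i) = 0.
  pose f (p : 'I_3) := if p == 0 then i else if p == 1 then j else l.
  by have := summand_minors EE rE f f; rewrite det_mx3 !mxE.
have trE2 : \sum_i \sum_j E i j * E j i = t by rewrite -tr_mulmxE EE.
have trE3 : \sum_i \sum_j \sum_l E i j * E j l * E l i = t.
  transitivity (\tr (E *m E *m E)); last by rewrite !EE.
  rewrite tr_mulmxE; apply: eq_bigr => i _; rewrite exchange_big /=.
  by apply: eq_bigr => l _; rewrite mxE mulr_suml.
have : \sum_i \sum_j \sum_l (E i i * (E j j * E l l - E j l * E l j)
   - E i j * (E j i * E l l - E j l * E l i)
   + E i l * (E j i * E l j - E j j * E l i)) = 0.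
  by rewrite big1 // => i _; rewrite big1 // => j _; rewrite big1.
have -> : \sum_i \sum_j \sum_l (E i i * (E j j * E l l - E j l * E l j)
   - E i j * (E j i * E l l - E j l * E l i)
   + E i l * (E j i * E l j - E j j * E l i)) =
  \sum_i \sum_j \sum_l E i i * E j j * E l l - \sum_i \sum_j \sum_l E i i * (E j l * E l j)
  - \sum_i \sum_j \sum_l (E i j * E j i) * E l l
  + \sum_i \sum_j \sum_l E i j * E j l * E l i
  + \sum_i \sum_j \sum_l E i l * E l j * E j i - \sum_i \sum_j \sum_l E i l * E l i * E j j.
  rewrite -!(sumrB, big_split) /=; apply: eq_bigr => i _.
  rewrite -!(sumrB, big_split) /=; apply: eq_bigr => j _.
  rewrite -!(sumrB, big_split) /=; apply: eq_bigr => l _.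
  ring.
have -> : \sum_i \sum_j \sum_l E i i * E j j * E l l = t * t * t.
  rewrite /t /mxtrace -mulrA mulr_suml; apply: eq_bigr => i _.
  rewrite mulr_suml mulr_sumr; apply: eq_bigr => j _.
  by rewrite mulrA mulr_sumr.
have -> : \sum_i \sum_j \sum_l E i i * (E j l * E l j) = t * t.
  rewrite -{2}trE2 /t /mxtrace mulr_suml; apply: eq_bigr => i _.
  by rewrite mulr_sumr; apply: eq_bigr => j _; rewrite mulr_sumr.
have -> : \sum_i \sum_j \sum_l (E i j * E j i) * E l l = t * t.
  rewrite -{1}trE2 mulr_suml; apply: eq_bigr => i _.
  by rewrite mulr_suml; apply: eq_bigr => j _; rewrite /t /mxtrace mulr_sumr.
have -> : \sum_i \sum_j \sum_l E i l * E l i * E j j = t * t.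
  rewrite -{1}trE2 mulr_suml; apply: eq_bigr => i _; rewrite exchange_big /=.
  by rewrite mulr_suml; apply: eq_bigr => j _; rewrite /t /mxtrace mulr_sumr.
have -> : \sum_i \sum_j \sum_l E i l * E l j * E j i = t.
  by rewrite -[RHS]trE3; apply: eq_bigr => i _; rewrite exchange_big.
rewrite trE3 => <-; ring.
Qed.

End SummandTrace.

Lemma lin_span_sum (A : comNzRingType) n (S : set 'cV[A]_n) m (x : 'I_m -> 'cV[A]_n) :
  (forall j, S (x j)) -> lin_span S (\sum_j x j).
Proof.
move=> Sx; exists m, (\matrix_(i, j) x j i 0), (const_mx 1); split=> [j|].
  by have -> : col j (\matrix_(i, j) x j i 0) = x j by apply/colP => i; rewrite !mxE.
apply/colP => i; rewrite summxE mxE; apply: eq_bigr => j _.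
by rewrite !mxE mulr1.
Qed.

(** * Vanishing of a spinor at an isotropic plane *)

Section CliffordExt.
Variables (k : numFieldType) (n N : nat) (Q : 'M[k]_n).
Variable c : {linear 'cV[k]_n -> 'M[k]_N}.
Hypothesis cliff : clifford_action Q c.
Variable A : comAlgType k.
Notation ext := (@clifford_ext k n N c A).
Notation inA := (map_mx (in_alg A)).

Lemma clifford_extD u v : ext (u + v) = ext u + ext v.
Proof.
rewrite /clifford_ext -big_split; apply: eq_bigr => i _ /=.
by rewrite mxE scalerDl.
Qed.

Lemma clifford_extZ a u : ext (a *: u) = a *: ext u.
Proof.
by rewrite /clifford_ext scaler_sumr; apply: eq_bigr => i _; rewrite mxE scalerA.
Qed.

Lemma clifford_ext0 : ext 0 = 0.
Proof. by rewrite -(scale0r 0) clifford_extZ scale0r. Qed.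

Lemma clifford_ext_sum I (r : seq I) (P : pred I) (F : I -> 'cV[A]_n) :
  ext (\sum_(i <- r | P i) F i) = \sum_(i <- r | P i) ext (F i).
Proof.
apply: (big_morph ext clifford_extD clifford_ext0).
Qed.

Lemma clifford_ext_map v : ext (inA v) = inA (c v).
Proof.
have vE : v = \sum_i v i 0 *: delta_mx i 0.
  by rewrite [LHS]matrix_sum_delta; apply: eq_bigr => i _; rewrite big_ord1.
rewrite {2}vE linear_sum raddf_sum /clifford_ext; apply: eq_bigr => i _ /=.
by apply/matrixP => a b; rewrite linearZ !mxE rmorphM.
Qed.

Lemma clifford_ext_mulmx m (G : 'M[A]_(n, m)) t :
  ext (G *m t) = \sum_j t j 0 *: ext (col j G).
Proof.
have -> : G *m t = \sum_j t j 0 *: col j G.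
  apply/colP => i; rewrite mxE summxE; apply: eq_bigr => j _.
  by rewrite !mxE mulrC.
by rewrite clifford_ext_sum; apply: eq_bigr => j _; rewrite clifford_extZ.
Qed.

Definition clifford_polar (u v : 'cV[A]_n) : A := (u^T *m inA (Q + Q^T) *m v) 0 0.

Lemma clifford_polarE u v :
  clifford_polar u v = \sum_i \sum_j u i 0 * v j 0 * (Q i j + Q j i)%:A.
Proof.
rewrite /clifford_polar mxE exchange_big; apply: eq_bigr => j _ /=.
rewrite mxE mulr_suml; apply: eq_bigr => i _.
by rewrite !mxE mulrAC.
Qed.

Lemma clifford_polarization u v :
  c u *m c v + c v *m c u = ((u^T *m (Q + Q^T) *m v) 0 0)%:M.
Proof.
have qD : qform Q (u + v) = qform Q u + (u^T *m (Q + Q^T) *m v) 0 0 + qform Q v.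
  rewrite /qform [(_ + _)^T]raddfD mulmxDl mulmxDr !mulmxDl mulmxDr mulmxDl.
  have -> : u^T *m Q^T *m v = (v^T *m Q *m u)^T.
    by rewrite !trmx_mul trmxK mulmxA.
  move: (u^T *m Q *m u) (u^T *m Q *m v) (v^T *m Q *m u) (v^T *m Q *m v) => a1 a2 a3 a4.
  by rewrite !mxE; ring.
move: ((u^T *m (Q + Q^T) *m v) 0 0) qD => b qD.
have := cliff (u + v); rewrite linearD mulmxDl !mulmxDr !cliff qD => e.
transitivity ((qform Q u + b + qform Q v)%:M - (qform Q u)%:M - (qform Q v)%:M :> 'M[k]_N).
  by rewrite -e !addrA [RHS]addrAC addrK [RHS]addrAC [_%:M + _]addrC addrK.
move: (qform Q u) (qform Q v) => x y.
by apply/matrixP => i j; rewrite !mxE; case: (i == j); rewrite ?mulr1n ?mulr0n; ring.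
Qed.

Lemma clifford_anticomm u v :
  ext u *m ext v + ext v *m ext u = (clifford_polar u v)%:M.
Proof.
have q_delta i j : c (delta_mx i 0) *m c (delta_mx j 0)
    + c (delta_mx j 0) *m c (delta_mx i 0) = (Q i j + Q j i)%:M.
  by rewrite clifford_polarization -colE trmx_delta -rowE !mxE.
rewrite /clifford_ext !mulmx_suml.
under eq_bigr do rewrite mulmx_sumr.
under [X in _ + X]eq_bigr do rewrite mulmx_sumr.
rewrite [X in _ + X]exchange_big clifford_polarE -big_split raddf_sum /=.
apply: eq_bigr => i _; rewrite -big_split raddf_sum /=; apply: eq_bigr => j _.
rewrite -!scalemxAl -!scalemxAr !scalerA (mulrC (v j 0)) -scalerDr -!map_mxM -map_mxD q_delta.
apply/matrixP => a b; rewrite !mxE; case: (a == b); rewrite ?mulr1n ?mulr0n /=; first by [].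
by rewrite scale0r mulr0.
Qed.

Lemma clifford_polarC u v : clifford_polar u v = clifford_polar v u.
Proof.
rewrite !clifford_polarE exchange_big; apply: eq_bigr => i _; apply: eq_bigr => j _ /=.
by rewrite (mulrC (u j 0)) addrC.
Qed.

Lemma clifford_polarDl u1 u2 v :
  clifford_polar (u1 + u2) v = clifford_polar u1 v + clifford_polar u2 v.
Proof. by rewrite /clifford_polar raddfD !mulmxDl mxE. Qed.

Lemma clifford_polarDr u v1 v2 :
  clifford_polar u (v1 + v2) = clifford_polar u v1 + clifford_polar u v2.
Proof. by rewrite !(clifford_polarC u) clifford_polarDl. Qed.

Lemma clifford_polar_qform u v : clifford_polar u v =
  qform (inA Q) (u + v) - qform (inA Q) u - qform (inA Q) v.
Proof.
rewrite /qform [(_ + _)^T]raddfD mulmxDl mulmxDr !mulmxDl /= /clifford_polar.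
rewrite map_mxD mulmxDr mulmxDl.
have -> : (u^T *m inA Q^T *m v) = (v^T *m inA Q *m u)^T.
  by rewrite !trmx_mul trmxK -map_trmx mulmxA.
by rewrite !mxE; ring.
Qed.

Lemma qform_polar u : clifford_polar u u = qform (inA Q) u *+ 2.
Proof.
rewrite /clifford_polar map_mxD mulmxDr mulmxDl mxE mulr2n; congr (_ + _).
have -> : (u^T *m inA Q^T *m u) = (u^T *m inA Q *m u)^T.
  by rewrite !trmx_mul trmxK -map_trmx mulmxA.
by rewrite mxE.
Qed.

Section Criterion.
Variables (E : 'M[A]_n) (delta : 'cV[A]_N).
Hypothesis EE : E *m E = E.
Hypothesis isoE : forall u, E *m u = u -> qform (inA Q) u = 0.

Lemma isotropic_polar u v : E *m u = u -> E *m v = v -> clifford_polar u v = 0.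
Proof.
by move=> Eu Ev; rewrite clifford_polar_qform !isoE ?subr0 // mulmxDr Eu Ev.
Qed.

Lemma isotropic_anticomm u v : E *m u = u -> E *m v = v ->
  ext u *m ext v = - (ext v *m ext u).
Proof.
move=> Eu Ev; apply/eqP; rewrite -addr_eq0 clifford_anticomm.
by rewrite isotropic_polar // raddf0.
Qed.

Hypothesis rE : forall (K : fieldType) (psi : {rmorphism A -> K}),
  \rank (map_mx psi E) = 2%N.

(** The 3 x 3 minors of the matrix with columns [u], [v], [w] are, up to the invertible factor 3!,
    combinations of 3 x 3 minors of [E], hence vanish. So the antisymmetrized triple product is
    zero; isotropic vectors anticommute, and this antisymmetrization is six times the product. *)
Lemma clifford_triple_eq0 u v w : E *m u = u -> E *m v = v -> E *m w = w ->
  ext u *m ext v *m ext w = 0.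
Proof.
move=> Eu Ev Ew.
pose W : 'M[A]_(n, 3) :=
  \matrix_(i, q) (if q == 0 then u i 0 else if q == 1 then v i 0 else w i 0).
have EW : E *m W = W.
  apply/matrixP => i q; rewrite !mxE.
  under eq_bigr do rewrite mxE.
  case: (q == 0); first by rewrite -[in RHS]Eu mxE.
  by case: (q == 1); [rewrite -[in RHS]Ev mxE | rewrite -[in RHS]Ew mxE].
have minor (f : 'I_3 -> 'I_n) : \det (rowsub f W) = 0.
  have -> : rowsub f W = rowsub f E *m W.
    apply/matrixP => i q; rewrite -[in LHS]EW !mxE.
    by apply: eq_bigr => l _; rewrite !mxE.
  apply: (@mulrSn_eq0 k A (3`!).-1).
  rewrite prednK ?fact_gt0 // -det_mulmx_sum big1 // => g _.
  have -> : colsub g (rowsub f E) = mxsub f g E by apply/matrixP => i j; rewrite !mxE.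
  by rewrite (summand_minors EE rE) mul0r.
have tripleE (x y z : 'cV[A]_n) : ext x *m ext y *m ext z =
   \sum_i \sum_j \sum_l (x i 0 * y j 0 * z l 0) *: (inA (c (delta_mx i 0)) *m
     inA (c (delta_mx j 0)) *m inA (c (delta_mx l 0))).
  rewrite -mulmxA /clifford_ext mulmx_suml; apply: eq_bigr => i _.
  rewrite mulmx_suml mulmx_sumr; apply: eq_bigr => j _.
  rewrite !mulmx_sumr; apply: eq_bigr => l _.
  by rewrite -!(scalemxAl, scalemxAr) !scalerA mulmxA mulrA.
have six : ext u *m ext v *m ext w - ext u *m ext w *m ext v
  - (ext v *m ext u *m ext w - ext v *m ext w *m ext u)
  + (ext w *m ext u *m ext v - ext w *m ext v *m ext u) = 0.
  rewrite !tripleE -!(sumrB, big_split) /= big1 // => i _.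
  rewrite -!(sumrB, big_split) /= big1 // => j _.
  rewrite -!(sumrB, big_split) /= big1 // => l _.
  rewrite -!(scalerBl, scalerDl).
  pose f (p : 'I_3) := if p == 0 then i else if p == 1 then j else l.
  have := minor f; rewrite det_mx3 !mxE /= => m0.
  rewrite -[RHS](scale0r (inA (c (delta_mx i 0)) *m
     inA (c (delta_mx j 0)) *m inA (c (delta_mx l 0)))) -m0; congr (_ *: _); ring.
have uv := isotropic_anticomm Eu Ev; have uw := isotropic_anticomm Eu Ew.
have vw := isotropic_anticomm Ev Ew.
have e1 : ext u *m ext w *m ext v = - (ext u *m ext v *m ext w).
  by rewrite -!mulmxA vw mulmxN opprK.
have e2 : ext v *m ext u *m ext w = - (ext u *m ext v *m ext w).
  by rewrite uv mulNmx opprK.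
have e3 : ext v *m ext w *m ext u = ext u *m ext v *m ext w.
  by rewrite -mulmxA -[ext w *m ext u]opprK -uw mulmxN mulmxA e2 opprK.
have e4 : ext w *m ext u *m ext v = ext u *m ext v *m ext w.
  by rewrite -[ext w *m ext u]opprK -uw mulNmx e1 opprK.
have e5 : ext w *m ext v *m ext u = - (ext u *m ext v *m ext w).
  by rewrite -[ext w *m ext v]opprK -vw mulNmx e3.
move: six; rewrite e1 e2 e3 e4 e5; move: (ext u *m ext v *m ext w) => T T6.
apply/matrixP => a b; rewrite [RHS]mxE; apply: (@mulrSn_eq0 k A 5).
by move/matrixP/(_ a b): T6; rewrite !mxE => h; rewrite -[RHS]h; ring.
Qed.

Lemma clifford_image_mul0 u v : clifford_image c [set x | E *m x = x]%classic delta ->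
  E *m u = u -> E *m v = v -> ext u *m ext v *m delta = 0.
Proof.
move=> [m [M [a [MS ->]]]] Eu Ev; rewrite mulmxA.
suff -> : ext u *m ext v *m M = 0 by rewrite mul0mx.
apply/matrixP => i j; have [w [s [Ew Mj]]] := MS j.
have : ext u *m ext v *m col j M = 0 by rewrite Mj mulmxA clifford_triple_eq0 // mul0mx.
by rewrite colE mulmxA -colE => /colP/(_ i); rewrite !mxE.
Qed.

Hypothesis Q_unit : Q + Q^T \in unitmx.

(** The vectors behind [w a] are dual to the coordinates for the polar form, and [u a] is the image
    under [E] of a coordinate vector. Thus [D] counts the degree along the plane, and [2 - D] is the
    sum of the [u a *m w a], with values in the Clifford image. The hypothesis says that delta has
    no component of degree 2, in the form D D delta = D delta. Hence (2 - D) (delta + D delta) = 2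
    delta, which exhibits delta in the image. *)
Lemma clifford_image_of_mul0 :
  (forall u v, E *m u = u -> E *m v = v -> ext u *m ext v *m delta = 0) ->
  clifford_image c [set x | E *m x = x]%classic delta.
Proof.
move=> d0.
pose w a := ext (inA (col a (invmx (Q + Q^T)))).
have wx a x : w a *m ext x + ext x *m w a = (x a 0)%:M.
  rewrite clifford_anticomm clifford_polarC /clifford_polar map_col colE.
  by rewrite mulmxA -(mulmxA x^T) -map_mxM mulmxV // map_mx1 mulmx1 -colE !mxE.
pose u a := ext (col a E).
have Eu a : E *m col a E = col a E by rewrite colE mulmxA EE.
pose D := \sum_a w a *m u a.
have uwD : \sum_a u a *m w a = 2%:R%:M - D.
  apply/eqP; rewrite eq_sym subr_eq -big_split /= -(rank2_trace EE rE) raddf_sum /=.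
  by apply/eqP/eq_bigr => a _; rewrite addrC wx mxE.
have uE x : ext (E *m x) = \sum_b x b 0 *: u b by rewrite clifford_ext_mulmx.
have DD : D *m (D *m delta) = D *m delta.
  have DE x : D *m x = \sum_a w a *m (u a *m x).
    by rewrite /D mulmx_suml; apply: eq_bigr => a _; rewrite mulmxA.
  rewrite DE [RHS]DE; apply: eq_bigr => a _; congr (_ *m _).
  rewrite DE mulmx_sumr.
  transitivity (\sum_b (E b a *: (u b *m delta) - w b *m (u a *m (u b *m delta)))).
    apply: eq_bigr => b _.
    have -> : E b a *: (u b *m delta) = (w b *m u a + u a *m w b) *m (u b *m delta).
      by rewrite wx mul_scalar_mx mxE.
    by rewrite mulmxDl -!mulmxA addrC addKr.
  rewrite sumrB [X in _ - X]big1 ?subr0 => [|b _]; last first.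
    by rewrite (mulmxA (u a)) d0 ?mulmx0.
  transitivity (ext (E *m col a E) *m delta); last by rewrite Eu.
  by rewrite uE mulmx_suml; apply: eq_bigr => b _; rewrite mxE scalemxAl.
have [h h2] := natr_unit A 1.
have -> : delta = \sum_a u a *m (w a *m (h *: (delta + D *m delta))).
  transitivity ((2%:R%:M - D) *m (h *: (delta + D *m delta))).
    rewrite -scalemxAr mulmxBl mul_scalar_mx mulmxDr DD -mulr2n -(scaler_nat 2 (D *m delta)).
    by rewrite -scalerBr addrK scalerA mulrC h2 scale1r.
  by rewrite -uwD mulmx_suml; apply: eq_bigr => a _; rewrite mulmxA.
apply: lin_span_sum => a; exists (col a E), (w a *m (h *: (delta + D *m delta))).
by split=> //; apply: Eu.
Qed.

End Criterion.
End CliffordExt.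

Lemma bijective_of_inj_surj (T U : Type) (f : T -> U) :
  injective f -> (forall y, exists x, f x = y) -> bijective f.
Proof.
move=> fI fS; exists (fun y => projT1 (cid (fS y))) => x.
  by apply: fI; case: cid.
by case: cid.
Qed.

(** * Planes in a hyperbolic block of dimension 6 and flags *)

Section Split.
Variables (k : numFieldType) (A : comAlgType k) (n : nat) (E : 'M[A]_n) (S : pred 'I_n).
Hypotheses (EE : E *m E = E) (trE : \tr E = 2%:R).
Hypothesis ES : forall i j a b, S i -> ~~ S j -> E i a * E j b = E i b * E j a.

(** Let [P] and [N] be the parts of [E] with rows inside and outside [S], and [t] the trace of [P].
    The mixed minors give N P = t N and P N = (2 - t) P, and P E = P gives P P = (t - 1) P.
    Associativity of P N P yields (2 - t) P = 0, then associativity of N P N yields t N = 0. So t/2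
    is an idempotent, equal to 1 on [P] and to 0 on [N]: the plane lies locally on one of the two
    sides. *)
Lemma split_idempotent (h := in_alg A 2%:R^-1) (e := h * \sum_(i | S i) E i i) :
  [/\ e * e = e, forall i a, S i -> e * E i a = E i a
    & forall i a, ~~ S i -> e * E i a = 0].
Proof.
have h2 : h * 2%:R = 1.
  by rewrite -(rmorph_nat (in_alg A)) -rmorphM mulVf ?rmorph1 // pnatr_eq0.
pose P : 'M[A]_n := \matrix_(i, j) (if S i then E i j else 0).
pose N := E - P.
have NE i j : N i j = if S i then 0 else E i j.
  by rewrite !mxE; case: (S i); rewrite ?subrr ?subr0.
have PE : P *m E = P.
  apply/matrixP => i j; rewrite !mxE; case Si: (S i).
    by rewrite -[in RHS]EE mxE; apply: eq_bigr => l _; rewrite mxE Si.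
  by rewrite big1 // => l _; rewrite mxE Si mul0r.
have NEE : N *m E = N by rewrite mulmxBl EE PE.
set t := \sum_(i | S i) E i i in e *.
have trP : \tr P = t.
  rewrite /t big_mkcond; apply: eq_bigr => i _; by rewrite mxE.
have trN : \tr N = 2%:R - t by rewrite /N raddfB /= trE trP.
have PN i j a b : P i a * N j b = P i b * N j a.
  rewrite !NE !mxE; case Si: (S i); last by rewrite !mul0r.
  by case Sj: (S j); [rewrite !mulr0 | apply: ES; rewrite ?Si ?Sj].
have NP : N *m P = t *: N.
  apply/matrixP => j b; rewrite mxE [RHS]mxE -trP mulr_suml; apply: eq_bigr => i _.
  by rewrite mulrC -PN.
have PNs : P *m N = (2%:R - t) *: P.
  apply/matrixP => j b; rewrite mxE [RHS]mxE -trN mulr_suml; apply: eq_bigr => i _.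
  by rewrite PN mulrC.
have EPN : E = P + N by rewrite addrC subrK.
have PP : P *m P = (t - 1) *: P.
  have := PE; rewrite {1}EPN mulmxDr PNs => e1.
  by rewrite -[LHS](addrK ((2%:R - t) *: P)) e1 -{1}[P]scale1r -scalerBl; congr (_ *: _); ring.
have sP : (2%:R - t) *: P = 0.
  have : P *m (N *m P) = (P *m N) *m P by rewrite mulmxA.
  rewrite NP PNs -scalemxAr -scalemxAl PNs PP !scalerA => /eqP.
  rewrite -subr_eq0 -scalerBl => /eqP <-; congr (_ *: _); ring.
have ts : (2%:R - t) * t = 0 by have := congr1 mxtrace sP; rewrite mxtraceZ trP mxtrace0.
have tN : t *: N = 0.
  have NN : N *m N = (1 - t) *: N.
    have := NEE; rewrite {1}EPN mulmxDr NP => e1.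
    by rewrite -[LHS](addKr (t *: N)) e1 -{2}[N]scale1r -scaleNr -scalerDl addrC.
  have : N *m (P *m N) = (N *m P) *m N by rewrite mulmxA.
  rewrite sP in PNs; rewrite PNs mulmx0 NP -scalemxAl NN scalerA => e1.
  have -> : t = (2%:R - t) * t - t * (1 - t) by ring.
  by rewrite ts sub0r scaleNr -e1 oppr0.
have hst : h * (2%:R - t) = 1 - e by rewrite mulrBr h2.
split=> [|i a Si|i a Si].
- suff : e * (1 - e) = 0 by move/eqP; rewrite mulrBr mulr1 subr_eq0 => /eqP <-.
  by rewrite -hst /e mulrACA (mulrC t) ts mulr0.
- move/matrixP/(_ i a): sP; rewrite !mxE Si => sE.
  have : (1 - e) * E i a = 0 by rewrite -hst -mulrA sE mulr0.
  by move/eqP; rewrite mulrBl mul1r subr_eq0 => /eqP.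
- move/matrixP/(_ i a): tN; rewrite mxE NE (negPf Si) mxE => tE.
  by rewrite /e -mulrA tE mulr0.
Qed.

End Split.

Section BlockAlgebra.
Variables (k : numFieldType) (A : comAlgType k) (n r : nat).
Variables (X Y : 'M[A]_(n, r)) (X' Y' : 'M[A]_(r, n)) (E : 'M[A]_n).
Hypotheses (EE : E *m E = E) (trE : \tr E = 2%:R).
Hypothesis EXY : E = X *m X' *m E + Y *m Y' *m E.
Hypothesis pp : forall i j a b,
  (X' *m E) i a * (X' *m E) j b = (X' *m E) j a * (X' *m E) i b.
Hypothesis qq : forall i j a b,
  (Y' *m E) i a * (Y' *m E) j b = (Y' *m E) j a * (Y' *m E) i b.

(** The matrices [p] and [q] have vanishing 2 x 2 minors, so u W u = tr(u W) u for each of them and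
    every [W]. With t = tr(p X), associativity of p Y q X p gives (1 - t) p = 0, and likewise (1 -
    t) q = 0. Hence (1 - t) E = 0, and its trace 2 (1 - t) forces t = 1. The two components of the
    plane are therefore lines. *)
Lemma block_idempotents (p := X' *m E) (q := Y' *m E) :
  [/\ p *m X *m p = p, q *m X *m p = 0, p *m Y *m q = 0, q *m Y *m q = q
    & \tr (p *m X) = 1 /\ \tr (q *m Y) = 1].
Proof.
have contract (W : 'M[A]_(n, r)) (u : 'M[A]_(r, n)) :
    (forall i j a b, u i a * u j b = u j a * u i b) ->
    u *m W *m u = \tr (u *m W) *: u.
  move=> uu; apply/matrixP => j b; rewrite mxE [RHS]mxE mulr_suml.
  apply: eq_bigr => i _; rewrite !mxE !mulr_suml; apply: eq_bigr => a _.
  by rewrite mulrAC uu mulrAC.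
have pE : p *m E = p by rewrite -mulmxA EE.
have qE : q *m E = q by rewrite -mulmxA EE.
have Epq : E = X *m p + Y *m q by rewrite !mulmxA.
have ppp i j a b : p i a * p j b = p j a * p i b by apply: pp.
have qqq i j a b : q i a * q j b = q j a * q i b by apply: qq.
clearbody p q.
set t := \tr (p *m X); set s := \tr (q *m Y).
have ts : t + s = 2%:R.
  by rewrite -trE {1}Epq raddfD /= mxtrace_mulC (mxtrace_mulC Y).
have pXp : p *m X *m p = t *: p by apply: contract.
have qYq : q *m Y *m q = s *: q by apply: contract.
have pYq : p *m Y *m q = (1 - t) *: p.
  have := pE; rewrite {1}Epq mulmxDr !mulmxA pXp => e1.
  by rewrite -[LHS](addKr (t *: p)) e1 addrC scalerBl scale1r.
have qXp : q *m X *m p = (t - 1) *: q.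
  have := qE; rewrite {1}Epq mulmxDr !mulmxA qYq => e1.
  rewrite -[LHS](addrK (s *: q)) e1 -[X in X - _]scale1r -scalerBl; congr (_ *: _).
  by rewrite -[s](addKr t) ts; ring.
have tp : (1 - t) *: p = 0.
  have : p *m Y *m (q *m X *m p) = (p *m Y *m q) *m X *m p by rewrite !mulmxA.
  rewrite qXp pYq -scalemxAr pYq -!scalemxAl pXp !scalerA => /esym/eqP.
  rewrite -subr_eq0 -scalerBl => /eqP <-; congr (_ *: _); ring.
have tq : (1 - t) *: q = 0.
  have : q *m X *m (p *m Y *m q) = (q *m X *m p) *m Y *m q by rewrite !mulmxA.
  rewrite pYq -scalemxAr qXp -!scalemxAl qYq !scalerA => /eqP.
  rewrite -subr_eq0 -scalerBl => /eqP <-; congr (_ *: _).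
  by rewrite -[s](addKr t) ts; ring.
have t1 : t = 1.
  have : (1 - t) *: E = 0 by rewrite Epq scalerDr !scalemxAr tp tq !mulmx0 addr0.
  move/(congr1 mxtrace); rewrite mxtraceZ trE mxtrace0 mulr_natr => /mulrSn_eq0/eqP.
  by rewrite subr_eq0 => /eqP.
have s1 : s = 1 by rewrite -[s](addKr t) ts t1; ring.
by split; rewrite ?pXp ?qXp ?pYq ?qYq ?t1 ?s1 ?subrr ?scale1r ?scale0r.
Qed.

(** [E] and the block diagonal projector built from [p] and [q] need not be equal, but they have the
    same image. *)
Lemma block_fix (v : 'cV[A]_n) :
  (E *m v = v) <->
  ((X *m (X' *m E *m X) *m X' + Y *m (Y' *m E *m Y) *m Y') *m v = v).
Proof.
pose p := X' *m E; pose q := Y' *m E; rewrite -/p -/q.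
have [pXp qXp pYq qYq _] : [/\ p *m X *m p = p, q *m X *m p = 0, p *m Y *m q = 0,
  q *m Y *m q = q & _] := block_idempotents.
have Epq : E = X *m p + Y *m q by rewrite !mulmxA.
have Xv : E *m v = v -> X' *m v = p *m v by move=> Ev; rewrite -mulmxA Ev.
have Yv : E *m v = v -> Y' *m v = q *m v by move=> Ev; rewrite -mulmxA Ev.
clearbody p q; split=> Ev.
  have e1 : X *m (p *m X) *m (p *m v) = X *m p *m v.
    by rewrite mulmxA -(mulmxA X) pXp.
  have e2 : Y *m (q *m Y) *m (q *m v) = Y *m q *m v.
    by rewrite mulmxA -(mulmxA Y) qYq.
  by rewrite mulmxDl -(mulmxA _ X') (Xv Ev) -(mulmxA _ Y') (Yv Ev) e1 e2 -mulmxDl -Epq.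
have EXp : E *m X *m p = X *m p.
  by rewrite Epq !mulmxDl -!mulmxA (mulmxA p) pXp (mulmxA q) qXp mulmx0 addr0.
have EYq : E *m Y *m q = Y *m q.
  by rewrite Epq !mulmxDl -!mulmxA (mulmxA p) pYq (mulmxA q) qYq mulmx0 add0r.
rewrite -{1}Ev mulmxDl mulmxDr !mulmxA EXp EYq.
by rewrite -[RHS]Ev mulmxDl !mulmxA.
Qed.

End BlockAlgebra.

Local Open Scope classical_set_scope.

(** * Zeros inside one hyperbolic block and the flag variety *)

Section BlockKiso.
Variables (k : numFieldType) (n N : nat) (Q : 'M[k]_n).
Variable c : {linear 'cV[k]_n -> 'M[k]_N}.
Variable delta : 'cV[k]_N.
Hypothesis cliff : clifford_action Q c.
Hypothesis Q_unit : Q + Q^T \in unitmx.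
Notation inA A := (map_mx (in_alg A)).

Variables (X Y : 'M[k]_(n, 3)) (X' Y' : 'M[k]_(3, n)).
Hypotheses (XX : X' *m X = 1%:M) (YY : Y' *m Y = 1%:M).
Hypotheses (XY : X' *m Y = 0) (YX : Y' *m X = 0).
Hypothesis qXY : forall (A : comAlgType k) (l m : 'cV[A]_3),
  qform (inA A Q) (inA A X *m l + inA A Y *m m) = (l^T *m m) 0 0.
Hypothesis fwd : forall (A : comAlgType k) (l m l' m' : 'cV[A]_3),
  clifford_ext c (inA A X *m l + inA A Y *m m) *m
  clifford_ext c (inA A X *m l' + inA A Y *m m') *m inA A delta = 0 ->
  forall i j, l i 0 * l' j 0 = l j 0 * l' i 0 /\ m i 0 * m' j 0 = m j 0 * m' i 0.
Hypothesis bwd : forall (A : comAlgType k) (l m l' m' : 'cV[A]_3),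
  (forall i j, l i 0 * l' j 0 = l j 0 * l' i 0) ->
  (forall i j, m i 0 * m' j 0 = m j 0 * m' i 0) ->
  (l^T *m m') 0 0 = 0 -> (l'^T *m m) 0 0 = 0 ->
  clifford_ext c (inA A X *m l + inA A Y *m m) *m
  clifford_ext c (inA A X *m l' + inA A Y *m m') *m inA A delta = 0.

Variable Z : subkfunctor (zero_locus Q c delta).
Hypothesis ZE : forall (A : comAlgType k) (U : pt (zero_locus Q c delta) A),
  subpt Z U <-> forall u, sval (sval (sval U)) u ->
    u = inA A X *m (inA A X' *m u) + inA A Y *m (inA A Y' *m u).

Section Points.
Variable A : comAlgType k.
Local Notation XA := (inA A X).
Local Notation YA := (inA A Y).
Local Notation XA' := (inA A X').
Local Notation YA' := (inA A Y').

(** The flag is defined from [U] alone, so no choice of projector enters the natural transformation.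
    The pairing between X and Y is the standard one of coordinate vectors, by [qXY]; this identifies
    the annihilator of a line of Y with a plane of A^3. *)
Definition flag_line (U : set 'cV[A]_n) : set 'cV[A]_3 := [set l | U (XA *m l)].
Definition flag_plane (U : set 'cV[A]_n) : set 'cV[A]_3 :=
  [set h | forall m, U (YA *m m) -> (h^T *m m) 0 0 = 0].

Definition block_E (EL EM : 'M[A]_3) : 'M[A]_n := XA *m EL *m XA' + YA *m EM *m YA'.

Definition flag_data (EL EM : 'M[A]_3) :=
  [/\ EL *m EL = EL, EM *m EM = EM, \tr EL = 1, \tr EM = 1 &
      forall l m : 'cV[A]_3, EL *m l = l -> EM *m m = m -> (l^T *m m) 0 0 = 0].

Let XXA : XA' *m XA = 1%:M. Proof. by rewrite -map_mxM XX map_mx1. Qed.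
Let YYA : YA' *m YA = 1%:M. Proof. by rewrite -map_mxM YY map_mx1. Qed.
Let XYA : XA' *m YA = 0. Proof. by rewrite -map_mxM XY map_mx0. Qed.
Let YXA : YA' *m XA = 0. Proof. by rewrite -map_mxM YX map_mx0. Qed.

Lemma block_EX EL EM (l : 'cV[A]_n) : XA' *m (block_E EL EM *m l) = EL *m (XA' *m l).
Proof. by rewrite /block_E mulmxDl mulmxDr !mulmxA XXA XYA mul1mx !mul0mx addr0. Qed.

Lemma block_EY EL EM (l : 'cV[A]_n) : YA' *m (block_E EL EM *m l) = EM *m (YA' *m l).
Proof. by rewrite /block_E mulmxDl mulmxDr !mulmxA YYA YXA mul1mx !mul0mx add0r. Qed.

Lemma block_E_XY p EL EM (l m : 'M[A]_(3, p)) :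
  block_E EL EM *m (XA *m l + YA *m m) = XA *m (EL *m l) + YA *m (EM *m m).
Proof.
rewrite /block_E mulmxDl !mulmxDr -!mulmxA !(mulmxA XA') !(mulmxA YA').
by rewrite XXA YYA XYA YXA !mul1mx !mul0mx !mulmx0 addr0 add0r.
Qed.

Lemma block_EE EL EM : EL *m EL = EL -> EM *m EM = EM ->
  block_E EL EM *m block_E EL EM = block_E EL EM.
Proof.
move=> ELL EMM; rewrite {2 3}/block_E -!(mulmxA _ _ XA') -!(mulmxA _ _ YA') block_E_XY.
by rewrite !(mulmxA EL) !(mulmxA EM) ELL EMM.
Qed.

Lemma block_fixP EL EM (u : 'cV[A]_n) : block_E EL EM *m u = u <->
  exists l m : 'cV[A]_3, [/\ EL *m l = l, EM *m m = m & u = XA *m l + YA *m m].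
Proof.
split=> [Eu|[l [m [El Em ->]]]]; last by rewrite block_E_XY El Em.
have hX := block_EX EL EM u; have hY := block_EY EL EM u; rewrite Eu in hX hY.
exists (XA' *m u), (YA' *m u); split=> //.
by rewrite hX hY -{1}Eu /block_E mulmxDl !mulmxA.
Qed.

Lemma flag_line_fix EL EM : flag_line [set u | block_E EL EM *m u = u] = [set l | EL *m l = l].
Proof.
apply/seteqP; split=> l /= El.
  have := block_EX EL EM (XA *m l).
  by rewrite [block_E _ _ *m _]El !(mulmxA XA') XXA mul1mx.
by have := block_E_XY EL EM l 0; rewrite !mulmx0 !addr0 /flag_line /= => ->; rewrite El.
Qed.

Lemma YA_fix EL EM (m : 'cV[A]_3) : block_E EL EM *m (YA *m m) = YA *m m <-> EM *m m = m.
Proof.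
have := block_E_XY EL EM 0 m; rewrite !mulmx0 !add0r => ->.
split=> [|->//] /(congr1 (mulmx YA')).
by rewrite !mulmxA YYA !mul1mx.
Qed.

(** The transpose of [EM] kills exactly the annihilator of the image of [EM], so the complementary
    projector has this annihilator as image. *)
Lemma perp_fix (EM : 'M[A]_3) (h : 'cV[A]_3) : EM *m EM = EM ->
  (forall m : 'cV[A]_3, EM *m m = m -> (h^T *m m) 0 0 = 0) <-> (1%:M - EM^T) *m h = h.
Proof.
move=> EMM; rewrite mulmxBl mul1mx; split=> [h0|/eqP].
  suff -> : EM^T *m h = 0 by rewrite subr0.
  apply: trmx_inj; rewrite trmx_mul trmxK trmx0; apply/rowP => j; rewrite [RHS]mxE.
  rewrite -(h0 (col j EM)) ?colE ?mulmxA ?EMM // -colE.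
  by rewrite [RHS]mxE.
rewrite -subr_eq0 addrAC subrr add0r oppr_eq0 => /eqP h0 m <-.
by rewrite mulmxA -[h^T *m EM]trmxK trmx_mul trmxK h0 trmx0 mul0mx mxE.
Qed.

Lemma flag_plane_fix EL EM : EM *m EM = EM ->
  flag_plane [set u | block_E EL EM *m u = u] = [set h | (1%:M - EM^T) *m h = h].
Proof.
move=> EMM; apply/seteqP; split=> h /= hh.
  by apply/(perp_fix _ EMM) => m Em; apply: hh; apply/YA_fix.
by move=> m /YA_fix Em; move/(perp_fix _ EMM): hh; apply.
Qed.

Lemma summand_of_trace r m (E : 'M[A]_m) : E *m E = E -> \tr E = r%:R ->
  rank_summand r [set v | E *m v = v].
Proof. by move=> EE trE; exists E; split=> //; apply: rank_of_trace. Qed.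

Lemma compl_idem (EM : 'M[A]_3) : EM *m EM = EM ->
  (1%:M - EM^T) *m (1%:M - EM^T) = 1%:M - EM^T.
Proof.
by move=> EMM; rewrite mulmxBl mul1mx mulmxBr mulmx1 -trmx_mul EMM subrr subr0.
Qed.

Lemma compl_trace (EM : 'M[A]_3) (s : A) : \tr EM = s -> \tr (1%:M - EM^T) = 3%:R - s.
Proof. by move=> trE; rewrite raddfB /= mxtrace1 mxtrace_tr trE. Qed.

Lemma perpK (EM : 'M[A]_3) (m : 'cV[A]_3) : EM *m EM = EM ->
  (forall h : 'cV[A]_3, (1%:M - EM^T) *m h = h -> (h^T *m m) 0 0 = 0) <-> EM *m m = m.
Proof.
move=> EMM; have := perp_fix m (compl_idem EMM).
have -> : 1%:M - (1%:M - EM^T)^T = EM.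
  by rewrite linearB /= trmx1 trmxK opprB addrCA subrr addr0.
move=> <-.
have dotC (x y : 'cV[A]_3) : (x^T *m y) 0 0 = (y^T *m x) 0 0.
  by rewrite !mxE; apply: eq_bigr => i _; rewrite !mxE mulrC.
by split=> h0 h /h0; rewrite dotC.
Qed.

(** The columns of [E] lie in the plane, so [fwd] makes all 2 x 2 minors of its X and Y coordinates
    vanish, as [block_idempotents] requires. The orthogonality of the two lines is the isotropy of
    the sum of a vector of each. *)
Lemma block_zero_data (U : pt (zero_locus Q c delta) A) : subpt Z U ->
  exists EL EM, flag_data EL EM /\
    sval (sval (sval U)) = [set u | block_E EL EM *m u = u].
Proof.
move/ZE; case: U => -[[U rU] /= isoU] /= zU UXY.
have {}zU : clifford_image c U (inA A delta) := zU.
have {}isoU u : U u -> qform (inA A Q) u = 0 := isoU u.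
case: rU => E [EE UE rE]; rewrite {}UE in isoU zU UXY *.
have colE' a : E *m col a E = col a E by rewrite colE mulmxA EE.
have EXY : E = XA *m XA' *m E + YA *m YA' *m E.
  apply/matrixP => i a; have /colP/(_ i) := UXY _ (colE' a).
  by rewrite !colE !mulmxA -mulmxDl -!colE !mxE.
have wedge a b : clifford_ext c (XA *m col a (XA' *m E) + YA *m col a (YA' *m E)) *m
  clifford_ext c (XA *m col b (XA' *m E) + YA *m col b (YA' *m E)) *m inA A delta = 0.
  have cE d : XA *m col d (XA' *m E) + YA *m col d (YA' *m E) = col d E.
    by rewrite !colE !mulmxA -mulmxDl -EXY.
  by rewrite !cE; apply: (clifford_image_mul0 cliff EE isoU rE zU).
have pp i j a b : (XA' *m E) i a * (XA' *m E) j b = (XA' *m E) j a * (XA' *m E) i b.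
  by have [+ _] := fwd (wedge a b) i j; rewrite !mxE.
have qq i j a b : (YA' *m E) i a * (YA' *m E) j b = (YA' *m E) j a * (YA' *m E) i b.
  by have [_ +] := fwd (wedge a b) i j; rewrite !mxE.
have trE := rank2_trace EE rE.
have [pXp qXp pYq qYq [trp trq]] := block_idempotents EE trE EXY pp qq.
have fixE u := block_fix EE trE EXY pp qq u.
exists (XA' *m E *m XA), (YA' *m E *m YA); split; last first.
  by apply/seteqP; split=> u /= /fixE.
split=> //; try by rewrite mulmxA ?pXp ?qYq.
move=> l m El Em; rewrite -qXY; apply: isoU; apply/fixE.
by rewrite -/(block_E _ _) block_E_XY El Em.
Qed.

(** Two vectors of the image of a rank one projector are proportional in the sense of minors, which
    is what [bwd] asks for; the criterion by products of two vectors then shows that delta vanishes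
    at the plane. *)
Lemma block_zero_point EL EM : flag_data EL EM ->
  exists2 U : pt (zero_locus Q c delta) A, subpt Z U &
    sval (sval (sval U)) = [set u | block_E EL EM *m u = u].
Proof.
move=> [ELL EMM trL trM LM].
have EE := block_EE ELL EMM.
have trE : \tr (block_E EL EM) = 2%:R.
  rewrite raddfD /= mxtrace_mulC mulmxA XXA mul1mx trL.
  by rewrite mxtrace_mulC mulmxA YYA mul1mx trM.
pose U0 : pt (grassmannian k 2 n) A := exist _ _ (summand_of_trace EE trE).
have iso : og_pt Q U0.
  by move=> u /= /block_fixP[l [m [El Em ->]]]; rewrite qXY LM.
pose U1 : pt (orthogonal_grassmannian 2 Q) A := exist _ U0 iso.
have zU : zero_pt c delta U1.
  suff zE : clifford_image c [set u | block_E EL EM *m u = u] (inA A delta) by apply: zE.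
  apply: (clifford_image_of_mul0 cliff EE (rank_of_trace EE trE) Q_unit).
  move=> u v /block_fixP[l [m [El Em ->]]] /block_fixP[l' [m' [El' Em' ->]]].
  have minors (F : 'M[A]_3) (FF : F *m F = F) (trF : \tr F = 1) (x y : 'cV_3) i j :
      F *m x = x -> F *m y = y -> x i 0 * y j 0 = x j 0 * y i 0.
    move=> <- <-; rewrite !mxE !mulr_suml; apply: eq_bigr => a _.
    rewrite !mulr_sumr; apply: eq_bigr => b _; rewrite mulrACA [RHS]mulrACA.
    by rewrite (rank1_minors FF (rank_of_trace (r := 1) FF trF)) [F i b * _]mulrC.
  apply: bwd; [move=> i j|move=> i j|exact: LM|exact: LM].
    exact: (minors EL).
  exact: (minors EM).
exists (exist _ U1 zU) => //; apply/ZE => u /= /block_fixP[l [m [_ _ ->]]].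
by rewrite !mulmxDr !(mulmxA XA') !(mulmxA YA') XXA YYA XYA YXA !mul1mx !mul0mx
  !mulmx0 addr0 add0r.
Qed.

Lemma flag_line_rank (U : pt (zero_locus Q c delta) A) : subpt Z U ->
  rank_summand 1 (flag_line (sval (sval (sval U)))).
Proof.
move=> /block_zero_data[EL [EM [[ELL _ trL _ _] ->]]].
by rewrite flag_line_fix; apply: summand_of_trace.
Qed.

Lemma flag_plane_rank (U : pt (zero_locus Q c delta) A) : subpt Z U ->
  rank_summand 2 (flag_plane (sval (sval (sval U)))).
Proof.
move=> /block_zero_data[EL [EM [[_ EMM _ trM _] ->]]].
rewrite flag_plane_fix //; apply: summand_of_trace; first exact: compl_idem.
by rewrite (compl_trace trM); ring.
Qed.

Lemma flag_line_plane (U : pt (zero_locus Q c delta) A) : subpt Z U ->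
  flag_line (sval (sval (sval U))) `<=` flag_plane (sval (sval (sval U))).
Proof.
move=> /block_zero_data[EL [EM [[_ EMM _ _ LM] ->]]].
rewrite flag_line_fix => l El m /= /YA_fix Em; exact: LM.
Qed.

(** By biduality the line in Y is recovered as the annihilator of the flag plane; this gives
    injectivity. *)
Lemma flag_determines (U : pt (zero_locus Q c delta) A) : subpt Z U ->
  sval (sval (sval U)) = [set u | exists l m : 'cV[A]_3,
    [/\ flag_line (sval (sval (sval U))) l,
        forall h, flag_plane (sval (sval (sval U))) h -> (h^T *m m) 0 0 = 0
      & u = XA *m l + YA *m m]].
Proof.
move=> /block_zero_data[EL [EM [[_ EMM _ _ _] ->]]].
rewrite flag_line_fix flag_plane_fix //; apply/seteqP; split=> u /=.
  move/block_fixP => [l [m [El Em ->]]]; exists l, m; split=> //.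
  by apply/(perpK _ EMM).
move=> [l [m [El /(perpK _ EMM) Em ->]]]; apply/block_fixP.
by exists l, m.
Qed.

End Points.

Definition to_flag (A : comAlgType k) (U : pt Z A) : pt (Fl3 k) A :=
  exist _ (exist _ _ (flag_line_rank (svalP U)), exist _ _ (flag_plane_rank (svalP U)))
    (flag_line_plane (svalP U)).

Lemma block_kiso : kiso Z (Fl3 k).
Proof.
exists to_flag; split=> [A|A B g [U ZU]].
  apply: bijective_of_inj_surj.
    move=> [U ZU] [V ZV] /(congr1 sval)/= UV; apply: eq_exist.
    have L : flag_line (sval (sval (sval U))) = flag_line (sval (sval (sval V))).
      by move: UV => /(congr1 fst)/(congr1 sval).
    have H : flag_plane (sval (sval (sval U))) = flag_plane (sval (sval (sval V))).
      by move: UV => /(congr1 snd)/(congr1 sval).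
    have : sval (sval (sval U)) = sval (sval (sval V)).
      by rewrite (flag_determines ZU) (flag_determines ZV) L H.
    case: U V {ZU ZV UV L H} => [[[U rU] oU] zU] [[[V rV] oV] zV] /= UV.
    by do 3!apply: eq_exist.
  move=> [[[L rL] [H rH]] LH]; have LsubH : L `<=` H := LH.
  case: (rL) => EL [ELL LE rEL]; case: (rH) => EH [EHH HE rEH].
  have trL := rank1_trace ELL rEL; have trH := rank2_trace EHH rEH.
  (* The projector onto the annihilator of [H], a line because its trace is 3 - 2. *)
  pose EM := 1%:M - EH^T.
  have EMH : 1%:M - EM^T = EH.
    by rewrite /EM linearB /= trmx1 trmxK opprB addrCA subrr addr0.
  have EMM : EM *m EM = EM by apply: compl_idem.
  have [|U ZU UE] := @block_zero_point A EL EM.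
    split=> //; first by rewrite (compl_trace trH); ring.
    move=> l m El; have Hl : H l by apply: LsubH; rewrite LE.
    move/(perpK _ EMM); apply; rewrite EMH; by move: Hl; rewrite HE.
  exists (exist _ U ZU); apply: eq_exist.
  congr pair; apply: eq_exist; rewrite /= UE.
    by rewrite flag_line_fix LE.
  by rewrite flag_plane_fix // EMH HE.
have [EL [EM [[ELL EMM trL trM LM] UE]]] := block_zero_data ZU.
have inAg p q (M : 'M[k]_(p, q)) : map_mx g (inA A M) = inA B M.
  by apply/matrixP => i j; rewrite !mxE rmorph_alg.
have gE : map_mx g (block_E EL EM) = block_E (map_mx g EL) (map_mx g EM).
  by rewrite /block_E map_mxD !map_mxM !inAg.
have EE := block_EE ELL EMM.
have gU : base_change g (sval (sval (sval U))) =
    [set u | block_E (map_mx g EL) (map_mx g EM) *m u = u].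
  by rewrite UE base_changeE // gE.
apply: eq_exist; congr pair; apply: eq_exist; rewrite /= gU UE.
  by rewrite !flag_line_fix base_changeE.
rewrite !flag_plane_fix // -?map_mxM ?EMM // base_changeE; last exact: compl_idem.
by rewrite map_mxB map_mx1 map_trmx.
Qed.

End BlockKiso.
Local Close Scope classical_set_scope.

(** * The zero locus of a spinor with an adapted frame *)

(* The frame vectors are numbered 0-2 (X1), 3-5 (Y1), 6-8 (X2), 9-11 (Y2), 12 (n);
   the block of i is i %/ 6.  The vectors i and i + 3 of a block are dual, and n
   has polar norm 2. *)
Definition dual_index (i : nat) : nat := if (i < 12)%N then (i %/ 6 * 6 + (i + 3) %% 6)%N else i.

Definition gram_weight (i j : nat) : nat := if j == dual_index i then (i == 12%N).+1 else 0%N.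

(** Pairs with one vector in Xi and the other in Yi for the same i: the second test separates the
    two triples of a block. Their products are the part of the even Clifford algebra that can act on
    delta through scalar products only. *)
Definition sl_pair (i j : nat) : bool := (i %/ 6 == j %/ 6)%N && (i %/ 3 != j %/ 3)%N.

Lemma forall_ord13 (P : nat -> bool) : all P (iota 0 13) -> forall i : 'I_13, P i.
Proof. by move=> /allP PP i; apply: PP; rewrite mem_iota ltn_ord. Qed.

Lemma forall_ord13_2 (P : nat -> nat -> bool) :
  all (fun i => all (P i) (iota 0 13)) (iota 0 13) -> forall i j : 'I_13, P i j.
Proof. by move=> h i j; apply: (forall_ord13 (P := P i)); apply: (forall_ord13 h). Qed.

Lemma dual_index_lt (i : 'I_13) : (dual_index i < 13)%N.
Proof. by move: i; apply: (@forall_ord13 (fun i => dual_index i < 13)%N). Qed.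

Lemma dual_indexK (i : 'I_13) : dual_index (dual_index i) = i.
Proof. by apply/eqP; move: i; apply: (@forall_ord13 (fun i => dual_index (dual_index i) == i)). Qed.

Section Gram.
Variable k : numFieldType.

Definition gram13 : 'M[k]_13 := \matrix_(i, j) (gram_weight i j)%:R.

Lemma gram13_unit : gram13 \in unitmx.
Proof.
pose D : 'M[k]_13 := \matrix_(i, j) (if i == dual_index j :> nat then ((j == 12 :> nat).+1)%:R^-1 else 0).
suff : D *m gram13 = 1%:M by case/mulmx1_unit.
apply/matrixP => i j; rewrite !mxE.
pose i' := Ordinal (dual_index_lt i).
rewrite (bigD1 i') //= big1 ?addr0 => [|l li]; rewrite !mxE /gram_weight /=; last first.
  case: ifP => [/eqP il|]; last by rewrite mul0r.
  by move: li; rewrite -val_eqE /= il dual_indexK eqxx.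
rewrite dual_indexK eqxx (eq_sym (j : nat)) -[i == j :> nat]/(i == j).
have [_|_] := eqVneq i j; last by rewrite mulr0.
by rewrite mulVf // pnatr_eq0.
Qed.

End Gram.

Section Frame.
Variables (k : numFieldType) (N : nat) (Q : 'M[k]_13).
Variable c : {linear 'cV[k]_13 -> 'M[k]_N}.
Variable delta : 'cV[k]_N.
Variable G : 'M[k]_13.
Hypothesis cliff : clifford_action Q c.
Hypothesis Q_unit : Q + Q^T \in unitmx.
Notation inA A := (map_mx (in_alg A)).
Let C i := c (col i G).
Hypothesis N_gt0 : (0 < N)%N.
Hypothesis anticomm : forall i j, C i *m C j + C j *m C i = (gram_weight i j)%:R%:M.
Hypothesis sl_off : forall i j : 'I_13, (i < j)%N -> sl_pair i j -> (i %% 3 != j %% 3)%N ->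
  C i *m C j *m delta = 0.
Hypothesis sl_diag : forall i j i' j' : 'I_13, (i < j)%N -> sl_pair i j -> (i %% 3 = j %% 3)%N ->
  (i' < j')%N -> sl_pair i' j' -> (i' %% 3 = j' %% 3)%N -> (i %/ 6 = i' %/ 6)%N ->
  C i *m C j *m delta = C i' *m C j' *m delta.
Hypothesis functional : forall i j : 'I_13, i != j -> ~~ sl_pair i j ->
  exists L : 'rV[k]_N, forall a b : 'I_13,
    L *m (C a *m C b *m delta) = (((a == i) && (b == j))%:R - ((a == j) && (b == i))%:R)%:M.

Lemma frame_gram : G^T *m (Q + Q^T) *m G = gram13 k.
Proof.
apply/matrixP => i j; rewrite [RHS]mxE.
have := clifford_polarization cliff (col i G) (col j G); rewrite anticomm.
move/matrixP/(_ (Ordinal N_gt0) (Ordinal N_gt0)); rewrite !mxE eqxx !mulr1n => ->.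
apply: eq_bigr => a _; rewrite !mxE; congr (_ * _).
by apply: eq_bigr => b _; rewrite !mxE.
Qed.

Lemma frame_unit : G \in unitmx.
Proof.
have := gram13_unit k; rewrite -frame_gram !unitmxE det_mulmx unitrM.
by case/andP.
Qed.

Local Notation G' := (invmx G).

Section Algebra.
Variable A : comAlgType k.
Notation ext := (@clifford_ext k 13 N c A).

Lemma frame_ext t : ext (inA A G *m t) = \sum_j t j 0 *: inA A (C j).
Proof.
rewrite clifford_ext_mulmx; apply: eq_bigr => j _.
by rewrite -map_col clifford_ext_map.
Qed.

(** The functional attached to a pair outside [sl_pair] reads off the corresponding Plücker
    coordinate of the bivector of the two vectors. *)
Lemma frame_wedge t s : ext (inA A G *m t) *m ext (inA A G *m s) *m inA A delta = 0 ->
  forall i j : 'I_13, ~~ sl_pair i j -> t i 0 * s j 0 = t j 0 * s i 0.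
Proof.
move=> ts i j nsl; have [->|ij] := eqVneq i j; first by [].
have [L LC] := functional ij nsl.
have := congr1 (mulmx (inA A L)) ts; rewrite !frame_ext mulmx0.
have -> : inA A L *m ((\sum_a t a 0 *: inA A (C a)) *m (\sum_b s b 0 *: inA A (C b)) *m inA A delta)
  = \sum_a \sum_b (t a 0 * s b 0) *: inA A (L *m (C a *m C b *m delta)).
  rewrite -mulmxA mulmx_suml mulmx_sumr; apply: eq_bigr => a _.
  rewrite !mulmx_suml !mulmx_sumr; apply: eq_bigr => b _.
  by rewrite -!(scalemxAl, scalemxAr) scalerA !map_mxM !mulmxA.
move/matrixP/(_ 0 0); rewrite summxE mxE.
have delta_sum (i1 j1 : 'I_13) : \sum_a \sum_b (t a 0 * s b 0) * ((a == i1) && (b == j1))%:R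
    = t i1 0 * s j1 0.
  rewrite (bigD1 i1) //= (bigD1 j1) //= !eqxx mulr1 !big1 ?addr0 //.
    by move=> a /negPf ai; rewrite big1 // => b _; rewrite ai mulr0.
  by move=> b /negPf bj; rewrite bj andbF mulr0.
have -> : \sum_a (\sum_b (t a 0 * s b 0) *: inA A (L *m (C a *m C b *m delta))) 0 0 =
  \sum_a \sum_b (t a 0 * s b 0) * ((a == i) && (b == j))%:R
  - \sum_a \sum_b (t a 0 * s b 0) * ((a == j) && (b == i))%:R.
  rewrite -sumrB; apply: eq_bigr => a _; rewrite summxE -sumrB; apply: eq_bigr => b _.
  rewrite LC !mxE eqxx mulr1n -mulrBr; congr (_ * _).
  by rewrite rmorphB !rmorph_nat.
by rewrite !delta_sum => /eqP; rewrite subr_eq0 => /eqP.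
Qed.

End Algebra.

Section Block.
Variables (b : nat) (b_lt2 : (b < 2)%N).

Lemma block_lt (s : nat) (s_lt2 : (s < 2)%N) (i : 'I_3) : (6 * b + 3 * s + i < 13)%N.
Proof. by case: b b_lt2 => [|[]] //; case: s s_lt2 => [|[]] //; case: i => [[|[|[]]]]. Qed.

Definition x_index (i : 'I_3) : 'I_13 := Ordinal (block_lt (s := 0) isT i).
Definition y_index (i : 'I_3) : 'I_13 := Ordinal (block_lt (s := 1) isT i).

Lemma x_index_div i : (x_index i %/ 6 = b)%N.
Proof. by rewrite /=; case: b b_lt2 => [|[]] // _; case: i => [[|[|[]]]]. Qed.

Lemma y_index_div i : (y_index i %/ 6 = b)%N.
Proof. by rewrite /=; case: b b_lt2 => [|[]] // _; case: i => [[|[|[]]]]. Qed.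

Lemma x_index_inj (i j : 'I_3) : (x_index i == x_index j) = (i == j).
Proof.
rewrite -?val_eqE /=; case: b b_lt2 => [|[]] // _;
  by case: i => [[|[|[]]]] // ?; case: j => [[|[|[]]]].
Qed.

Lemma y_index_inj (i j : 'I_3) : (y_index i == y_index j) = (i == j).
Proof.
rewrite -?val_eqE /=; case: b b_lt2 => [|[]] // _;
  by case: i => [[|[|[]]]] // ?; case: j => [[|[|[]]]].
Qed.

Lemma xy_index_neq (i j : 'I_3) : (x_index i == y_index j) = false.
Proof.
rewrite -?val_eqE /=; case: b b_lt2 => [|[]] // _;
  by case: i => [[|[|[]]]] // ?; case: j => [[|[|[]]]].
Qed.

Lemma xx_sl (i j : 'I_3) : sl_pair (x_index i) (x_index j) = false.
Proof.
rewrite -?val_eqE /=; case: b b_lt2 => [|[]] // _;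
  by case: i => [[|[|[]]]] // ?; case: j => [[|[|[]]]].
Qed.

Lemma yy_sl (i j : 'I_3) : sl_pair (y_index i) (y_index j) = false.
Proof.
rewrite -?val_eqE /=; case: b b_lt2 => [|[]] // _;
  by case: i => [[|[|[]]]] // ?; case: j => [[|[|[]]]].
Qed.

Lemma xy_sl (i j : 'I_3) : sl_pair (x_index i) (y_index j).
Proof.
rewrite -?val_eqE /=; case: b b_lt2 => [|[]] // _;
  by case: i => [[|[|[]]]] // ?; case: j => [[|[|[]]]].
Qed.

Lemma xy_lt (i j : 'I_3) : (x_index i < y_index j)%N.
Proof.
rewrite -?val_eqE /=; case: b b_lt2 => [|[]] // _;
  by case: i => [[|[|[]]]] // ?; case: j => [[|[|[]]]].
Qed.

Lemma xy_mod (i j : 'I_3) : (x_index i %% 3 == y_index j %% 3)%N = (i == j).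
Proof.
rewrite -?val_eqE /=; case: b b_lt2 => [|[]] // _;
  by case: i => [[|[|[]]]] // ?; case: j => [[|[|[]]]].
Qed.

Lemma xx_gram (i j : 'I_3) : gram_weight (x_index i) (x_index j) = 0%N.
Proof.
rewrite -?val_eqE /=; case: b b_lt2 => [|[]] // _;
  by case: i => [[|[|[]]]] // ?; case: j => [[|[|[]]]].
Qed.

Lemma yy_gram (i j : 'I_3) : gram_weight (y_index i) (y_index j) = 0%N.
Proof.
rewrite -?val_eqE /=; case: b b_lt2 => [|[]] // _;
  by case: i => [[|[|[]]]] // ?; case: j => [[|[|[]]]].
Qed.

Lemma xy_gram (i j : 'I_3) : gram_weight (x_index i) (y_index j) = (i == j).
Proof.
rewrite -?val_eqE /=; case: b b_lt2 => [|[]] // _;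
  by case: i => [[|[|[]]]] // ?; case: j => [[|[|[]]]].
Qed.

Lemma yx_gram (i j : 'I_3) : gram_weight (y_index i) (x_index j) = (i == j).
Proof.
rewrite -?val_eqE /=; case: b b_lt2 => [|[]] // _;
  by case: i => [[|[|[]]]] // ?; case: j => [[|[|[]]]].
Qed.

Local Notation X := (colsub x_index G).
Local Notation Y := (colsub y_index G).
Local Notation X' := (rowsub x_index G').
Local Notation Y' := (rowsub y_index G').

Lemma sub_mul (f g : 'I_3 -> 'I_13) :
  rowsub f G' *m colsub g G = \matrix_(i, j) (f i == g j)%:R.
Proof.
apply/matrixP => i j; rewrite !mxE.
have /matrixP/(_ (f i) (g j)) := mulVmx frame_unit.
by rewrite !mxE => <-; apply: eq_bigr => l _; rewrite !mxE.
Qed.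

Lemma sub_gram (f g : 'I_3 -> 'I_13) :
  (colsub f G)^T *m (Q + Q^T) *m colsub g G = \matrix_(i, j) (gram_weight (f i) (g j))%:R.
Proof.
apply/matrixP => i j; rewrite [RHS]mxE.
have /matrixP/(_ (f i) (g j)) := frame_gram; rewrite [X in _ = X -> _]mxE => <-.
rewrite mxE [RHS]mxE; apply: eq_bigr => l _; rewrite !mxE; congr (_ * _).
by apply: eq_bigr => m _; rewrite !mxE.
Qed.

Lemma sub_polar (A : comAlgType k) (f g : 'I_3 -> 'I_13) (u v : 'cV[A]_3) :
  clifford_polar Q (inA A (colsub f G) *m u) (inA A (colsub g G) *m v) =
  (u^T *m inA A (\matrix_(i, j) (gram_weight (f i) (g j))%:R) *m v) 0 0.
Proof. by rewrite /clifford_polar trmx_mul -sub_gram !map_mxM map_trmx !mulmxA. Qed.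

Lemma block_XX : X' *m X = 1%:M.
Proof. by rewrite sub_mul; apply/matrixP => i j; rewrite !mxE x_index_inj. Qed.
Lemma block_YY : Y' *m Y = 1%:M.
Proof. by rewrite sub_mul; apply/matrixP => i j; rewrite !mxE y_index_inj. Qed.
Lemma block_XY : X' *m Y = 0.
Proof. by rewrite sub_mul; apply/matrixP => i j; rewrite !mxE xy_index_neq. Qed.
Lemma block_YX : Y' *m X = 0.
Proof. by rewrite sub_mul; apply/matrixP => i j; rewrite !mxE eq_sym xy_index_neq. Qed.

Lemma block_qform (A : comAlgType k) (l m : 'cV[A]_3) :
  qform (inA A Q) (inA A X *m l + inA A Y *m m) = (l^T *m m) 0 0.
Proof.
apply/eqP; rewrite -subr_eq0; apply/eqP; apply: (@mulrSn_eq0 k A 1).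
rewrite mulrnBl -qform_polar clifford_polarDl !clifford_polarDr !sub_polar.
have -> : \matrix_(i, j) (gram_weight (x_index i) (x_index j))%:R = 0 :> 'M[k]_3.
  by apply/matrixP => i j; rewrite !mxE xx_gram.
have -> : \matrix_(i, j) (gram_weight (y_index i) (y_index j))%:R = 0 :> 'M[k]_3.
  by apply/matrixP => i j; rewrite !mxE yy_gram.
have -> : \matrix_(i, j) (gram_weight (x_index i) (y_index j))%:R = 1%:M :> 'M[k]_3.
  by apply/matrixP => i j; rewrite !mxE xy_gram.
have -> : \matrix_(i, j) (gram_weight (y_index i) (x_index j))%:R = 1%:M :> 'M[k]_3.
  by apply/matrixP => i j; rewrite !mxE yx_gram.
rewrite map_mx0 map_mx1 !mulmx0 !mul0mx !mulmx1 mxE add0r addr0.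
have -> : m^T *m l = (l^T *m m)^T by rewrite trmx_mul trmxK.
by move: (l^T *m m) => x; rewrite !mxE; ring.
Qed.

Lemma block_fwd (A : comAlgType k) (l m l' m' : 'cV[A]_3) :
  clifford_ext c (inA A X *m l + inA A Y *m m) *m
  clifford_ext c (inA A X *m l' + inA A Y *m m') *m inA A delta = 0 ->
  forall i j, l i 0 * l' j 0 = l j 0 * l' i 0 /\ m i 0 * m' j 0 = m j 0 * m' i 0.
Proof.
pose t (l m : 'cV[A]_3) := inA A G' *m (inA A X *m l + inA A Y *m m).
have tE l1 m1 : inA A X *m l1 + inA A Y *m m1 = inA A G *m t l1 m1.
  by rewrite /t mulmxA -map_mxM mulmxV ?frame_unit // map_mx1 mul1mx.
have subE (f : 'I_3 -> 'I_13) u i : (inA A G' *m u) (f i) 0 = (inA A (rowsub f G') *m u) i 0.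
  by rewrite !mxE; apply: eq_bigr => a _; rewrite !mxE.
have tx l1 m1 i : t l1 m1 (x_index i) 0 = l1 i 0.
  rewrite /t subE mulmxDr !mulmxA -!map_mxM block_XX block_XY map_mx1 map_mx0.
  by rewrite mul1mx mul0mx addr0.
have ty l1 m1 i : t l1 m1 (y_index i) 0 = m1 i 0.
  rewrite /t subE mulmxDr !mulmxA -!map_mxM block_YY block_YX map_mx1 map_mx0.
  by rewrite mul1mx mul0mx add0r.
rewrite !tE => /frame_wedge ts i j; rewrite -!(tx l m) -!(tx l' m') -!(ty l m) -!(ty l' m').
by split; apply: ts; rewrite ?xx_sl ?yy_sl.
Qed.

(** Of the four partial products, the XX and YY ones have symmetric coefficients against
    anticommuting operators, so they equal their own opposites. The XY one acts on delta by the
    scalar product of [l] and [m'], which is zero; the YX one is reduced to this type by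
    anticommutation, since [l'] and [m] are orthogonal. *)
Lemma block_bwd (A : comAlgType k) (l m l' m' : 'cV[A]_3) :
  (forall i j, l i 0 * l' j 0 = l j 0 * l' i 0) ->
  (forall i j, m i 0 * m' j 0 = m j 0 * m' i 0) ->
  (l^T *m m') 0 0 = 0 -> (l'^T *m m) 0 0 = 0 ->
  clifford_ext c (inA A X *m l + inA A Y *m m) *m
  clifford_ext c (inA A X *m l' + inA A Y *m m') *m inA A delta = 0.
Proof.
move=> ll mm lm ml.
have extE (f : 'I_3 -> 'I_13) u : clifford_ext c (inA A (colsub f G) *m u) =
    \sum_i u i 0 *: inA A (C (f i)).
  rewrite clifford_ext_mulmx; apply: eq_bigr => i _.
  rewrite -map_col clifford_ext_map; congr (_ *: inA A (c _)).
  by apply/colP => a; rewrite !mxE.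
have prodE (f g : 'I_3 -> 'I_13) u v : clifford_ext c (inA A (colsub f G) *m u) *m
    clifford_ext c (inA A (colsub g G) *m v) =
    \sum_i \sum_j (u i 0 * v j 0) *: inA A (C (f i) *m C (g j)).
  rewrite !extE mulmx_suml; apply: eq_bigr => i _; rewrite mulmx_sumr.
  by apply: eq_bigr => j _; rewrite -scalemxAl -scalemxAr scalerA map_mxM.
have sym0 (f : 'I_3 -> 'I_13) (u v : 'cV[A]_3) : (forall i j, gram_weight (f i) (f j) = 0%N) ->
    (forall i j, u i 0 * v j 0 = u j 0 * v i 0) ->
    clifford_ext c (inA A (colsub f G) *m u) *m clifford_ext c (inA A (colsub f G) *m v) = 0.
  move=> f0 uv; set S := _ *m _.
  have SS : S = - S.
    rewrite {1}/S prodE exchange_big /S prodE -sumrN; apply: eq_bigr => i _ /=.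
    rewrite -sumrN; apply: eq_bigr => j _; rewrite uv -scalerN -raddfN /=.
    congr (_ *: inA A _); apply/eqP; rewrite -addr_eq0 anticomm f0.
    by rewrite raddf0.
  apply/matrixP => i j; rewrite [RHS]mxE; apply: (@mulrSn_eq0 k A 1).
  by rewrite mulr2n {1}SS mxE addNr.
have xy0 u v : (u^T *m v) 0 0 = 0 :> A -> clifford_ext c (inA A X *m u) *m
    clifford_ext c (inA A Y *m v) *m inA A delta = 0.
  move=> uv; transitivity ((u^T *m v) 0 0 *: inA A (C (x_index 0) *m C (y_index 0) *m delta));
    last by rewrite uv scale0r.
  rewrite prodE mulmx_suml mxE scaler_suml; apply: eq_bigr => i _.
  rewrite mulmx_suml (bigD1 i) //= big1 ?addr0 => [|j ji]; rewrite -scalemxAl -map_mxM.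
    rewrite mxE; congr (_ *: inA A _); apply: sl_diag; rewrite ?xy_lt ?xy_sl ?x_index_div //;
    by apply/eqP; rewrite xy_mod.
  by rewrite sl_off ?map_mx0 ?scaler0 ?xy_lt ?xy_sl // xy_mod eq_sym.
have yx : clifford_ext c (inA A Y *m m) *m clifford_ext c (inA A X *m l') =
    - (clifford_ext c (inA A X *m l') *m clifford_ext c (inA A Y *m m)).
  apply/eqP; rewrite -addr_eq0 (clifford_anticomm cliff) sub_polar.
  have -> : \matrix_(i, j) (gram_weight (y_index i) (x_index j))%:R = 1%:M :> 'M[k]_3.
    by apply/matrixP => i j; rewrite !mxE yx_gram.
  rewrite map_mx1 mulmx1; have -> : m^T *m l' = (l'^T *m m)^T by rewrite trmx_mul trmxK.
  by rewrite mxE ml raddf0.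
rewrite !clifford_extD !(mulmxDl, mulmxDr) (sym0 x_index) //; last exact: xx_gram.
rewrite (sym0 y_index) //; last exact: yy_gram.
by rewrite yx mulNmx !xy0 // mul0mx oppr0 !addr0.
Qed.

Definition in_block (A : comAlgType k) : set (pt (zero_locus Q c delta) A) :=
  [set U | forall u, sval (sval (sval U)) u ->
     forall j : 'I_13, (j %/ 6 != b)%N -> (inA A G' *m u) j 0 = 0].

Lemma in_map_alg (A B : comAlgType k) (g : {lrmorphism A -> B}) p q (M : 'M[k]_(p, q)) :
  map_mx g (inA A M) = inA B M.
Proof. by apply/matrixP => i j; rewrite !mxE rmorph_alg. Qed.

Lemma in_block_pull (A B : comAlgType k) (g : {lrmorphism A -> B})
  (U : pt (zero_locus Q c delta) A) : in_block U -> in_block (pull g U).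
Proof.
move=> Ub w [m [M [a [MU ->]]]] j jb; rewrite mulmxA mxE big1 // => l _.
have [u Uu uM] := MU l.
have -> : (inA B G' *m M) j l = g ((inA A G' *m u) j 0).
  transitivity ((inA B G' *m col l M) j 0).
    by rewrite !mxE; apply: eq_bigr => i _; rewrite !mxE.
  by rewrite -uM -(in_map_alg g) -map_mxM mxE.
by rewrite Ub // rmorph0 mul0r.
Qed.

Definition block_locus : subkfunctor (zero_locus Q c delta) := SubKFunctor in_block_pull.

Lemma big_block (A : nmodType) (F : 'I_13 -> A) :
  \sum_(j : 'I_13 | (j %/ 6 == b)%N) F j = \sum_i F (x_index i) + \sum_i F (y_index i).
Proof.
pose f (j : nat) := F (inord j).
have fE (j : 'I_13) : F j = f j by rewrite /f inord_val.
under eq_bigr do rewrite fE; under [X in _ = X + _]eq_bigr do rewrite fE.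
under [X in _ = _ + X]eq_bigr do rewrite fE.
rewrite big_mkcond /=; case: b b_lt2 => [|[]] // _; rewrite !big_ord_recl !big_ord0 /=.
  by rewrite !addr0 !addrA.
by rewrite !addr0 !add0r !addrA.
Qed.

Lemma block_locus_kiso : kiso block_locus (Fl3 k).
Proof.
apply: (block_kiso cliff Q_unit block_XX block_YY block_XY block_YX block_qform
  block_fwd block_bwd) => A U.
have GG : inA A G *m inA A G' = 1%:M.
  by rewrite -map_mxM mulmxV ?frame_unit // map_mx1.
have coord (v : 'cV[A]_13) : inA A X *m (inA A X' *m v) + inA A Y *m (inA A Y' *m v) =
    inA A G *m (\col_j (if (j %/ 6 == b)%N then (inA A G' *m v) j 0 else 0)).
  apply/colP => a; rewrite !mxE.
  under [RHS]eq_bigr => j _ do rewrite mxE.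
  rewrite (bigID (fun j : 'I_13 => j %/ 6 == b)%N) /= [X in _ = _ + X]big1 ?addr0; last first.
    by move=> j /negPf ->; rewrite mulr0.
  rewrite big_block; congr (_ + _); apply: eq_bigr => i _;
    rewrite ?x_index_div ?y_index_div eqxx [LHS]mulrC [RHS]mulrC !mxE; congr (_ * _);
    by apply: eq_bigr => l _; rewrite !mxE.
split=> [Ub u Uu|Ub u Uu j jb].
  rewrite coord; have -> : \col_j (if (j %/ 6 == b)%N then (inA A G' *m u) j 0 else 0) = inA A G' *m u.
    by apply/colP => j; rewrite [LHS]mxE; case: ifPn => // jb; rewrite (Ub u Uu).
  by rewrite mulmxA GG mul1mx.
rewrite [u in LHS](Ub u Uu) coord mulmxA -map_mxM mulVmx ?frame_unit //.
by rewrite map_mx1 mul1mx mxE (negPf jb).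
Qed.

End Block.

Lemma sl_pair_div (i j : nat) : (i %/ 6 != j %/ 6)%N -> sl_pair i j = false.
Proof. by rewrite /sl_pair => /negPf ->. Qed.

(** This turns membership after any base change into equations on the rows of one matrix over [A],
    which an idempotent of [A] can control. *)
Lemma in_block_rows b (A B : comAlgType k) (g : {lrmorphism A -> B}) (E : 'M[A]_13)
    (U : pt (zero_locus Q c delta) A) :
  E *m E = E -> sval (sval (sval U)) = [set v | E *m v = v]%classic ->
  in_block b (pull g U) <-> forall i j : 'I_13, (i %/ 6 != b)%N ->
    g ((inA A G' *m E *m inA A G) i j) = 0.
Proof.
move=> EE UE.
have gU : sval (sval (sval (pull g U))) = [set v | map_mx g E *m v = v]%classic.
  by rewrite /= UE base_changeE.
have gEE : map_mx g E *m map_mx g E = map_mx g E by rewrite -map_mxM EE.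
have gE : map_mx g (inA A G' *m E *m inA A G) = inA B G' *m map_mx g E *m inA B G.
  by rewrite !map_mxM !in_map_alg.
rewrite /in_block /= -[base_change _ _]/(sval (sval (sval (pull g U)))) gU.
split=> [Ub i j ib|Eb u /= Eu i ib].
  have -> : g ((inA A G' *m E *m inA A G) i j) =
      (inA B G' *m col j (map_mx g E *m inA B G)) i 0.
    transitivity ((map_mx g (inA A G' *m E *m inA A G)) i j); first by rewrite [RHS]mxE.
    by rewrite gE colE !mulmxA -colE [RHS]mxE.
  by apply: Ub => //=; rewrite colE !mulmxA gEE.
have -> : inA B G' *m u = map_mx g (inA A G' *m E *m inA A G) *m (inA B G' *m u).
  rewrite gE -!mulmxA (mulmxA (inA B G)) -map_mxM mulmxV ?frame_unit // map_mx1 mul1mx.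
  by rewrite Eu.
by rewrite mxE big1 // => j _; rewrite mxE Eb ?mul0r.
Qed.

(** In frame coordinates the rows of the projector [F] fall into three groups: the two blocks and
    the row of n. No [sl_pair] joins different groups, so the mixed minors vanish and
    [split_idempotent] for block 0 supplies [e]. It remains to kill the row of n, after which 1 - e
    belongs to block 1. *)
Lemma disjoint_blocks : disjoint_union (block_locus 0) (block_locus 1).
Proof.
move=> A U.
have [E [EE UE rE]] := svalP (sval (sval U)).
have isoE u : E *m u = u -> qform (inA A Q) u = 0.
  by move=> Eu; apply: (svalP (sval U)); rewrite UE.
have zE : clifford_image c [set v | E *m v = v]%classic (inA A delta).
  by have := svalP U; rewrite /= /zero_pt /= UE.
pose F := inA A G' *m E *m inA A G.
have GG : inA A G *m inA A G' = 1%:M.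
  by rewrite -map_mxM mulmxV ?frame_unit // map_mx1.
have FF : F *m F = F.
  by rewrite /F -!mulmxA (mulmxA (inA A G)) GG mul1mx (mulmxA E) EE.
have trF : \tr F = 2%:R.
  by rewrite /F mxtrace_mulC mulmxA GG mul1mx (rank2_trace EE rE).
have wedge (i j a b : 'I_13) : (i %/ 6 != j %/ 6)%N -> F i a * F j b = F i b * F j a.
  move=> ij; have colF l : inA A G *m col l F = E *m col l (inA A G).
    by rewrite /F !colE !mulmxA GG mul1mx.
  have EcolF l : E *m (inA A G *m col l F) = inA A G *m col l F.
    by rewrite colF mulmxA EE.
  have cE l m : (col l F) m 0 = F m l by rewrite mxE.
  have W := frame_wedge (clifford_image_mul0 cliff EE isoE rE zE (EcolF a) (EcolF b)).
  have := W i j; rewrite sl_pair_div // !cE => -> //.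
  exact: mulrC.
have split b := @split_idempotent k A 13 F (fun i : 'I_13 => i %/ 6 == b)%N FF trF.
have ES b (i j a d : 'I_13) : (i %/ 6 == b)%N -> (j %/ 6 != b)%N ->
    F i a * F j d = F i d * F j a.
  by move=> /eqP <- ji; apply: wedge; rewrite eq_sym.
have [e0e0 e0F e0F0] := split 0%N (ES 0%N).
set e := in_alg A _ * _ in e0e0 e0F e0F0.
have hA2 : in_alg A 2%:R^-1 * 2%:R = 1.
  by rewrite -(rmorph_nat (in_alg A)) -rmorphM mulVf ?rmorph1 // pnatr_eq0.
have last_row (i : 'I_13) : (i %/ 6 == 2)%N = (i == ord_max).
  exact: (eqP (@forall_ord13 (fun i => (i %/ 6 == 2) == (i == 12))%N isT i)).
(* A plane cannot be supported on one coordinate: [e2] is half of the last diagonal entry of [F] and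
   kills the other rows, so this entry of F F = F gives 4 e2 = 2 e2. *)
have F12 (j a : 'I_13) : (j %/ 6 == 2)%N -> F j a = 0.
  have [e2e2 e2F e2F0] := split 2%N (ES 2%N).
  set e2 := in_alg A _ * _ in e2e2 e2F e2F0.
  have e2E : F ord_max ord_max = 2%:R * e2.
    by rewrite /e2 mulrA (mulrC 2%:R) hA2 mul1r (eq_bigl _ _ last_row) big_pred1_eq.
  have : e2 * F ord_max ord_max = e2 * (F *m F) ord_max ord_max by rewrite FF.
  rewrite [(F *m F) _ _]mxE mulr_sumr (bigD1 ord_max) //= big1 ?addr0 => [|l lm]; last first.
    by rewrite mulrCA e2F0 ?mulr0 // last_row.
  rewrite mulrCA !e2F // e2E => e22.
  have e20 : e2 = 0.
    apply: (@mulrSn_eq0 k A 1); rewrite -mulr_natl.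
    apply: (addrI (2%:R * e2)); rewrite addr0 [RHS]e22.
    by rewrite mulrACA e2e2; ring.
  by move=> j2; rewrite -e2F // e20 mul0r.
exists e; split=> // B g.
have R0 := in_block_rows 0 g EE UE; have R1 := in_block_rows 1 g EE UE; rewrite -/F in R0 R1.
have ge : g e = in_alg B 2%:R^-1 * \sum_(i : 'I_13 | (i %/ 6 == 0)%N) g (F i i).
  by rewrite rmorphM rmorph_sum; congr (_ * _); apply: rmorph_alg.
have h2 : in_alg B 2%:R^-1 * 2%:R = 1.
  by rewrite -(rmorph_nat (in_alg B)) -rmorphM mulVf ?rmorph1 // pnatr_eq0.
split.
  split=> [/R0 F0|e1].
    have := congr1 g trF; rewrite rmorph_nat => g2.
    rewrite ge -[RHS]h2 -g2 /mxtrace rmorph_sum.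
    rewrite [in RHS](bigID (fun i : 'I_13 => i %/ 6 == 0)%N) /=.
    by rewrite [X in _ = _ * (_ + X)]big1 ?addr0 // => i ?; rewrite F0.
  by apply/R0 => i j i0; rewrite -[LHS]mul1r -e1 -rmorphM e0F0 ?rmorph0.
split=> [/R1 F0|e1].
  by rewrite ge big1 ?mulr0 // => i /eqP i0; rewrite F0 // i0.
apply/R1 => i j i1; case i0: (i %/ 6 == 0)%N.
  by rewrite -e0F // rmorphM [X in X * _]e1 mul0r.
rewrite F12 ?rmorph0 //.
have := forall_ord13 (P := fun i => [|| i %/ 6 == 0, i %/ 6 == 1 | i %/ 6 == 2])%N isT i.
by rewrite i0 (negPf i1).
Qed.

Lemma frame_zero_locus : exists Z1 Z2 : subkfunctor (zero_locus Q c delta),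
  [/\ disjoint_union Z1 Z2, kiso Z1 (Fl3 k) & kiso Z2 (Fl3 k)].
Proof.
exists (block_locus 0), (block_locus 1); split; first exact: disjoint_blocks.
  exact: block_locus_kiso.
exact: block_locus_kiso.
Qed.

End Frame.

(** * Adapted frames *)

Definition off_pairs : seq (nat * nat) :=
  [seq p <- [seq (i, j) | i <- iota 0 13, j <- iota 0 13]
   | (p.1 < p.2)%N && ~~ sl_pair p.1 p.2].

Lemma size_off_pairs : size off_pairs = 60%N. Proof. by []. Qed.

Lemma off_pairsP (p : nat) : (p < 60)%N -> let q := nth (0, 0)%N off_pairs p in
  [/\ (q.1 < q.2)%N, (q.2 < 13)%N & ~~ sl_pair q.1 q.2].
Proof.
move=> p60; have /allP h : all (fun p => let q := nth (0, 0)%N off_pairs p in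
  [&& (q.1 < q.2)%N, (q.2 < 13)%N & ~~ sl_pair q.1 q.2]) (iota 0 60) by [].
by have := h p; rewrite mem_iota p60 => /(_ isT)/and3P[].
Qed.

Lemma index_off_pairs (i j : nat) : (i < j)%N -> (j < 13)%N -> ~~ sl_pair i j ->
  (index (i, j) off_pairs < 60)%N /\ nth (0, 0)%N off_pairs (index (i, j) off_pairs) = (i, j).
Proof.
move=> ij j13 nsl; have ijin : (i, j) \in off_pairs.
  rewrite mem_filter; apply/andP; split; first by rewrite ij.
  apply/allpairsPdep; exists i, j; split=> //.
    by rewrite mem_iota /= (ltn_trans ij).
  by rewrite mem_iota.
by rewrite -size_off_pairs index_mem nth_index.
Qed.

Opaque off_pairs.

Section Adapted.
Variable k : numFieldType.
Implicit Types (C : 'I_13 -> 'M[k]_64) (delta : 'cV[k]_64).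

Definition spin_col C delta (p : nat) : 'cV[k]_64 :=
  let D i := C (inord i) in
  if (p < 60)%N then let q := nth (0, 0)%N off_pairs p in D q.1 *m D q.2 *m delta
  else if p == 60%N then delta
  else if p == 61%N then D 0%N *m D 3%N *m delta
  else if p == 62%N then D 6%N *m D 9%N *m delta
  else D 0%N *m D 3%N *m (D 6%N *m D 9%N *m delta).

Definition spin_mx C delta : 'M[k]_64 := \matrix_(i, p) spin_col C delta p i 0.

Definition clifford_frame C :=
  forall i j, C i *m C j + C j *m C i = (gram_weight i j)%:R%:M.

Definition sl_invariant C delta :=
  (forall i j : 'I_13, (i < j)%N -> sl_pair i j -> (i %% 3 != j %% 3)%N ->
     C i *m C j *m delta = 0) /\
  (forall i j i' j' : 'I_13, (i < j)%N -> sl_pair i j -> (i %% 3 = j %% 3)%N ->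
     (i' < j')%N -> sl_pair i' j' -> (i' %% 3 = j' %% 3)%N -> (i %/ 6 = i' %/ 6)%N ->
     C i *m C j *m delta = C i' *m C j' *m delta).

Definition adapted C delta :=
  [/\ clifford_frame C, sl_invariant C delta & spin_mx C delta \in unitmx].

Lemma col_spin_mx C delta (p : 'I_64) : col p (spin_mx C delta) = spin_col C delta p.
Proof. by apply/colP => i; rewrite !mxE. Qed.

Lemma gram_weight_sym (i j : 'I_13) : gram_weight i j = gram_weight j i.
Proof.
by apply/eqP; move: i j; apply: (@forall_ord13_2 (fun i j => gram_weight i j == gram_weight j i)).
Qed.

Lemma sl_pair_sym i j : sl_pair i j = sl_pair j i.
Proof. by rewrite /sl_pair eq_sym [X in _ && ~~ X]eq_sym. Qed.

Lemma off_gram0 (i j : 'I_13) : ~~ sl_pair i j -> i != j -> gram_weight i j = 0%N.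
Proof.
move=> nsl; rewrite -val_eqE => ij; apply/eqP.
have := @forall_ord13_2 (fun i j => ~~ sl_pair i j ==> (i != j) ==> (gram_weight i j == 0%N)) isT i j.
by rewrite nsl ij.
Qed.

Lemma clifford_frameC C : clifford_frame C -> forall i j : 'I_13,
  C i *m C j = (gram_weight i j)%:R%:M - C j *m C i.
Proof. by move=> CC i j; rewrite -CC addrK. Qed.

Lemma clifford_frame_sq C : clifford_frame C -> forall i : 'I_13,
  C i *m C i = ((gram_weight i i)%:R / 2%:R)%:M.
Proof.
move=> CC i; have := CC i i; rewrite -mulr2n -(scaler_nat 2) => /(canRL (scalerK _)) ->.
  by rewrite scale_scalar_mx mulrC.
by rewrite pnatr_eq0.
Qed.

(** The functional is a row of the inverse of the spin matrix. Every product of two frame vectors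
    applied to delta reduces to its columns: products from an [sl_pair] in increasing order vanish
    or equal column 61 or 62, and squares and reversed orders differ only by multiples of delta,
    which is column 60 and is killed. *)
Lemma adapted_functional C delta : adapted C delta ->
  forall i j : 'I_13, i != j -> ~~ sl_pair i j ->
  exists L : 'rV[k]_64, forall a b : 'I_13,
    L *m (C a *m C b *m delta) = (((a == i) && (b == j))%:R - ((a == j) && (b == i))%:R)%:M.
Proof.
move=> [CC [off diag] Mu].
have main (i j : 'I_13) : (i < j)%N -> ~~ sl_pair i j ->
  exists L : 'rV[k]_64, forall a b : 'I_13,
    L *m (C a *m C b *m delta) = (((a == i) && (b == j))%:R - ((a == j) && (b == i))%:R)%:M.
  move=> ij nsl; have [p60 pE] := index_off_pairs ij (ltn_ord j) nsl.
  pose p : 'I_64 := Ordinal (leq_trans p60 (isT : (60 <= 64)%N)).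
  pose L := row p (invmx (spin_mx C delta)).
  have Lcol (q : 'I_64) : L *m spin_col C delta q = (p == q)%:R%:M.
    rewrite -col_spin_mx /L rowE colE mulmxA -(mulmxA (delta_mx 0 p)) mulVmx //.
    by rewrite mulmx1; apply/matrixP => x y; rewrite !ord1 -colE !mxE eqxx eq_sym.
  have L0 (q : nat) : (60 <= q < 64)%N -> L *m spin_col C delta q = 0.
    move=> /andP[q60 q64]; have -> := Lcol (Ordinal q64).
    by rewrite -val_eqE /= ltn_eqF ?raddf0 // (leq_trans p60).
  have Ldelta : L *m delta = 0 by apply: (L0 60%N).
  have Llt (a b : 'I_13) : (a < b)%N ->
      L *m (C a *m C b *m delta) = ((a == i) && (b == j))%:R%:M.
    move=> ab; have [sl|nslab] := boolP (sl_pair a b).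
      have -> : (a == i) && (b == j) = false.
        by apply/negP => /andP[/eqP ai /eqP bj]; rewrite -ai -bj sl in nsl.
      rewrite raddf0; have [ab3|ab3] := eqVneq (a %% 3)%N (b %% 3)%N; last first.
        by rewrite off // mulmx0.
      have [a6|a6] := eqVneq (a %/ 6)%N 0%N.
        rewrite (diag a b (inord 0) (inord 3)) ?inordK //; exact: (L0 61%N).
      rewrite (diag a b (inord 6) (inord 9)) ?inordK //; first exact: (L0 62%N).
      have := @forall_ord13_2 (fun a b => sl_pair a b ==> (a %/ 6 != 0)%N ==> (a %/ 6 == 1)%N) isT a b.
      by rewrite sl a6 => /eqP.
    have [q60 qE] := index_off_pairs ab (ltn_ord b) nslab.
    have := Lcol (Ordinal (leq_trans q60 (isT : (60 <= 64)%N))).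
    rewrite /spin_col /= q60 qE /= !inord_val => ->; congr (_%:R%:M).
    rewrite -val_eqE /=; congr nat_of_bool; apply/eqP/andP => [pq|[/eqP -> /eqP ->]] //.
    by move: pE; rewrite pq qE => -[ai bj]; split; apply/eqP/val_inj.
  exists L => a b; case: (ltngtP a b) => [ab|ba|/val_inj <-].
  - rewrite Llt //; suff -> : (a == j) && (b == i) = false by rewrite subr0.
    by apply/negP => /andP[/eqP aj /eqP bi]; rewrite aj bi ltnNge (ltnW ij) in ab.
  - rewrite clifford_frameC // mulmxBl mul_scalar_mx mulmxBr -scalemxAr Ldelta scaler0.
    rewrite Llt // sub0r; suff -> : (a == i) && (b == j) = false.
      by rewrite sub0r andbC raddfN.
    by apply/negP => /andP[/eqP aj /eqP bi]; rewrite aj bi ltnNge (ltnW ij) in ba.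
  - rewrite clifford_frame_sq // mul_scalar_mx -scalemxAr Ldelta scaler0.
    suff [-> ->] : (a == i) && (a == j) = false /\ (a == j) && (a == i) = false.
      by rewrite subr0 raddf0.
    by split; apply/negP => /andP[/eqP a1 /eqP a2]; move: ij; rewrite -a1 -a2 ltnn.
move=> i j; case: (ltngtP i j) => [ij _|ji _|/val_inj ->]; last by rewrite eqxx.
  exact: main.
rewrite sl_pair_sym => /(main _ _ ji)[L LE]; exists (- L) => a b.
by rewrite mulNmx LE -raddfN opprB.
Qed.

Lemma spin_col_conj C delta (P P' : 'M[k]_64) p : P' *m P = 1%:M ->
  spin_col (fun i => P *m C i *m P') (P *m delta) p = P *m spin_col C delta p.
Proof.
move=> PP; have two i j v : P *m C i *m P' *m (P *m C j *m P') *m (P *m v) =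
    P *m (C i *m C j *m v).
  by rewrite -!mulmxA (mulmxA P' P v) PP mul1mx (mulmxA P' P) PP mul1mx.
by rewrite /spin_col; do ![case: ifP => _]; rewrite ?two.
Qed.

Lemma adapted_conj C delta (P P' : 'M[k]_64) : P *m P' = 1%:M -> P' *m P = 1%:M ->
  adapted C delta -> adapted (fun i => P *m C i *m P') (P *m delta).
Proof.
move=> PP' PP [CC [off diag] Mu].
have two i j v : P *m C i *m P' *m (P *m C j *m P') *m (P *m v) = P *m (C i *m C j *m v).
  by rewrite -!mulmxA (mulmxA P' P v) PP mul1mx (mulmxA P' P) PP mul1mx.
split.
- move=> i j; have mid a b : P *m C a *m P' *m (P *m C b *m P') = P *m (C a *m C b) *m P'.
    by rewrite -!mulmxA (mulmxA P' P) PP mul1mx.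
  by rewrite !mid -mulmxDl -mulmxDr CC mul_mx_scalar -scalemxAl PP' scalemx1.
- split=> [i j ij sl ij3|i j i' j' ij sl ij3 ij' sl' ij3' i6]; rewrite !two.
    by rewrite off // mulmx0.
  by rewrite (diag i j i' j').
- have -> : spin_mx (fun i => P *m C i *m P') (P *m delta) = P *m spin_mx C delta.
    apply/matrixP => i p; rewrite mxE spin_col_conj // !mxE.
    by apply: eq_bigr => l _; rewrite !mxE.
  by rewrite unitmx_mul Mu andbT; case/mulmx1_unit: PP'.
Qed.

Lemma gram_weight_mod (i j : 'I_13) : (i %% 3 != j %% 3)%N -> gram_weight i j = 0%N.
Proof.
move=> ij; apply/eqP.
have := @forall_ord13_2 (fun i j => (i %% 3 != j %% 3)%N ==> (gram_weight i j == 0%N)) isT i j.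
by rewrite ij.
Qed.

Lemma clifford_frame_comm C : clifford_frame C -> forall i j u v : 'I_13,
  gram_weight i u = 0%N -> gram_weight i v = 0%N -> gram_weight j u = 0%N -> gram_weight j v = 0%N ->
  C i *m C j *m (C u *m C v) = C u *m C v *m (C i *m C j).
Proof.
move=> CC i j u v iu iv ju jv.
have anti (a b : 'I_13) : gram_weight a b = 0%N -> C a *m C b = - (C b *m C a).
  by move=> ab; rewrite clifford_frameC // ab raddf0 sub0r.
rewrite !mulmxA -(mulmxA (C i)) (anti j u) // mulmxN mulmxA (anti i u) // !mulNmx opprK.
rewrite -!mulmxA (anti j v) // !mulmxN (mulmxA (C i)) (anti i v) // !mulNmx !mulmxN opprK.
by rewrite !mulmxA.
Qed.

(* Each product h = x_i y_i acts on an invariant spinor independently of i, hence i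
   may be chosen so that h commutes with a given root vector. *)
Lemma third_root (u v : 'I_13) (a b : nat) : (u < v)%N -> sl_pair u v ->
  exists w w' : 'I_13, [/\ (w < w')%N, sl_pair w w', (w %% 3 = w' %% 3)%N,
    (w %/ 6 = u %/ 6)%N & (a != w %% 3)%N && (b != w %% 3)%N].
Proof.
move=> uv sl.
have [r r3 rab] : exists2 r, (r < 3)%N & (a != r) && (b != r).
  by case: a b => [|[|a]] [|[|b]]; [exists 1%N|exists 2%N|exists 1%N|exists 2%N|
    exists 0%N|exists 0%N|exists 1%N|exists 0%N|exists 0%N].
have := @forall_ord13_2 (fun u v => sl_pair u v ==> (u < v)%N ==> (u %/ 6 < 2)%N) isT u v.
rewrite sl uv /= => u2; move: (u %/ 6)%N u2 => B B2.
exists (inord (6 * B + r)), (inord (6 * B + 3 + r)).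
case: B B2 => [|[]] // _; case: r r3 rab => [|[|[]]] // _ rab; by rewrite !inordK.
Qed.

Lemma sl_invariant_cartan C delta : clifford_frame C -> sl_invariant C delta ->
  forall u v : 'I_13, (u < v)%N -> sl_pair u v -> (u %% 3 = v %% 3)%N ->
  sl_invariant C (C u *m C v *m delta).
Proof.
move=> CC [off diag] u v uv sluv uv3.
have swap (w w' i j : 'I_13) : (i %% 3 != w %% 3)%N -> (j %% 3 != w %% 3)%N ->
    (w %% 3 = w' %% 3)%N ->
    C i *m C j *m (C w *m C w' *m delta) = C w *m C w' *m (C i *m C j *m delta).
  move=> iw jw ww; rewrite !mulmxA -!(mulmxA _ (C _) (C _)) -!mulmxA.
  rewrite !mulmxA -(mulmxA (C i *m C j)) clifford_frame_comm ?mulmxA //;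
    by apply: gram_weight_mod; rewrite -?ww.
split=> [i j ij sl ij3|i j i' j' ij sl ij3 ij' sl' ij3' i6].
  have [w [w' [lt ww ww3 w6 /andP[iw jw]]]] := third_root (i %% 3) (j %% 3) uv sluv.
  by rewrite (diag u v w w') // swap // off // mulmx0.
have [w [w' [lt ww ww3 w6 /andP[iw jw]]]] := third_root (i %% 3) (i' %% 3) uv sluv.
by rewrite (diag u v w w') // (swap w w' i j) -?ij3 // (swap w w' i' j') -?ij3' // (diag i j i' j').
Qed.

Lemma sl_invariantD C delta eta (s : k) : sl_invariant C delta -> sl_invariant C eta ->
  sl_invariant C (delta + s *: eta).
Proof.
move=> [off diag] [off' diag']; split=> [i j ij sl ij3|i j i' j' ij sl ij3 ij' sl' ij3' i6].
  by rewrite mulmxDr -scalemxAr off // off' // scaler0 addr0.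
by rewrite !mulmxDr -!scalemxAr (diag i j i' j') // (diag' i j i' j').
Qed.

Lemma spin_colD C delta eta (s : k) p :
  spin_col C (delta + s *: eta) p = spin_col C delta p + s *: spin_col C eta p.
Proof.
by rewrite /spin_col; do ![case: ifP => _]; rewrite ?mulmxDr -?scalemxAr ?mulmxDr -?scalemxAr.
Qed.

(** The frame stays fixed. Invariance is linear in the spinor and inherited by h1 delta, h2 delta
    and h1 h2 delta; the determinant of the spin matrix is polynomial along the line and nonzero at
    s = 0. *)
Lemma slice_line C delta (p : 'I_64) : adapted C delta -> (60 <= p)%N ->
  exists2 q : {poly k}, q != 0 &
  forall s, q.[s] != 0 -> adapted C (delta + s *: spin_col C delta p).
Proof.
move=> [CC sl Mu] p60; set eta := spin_col C delta p.
pose q := \det (map_mx polyC (spin_mx C delta) + 'X *: map_mx polyC (spin_mx C eta)).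
have qE s : q.[s] = \det (spin_mx C (delta + s *: eta)).
  rewrite /q -horner_evalE -det_map_mx; congr (\det _).
  apply/matrixP => i j; rewrite !mxE /= horner_evalE !hornerE.
  by rewrite spin_colD [RHS]mxE [X in _ = _ + X]mxE.
exists q.
  apply/eqP => q0; have := qE 0; rewrite q0 horner0 scale0r addr0 => /esym/eqP.
  by rewrite -[_ == 0]negbK -unitfE -unitmxE Mu.
move=> s qs; split=> //; last by rewrite unitmxE unitfE -qE.
apply: sl_invariantD => //.
have h0 d : sl_invariant C d -> sl_invariant C (C (inord 0) *m C (inord 3) *m d).
  by move=> dsl; apply: sl_invariant_cartan; rewrite // ?inordK.
have h6 d : sl_invariant C d -> sl_invariant C (C (inord 6) *m C (inord 9) *m d).
  by move=> dsl; apply: sl_invariant_cartan; rewrite // ?inordK.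
rewrite /eta /spin_col ltnNge p60 /=; do ![case: ifP => _]; auto.
Qed.

End Adapted.

Section RootLine.
Variable k : numFieldType.
Variable c : {linear 'cV[k]_13 -> 'M[k]_64}.
Notation ops G := (fun i : 'I_13 => c (col i G)).

Lemma adapted_ext (C D : 'I_13 -> 'M[k]_64) delta : C =1 D -> adapted C delta -> adapted D delta.
Proof. by move=> /funext ->. Qed.

(* [1 + s a b] and [1 - s a b] are inverse spin group elements, and conjugation
   by them preserves the image of [c]. *)
Lemma root_line (G : 'M[k]_13) delta (p : 'I_64) (s : k) : adapted (ops G) delta -> (p < 60)%N ->
  exists G2, adapted (ops G2) (delta + s *: spin_col (ops G) delta p).
Proof.
move=> ad p60; have [CC _ _] := ad.
have [ij j13 nsl] := off_pairsP p60; set q := nth (0, 0)%N off_pairs p in ij j13 nsl.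
pose i : 'I_13 := inord q.1; pose j : 'I_13 := inord q.2.
have iE : i = q.1 :> nat by rewrite inordK // (ltn_trans ij).
have jE : j = q.2 :> nat by rewrite inordK.
pose a := c (col i G); pose b := c (col j G).
have neq : i != j by rewrite -val_eqE /= iE jE (ltn_eqF ij).
have ab0 : gram_weight i j = 0%N by apply: off_gram0; rewrite ?iE ?jE.
have ba : b *m a = - (a *m b).
  have := CC i j; rewrite /= -/a -/b ab0 raddf0 addrC => e.
  by apply/eqP; rewrite -addr_eq0 e.
(* The smaller index of a pair is never 12, so [a] is isotropic even when [b] is n. This is what
   makes the square of a b vanish. *)
have aa : a *m a = 0.
  have -> : a *m a = ((gram_weight i i)%:R / 2%:R)%:M by apply: (clifford_frame_sq CC i).
  rewrite (_ : gram_weight i i = 0%N) ?mul0r ?raddf0 //.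
  have := @forall_ord13_2 (fun i j => (i < j)%N ==> (gram_weight i i == 0%N)) isT i j.
  by rewrite iE jE ij => /eqP.
pose w (m : 'I_13) : k := (gram_weight j m)%:R; pose u (m : 'I_13) : k := (gram_weight i m)%:R.
pose bb : k := (gram_weight j j)%:R / 2%:R.
have bbE : b *m b = bb%:M by apply: (clifford_frame_sq CC j).
pose x := a *m b.
have bab : b *m x = - (bb *: a).
  by rewrite mulmxA ba mulNmx -mulmxA bbE mul_mx_scalar.
have xx : x *m x = 0 by rewrite -mulmxA bab mulmxN -scalemxAr aa scaler0 oppr0.
have PP : (1%:M + s *: x) *m (1%:M - s *: x) = 1%:M.
  rewrite mulmxBr mulmx1 mulmxDl mul1mx -scalemxAl -scalemxAr xx !scaler0 addr0.
  by rewrite addrK.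
have PP' : (1%:M - s *: x) *m (1%:M + s *: x) = 1%:M.
  rewrite mulmxDr mulmx1 mulmxBl mul1mx -scalemxAl -scalemxAr xx !scaler0 subr0.
  by rewrite subrK.
(* Conjugating [v] by 1 + s x, with x = a b, gives v + s (x v - v x) - s^2 x v x. The commutator is
   w a - u b, with the polar products [w] and [u] of [v] with b and a, and x v x = u bb a. These are
   the coefficients below; the quadratic term occurs only for b = n, as [bb] is 0 otherwise. *)
pose G2 : 'M[k]_13 := \matrix_(l, m) (G l m + s * (w m * G l i - u m * G l j)
   - s ^+ 2 * (u m * bb) * G l i).
exists G2.
have -> : delta + s *: spin_col (ops G) delta p = (1%:M + s *: x) *m delta.
  by rewrite mulmxDl mul1mx -scalemxAl /spin_col p60.
apply: (adapted_ext _ (adapted_conj PP PP' ad)) => m /=.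
have -> : col m G2 = col m G + s *: (w m *: col i G - u m *: col j G)
    - (s ^+ 2 * (u m * bb)) *: col i G.
  by apply/colP => l; rewrite !mxE.
have cE (v1 v2 v3 : 'cV[k]_13) (s1 s2 s3 s4 : k) :
    c (v1 + s1 *: (s2 *: v2 - s3 *: v3) - s4 *: v2) =
    c v1 + s1 *: (s2 *: c v2 - s3 *: c v3) - s4 *: c v2.
  by rewrite linearB linearD /= !(linearZZ c) linearB /= !(linearZZ c).
rewrite cE -/a -/b; set v := c (col m G).
have bv : b *m v = (w m)%:M - v *m b by rewrite /w -(CC j m) /= addrK.
have av : a *m v = (u m)%:M - v *m a by rewrite /u -(CC i m) /= addrK.
have xv : x *m v = w m *: a - u m *: b + v *m x.
  rewrite -mulmxA bv mulmxBr mul_mx_scalar mulmxA av mulmxBl mul_scalar_mx mulmxA.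
  by rewrite opprB addrA addrAC.
have xvx : x *m v *m x = (u m * bb) *: a.
  rewrite xv !mulmxDl mulNmx -!scalemxAl bab -(mulmxA v) xx mulmx0 addr0 mulmxA aa mul0mx.
  by rewrite scaler0 sub0r scalerN opprK scalerA.
transitivity (v + s *: (x *m v - v *m x) - s ^+ 2 *: (x *m v *m x)).
  rewrite mulmxBr mulmx1 mulmxDl mul1mx -scalemxAl -scalemxAr mulmxDl -scalemxAl.
  by rewrite scalerDr scalerA -expr2 scalerBr opprD !addrA.
by rewrite xvx scalerA xv addrK.
Qed.

End RootLine.

Section GeneralSpinor.
Variable k : numClosedFieldType.
Variables (Q : 'M[k]_13) (c : {linear 'cV[k]_13 -> 'M[k]_64}).
Hypothesis cliff : clifford_action Q c.
Hypothesis Q_unit : Q + Q^T \in unitmx.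

Definition has_frame (delta : 'cV[k]_64) := exists G : 'M[k]_13,
  adapted (fun i => c (col i G)) delta.

Lemma has_frame_zero_locus delta : has_frame delta ->
  exists Z1 Z2 : subkfunctor (zero_locus Q c delta),
    [/\ disjoint_union Z1 Z2, kiso Z1 (Fl3 k) & kiso Z2 (Fl3 k)].
Proof.
move=> [G ad]; have [CC [off diag] _] := ad.
exact: (frame_zero_locus cliff Q_unit isT CC off diag (adapted_functional ad)).
Qed.

Lemma has_frame_dense : (exists delta, has_frame delta) ->
  forall p : mpoly.mpoly 64 k,
  (forall x : 'cV[k]_64, has_frame x -> mpoly.meval (fun i => x i 0) p = 0) -> p = 0.
Proof.
move=> ne; apply: dense_of_lines => // y [G ad]; have [_ _ Mu] := ad.
exists (spin_mx (fun i => c (col i G)) y) => // j; rewrite col_spin_mx.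
have [j60|j60] := ltnP j 60.
  exists 1 => [|s _]; first exact: oner_neq0.
  exact: root_line.
have [q q0 qS] := slice_line ad j60; exists q => // s /qS ad'.
by exists G.
Qed.

End GeneralSpinor.

(** * Definability of the existence of an adapted frame *)

Section DefinableSets.
Variable K : fieldType.
Implicit Types (F H : seq K -> K) (S : seq K -> Prop).

Definition polyfun F := exists2 t : GRing.term K, GRing.rterm t &
  forall e, GRing.eval e t = F e.

Definition definable S := exists2 f : GRing.formula K, GRing.rformula f &
  forall e, GRing.holds e f <-> S e.

Definition mxpolyfun m n (F : seq K -> 'M[K]_(m, n)) :=
  forall i j, polyfun (fun e => F e i j).

Lemma polyfun_ext F H : F =1 H -> polyfun F -> polyfun H.
Proof. by move=> /funext ->. Qed.

Lemma polyfun_const a : polyfun (fun=> a).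
Proof. by exists (GRing.Const a). Qed.

Lemma polyfun_nth i : polyfun (fun e => e`_i).
Proof. by exists (GRing.Var _ i). Qed.

Lemma polyfunD F H : polyfun F -> polyfun H -> polyfun (fun e => F e + H e).
Proof.
by move=> [t rt tE] [u ru uE]; exists (GRing.Add t u) => [|e] /=; rewrite ?rt ?tE ?uE.
Qed.

Lemma polyfunM F H : polyfun F -> polyfun H -> polyfun (fun e => F e * H e).
Proof.
by move=> [t rt tE] [u ru uE]; exists (GRing.Mul t u) => [|e] /=; rewrite ?rt ?tE ?uE.
Qed.

Lemma polyfun_sum (I : Type) (r : seq I) (F : I -> seq K -> K) :
  (forall i, polyfun (F i)) -> polyfun (fun e => \sum_(i <- r) F i e).
Proof.
move=> pF; elim: r => [|i r IH].
  by apply: polyfun_ext (polyfun_const 0) => e; rewrite big_nil.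
by apply: polyfun_ext (polyfunD (pF i) IH) => e; rewrite big_cons.
Qed.

Lemma mxpolyfunM m n p (F : seq K -> 'M[K]_(m, n)) (H : seq K -> 'M[K]_(n, p)) :
  mxpolyfun F -> mxpolyfun H -> mxpolyfun (fun e => F e *m H e).
Proof.
move=> pF pH i j.
apply: polyfun_ext (polyfun_sum (index_enum 'I_n) (fun l => polyfunM (pF i l) (pH l j))).
by move=> e; rewrite mxE.
Qed.

Lemma mxpolyfunD m n (F H : seq K -> 'M[K]_(m, n)) :
  mxpolyfun F -> mxpolyfun H -> mxpolyfun (fun e => F e + H e).
Proof.
by move=> pF pH i j; apply: polyfun_ext (polyfunD (pF i j) (pH i j)) => e; rewrite mxE.
Qed.

Lemma mxpolyfun_const m n (M : 'M[K]_(m, n)) : mxpolyfun (fun=> M).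
Proof. by move=> i j; apply: polyfun_const. Qed.

Lemma definable_ext S S' : (forall e, S e <-> S' e) -> definable S -> definable S'.
Proof.
by move=> SS [f rf fE]; exists f => // e; apply: iff_trans (fE e) (SS e).
Qed.

Lemma definable_true : definable (fun=> True).
Proof. by exists (GRing.Bool true). Qed.

Lemma definable_and S S' : definable S -> definable S' -> definable (fun e => S e /\ S' e).
Proof.
move=> [f rf fE] [f' rf' fE']; exists (GRing.And f f') => [|e] /=; first by rewrite rf.
by split=> -[/fE ? /fE' ?].
Qed.

Lemma definable_imp (P : Prop) S : definable S -> definable (fun e => P -> S e).
Proof.
move=> dS; have [p|np] := pselect P.
  by apply: definable_ext dS => e; split=> // /(_ p).
by apply: definable_ext definable_true => e; split.
Qed.

Lemma definable_forall (T : finType) (S : T -> seq K -> Prop) :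
  (forall x, definable (S x)) -> definable (fun e => forall x, S x e).
Proof.
move=> dS; suff : definable (fun e => forall x, x \in enum T -> S x e).
  by apply: definable_ext => e; split=> Se x; [apply: Se; rewrite mem_enum | move=> _; apply: Se].
elim: (enum T) => [|y s IH]; first by apply: definable_ext definable_true.
apply: definable_ext (definable_and (dS y) IH) => e; split=> [[Sy Ss] x|Se].
  by rewrite inE => /predU1P[->|/Ss].
by split=> [|x xs]; apply: Se; rewrite inE ?eqxx ?xs ?orbT.
Qed.

Lemma definable_eq F H : polyfun F -> polyfun H -> definable (fun e => F e = H e).
Proof.
move=> [t rt tE] [u ru uE]; exists (GRing.Equal t u) => [|e] /=; first by rewrite rt.
by rewrite tE uE.
Qed.

Lemma definable_mxeq m n (F H : seq K -> 'M[K]_(m, n)) :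
  mxpolyfun F -> mxpolyfun H -> definable (fun e => F e = H e).
Proof.
move=> pF pH.
have d := definable_forall (fun i => definable_forall (fun j => definable_eq (pF i j) (pH i j))).
by apply: definable_ext d => e; split=> [FH|-> //]; apply/matrixP.
Qed.

Lemma definable_exists (m n : nat) S : definable S ->
  definable (fun e => exists2 e', (forall a, (a < m)%N || (m + n <= a)%N -> e`_a = e'`_a) & S e').
Proof.
move=> [f rf fE]; exists (foldr GRing.Exists f (iota m n)) => [|e].
  by elim: (iota m n).
have inC a : (a \in [predC iota m n]) = (a < m)%N || (m + n <= a)%N.
  by rewrite inE mem_iota negb_and -ltnNge -leqNgt.
split=> [/GRing.foldExistsP|] [e' ee' he'].
  by exists e' => [a|]; [rewrite -inC; apply: ee' | apply/fE].
by apply/GRing.foldExistsP; exists e' => [a|]; [rewrite inC; apply: ee' | apply/fE].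
Qed.

End DefinableSets.

Section FrameDefinable.
Variables (k : numClosedFieldType) (c : {linear 'cV[k]_13 -> 'M[k]_64}).
Notation ops G := (fun i : 'I_13 => c (col i G)).

(** Layout of the variables: 64 coordinates of the spinor, then 13 * 13 = 169 entries of the frame
    from position 64, then 64 * 64 = 4096 entries of an inverse of the spin matrix from position
    233. The inverse makes invertibility an equation. The last two groups, 4265 variables in all,
    get quantified. *)
Let delta_of (e : seq k) : 'cV[k]_64 := \col_i e`_i.
Let G_of (e : seq k) : 'M[k]_13 := \matrix_(i, j) e`_(64 + 13 * i + j).
Let N_of (e : seq k) : 'M[k]_64 := \matrix_(i, j) e`_(233 + 64 * i + j).

Lemma mxpolyfun_linear (F : seq k -> 'cV[k]_13) : mxpolyfun F -> mxpolyfun (fun e => c (F e)).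
Proof.
move=> pF i j.
apply: polyfun_ext (polyfun_sum (index_enum 'I_13)
  (fun l => polyfunM (pF l 0) (polyfun_const (c (delta_mx l 0) i j)))) => e.
have vE : F e = \sum_l F e l 0 *: delta_mx l 0.
  by rewrite [LHS]matrix_sum_delta; apply: eq_bigr => l _; rewrite big_ord1.
rewrite [in RHS]vE linear_sum summxE; apply: eq_bigr => l _.
by rewrite linearZ mxE.
Qed.

Let frame_data (e : seq k) := [/\ clifford_frame (ops (G_of e)),
  sl_invariant (ops (G_of e)) (delta_of e)
  & N_of e *m spin_mx (ops (G_of e)) (delta_of e) = 1%:M].

Lemma definable_frame_data : definable frame_data.
Proof.
have pd : mxpolyfun delta_of.
  by move=> i j; apply: polyfun_ext (polyfun_nth _ i) => e; rewrite mxE.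
have pN : mxpolyfun N_of.
  by move=> i j; apply: polyfun_ext (polyfun_nth _ (233 + 64 * i + j)) => e; rewrite mxE.
have pC l : mxpolyfun (fun e => c (col l (G_of e))).
  apply: mxpolyfun_linear => i j.
  by apply: polyfun_ext (polyfun_nth _ (64 + 13 * i + l)) => e; rewrite !mxE.
have pCC i j : mxpolyfun (fun e => c (col i (G_of e)) *m c (col j (G_of e))).
  exact: mxpolyfunM.
have pCCd i j : mxpolyfun (fun e => c (col i (G_of e)) *m c (col j (G_of e)) *m delta_of e).
  exact: mxpolyfunM.
have pcol p : mxpolyfun (fun e => spin_col (ops (G_of e)) (delta_of e) p).
  rewrite /spin_col; case: (p < 60)%N; first exact: pCCd.
  case: (p == 60%N); first exact: pd.
  case: (p == 61%N); first exact: pCCd.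
  case: (p == 62%N); first exact: pCCd.
  exact: (mxpolyfunM (pCC _ _) (pCCd _ _)).
have pmx : mxpolyfun (fun e => spin_mx (ops (G_of e)) (delta_of e)).
  by move=> i p; apply: polyfun_ext (pcol p i 0) => e; rewrite mxE.
have d1 : definable (fun e => clifford_frame (ops (G_of e))).
  apply: definable_forall => i; apply: definable_forall => j.
  by apply: definable_mxeq; [apply: mxpolyfunD|apply: mxpolyfun_const].
have d2 : definable (fun e => sl_invariant (ops (G_of e)) (delta_of e)).
  apply: definable_and.
    apply: definable_forall => i; apply: definable_forall => j.
    do 3!apply: definable_imp; apply: definable_mxeq => //; exact: mxpolyfun_const.
  do 4!apply: definable_forall => ?; do 7!apply: definable_imp.
  exact: definable_mxeq.
have d3 : definable (fun e => N_of e *m spin_mx (ops (G_of e)) (delta_of e) = 1%:M).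
  by apply: definable_mxeq; [apply: mxpolyfunM|apply: mxpolyfun_const].
apply: definable_ext (definable_and (definable_and d1 d2) d3) => e.
by split=> [[[h1 h2] h3]|[h1 h2 h3]]; split.
Qed.

Lemma frame_data_has_frame e : frame_data e -> has_frame c (delta_of e).
Proof. by move=> [CC sl /mulmx1_unit[_ u]]; exists (G_of e). Qed.

Lemma has_frame_frame_data (x : 'cV[k]_64) : has_frame c x ->
  exists2 e', (forall a, (a < 64)%N || (64 + 4265 <= a)%N -> (env x)`_a = e'`_a) & frame_data e'.
Proof.
move=> [G [CC sl u]].
pose f (a : nat) : k := if (a < 64)%N then x (inord a) 0
  else if (a < 233)%N then G (inord ((a - 64) %/ 13)) (inord ((a - 64) %% 13))
  else invmx (spin_mx (ops G) x) (inord ((a - 233) %/ 64)) (inord ((a - 233) %% 64)).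
have fE a : (a < 4329)%N -> (mkseq f 4329)`_a = f a by apply: nth_mkseq.
have dE : delta_of (mkseq f 4329) = x.
  apply/colP => i; rewrite mxE fE; last by rewrite (ltn_trans (ltn_ord i)).
  by rewrite /f ltn_ord inord_val.
have GE : G_of (mkseq f 4329) = G.
  apply/matrixP => i j; rewrite mxE.
  have ij : (13 * i + j < 169)%N.
    have := ltn_ord i; have := ltn_ord j; rewrite -[169%N]/(13 * 12 + 13)%N => j13 i13.
    by rewrite -addnS leq_add // leq_mul2l -ltnS.
  rewrite fE -addnA; last by rewrite (leq_trans (n := 64 + 169)%N) ?ltn_add2l.
  rewrite /f ltnNge leq_addr /= -[233%N]/(64 + 169)%N ltn_add2l ij addKn mulnC.
  by rewrite divnMDl // modnMDl !(divn_small, modn_small) // addn0 !inord_val.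
have NE : N_of (mkseq f 4329) = invmx (spin_mx (ops G) x).
  apply/matrixP => i j; rewrite mxE.
  have ij : (64 * i + j < 4096)%N.
    have := ltn_ord i; have := ltn_ord j; rewrite -[4096%N]/(64 * 63 + 64)%N => j64 i64.
    by rewrite -addnS leq_add // leq_mul2l -ltnS.
  rewrite fE -addnA; last by rewrite (leq_trans (n := 233 + 4096)%N) ?ltn_add2l.
  have lt233 (b : nat) : (b <= 233)%N -> (233 + (64 * i + j) < b)%N = false.
    by move=> b233; apply/negbTE; rewrite -leqNgt (leq_trans b233) ?leq_addr.
  rewrite /f !lt233 // addKn mulnC.
  by rewrite divnMDl // modnMDl !(divn_small, modn_small) // addn0 !inord_val.
exists (mkseq f 4329).
  move=> a /orP[a64|a4329].
    rewrite fE ?(ltn_trans a64) // /f a64.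
    by rewrite -[a in LHS]/(nat_of_ord (Ordinal a64)) nth_env; congr (x _ _); apply/val_inj; rewrite /= inordK.
  (* Past position 4329 both sequences have ended and read as 0. *)
  by rewrite !nth_default // ?size_mkseq // size_map size_enum_ord (leq_trans _ a4329).
by split; rewrite ?GE ?dE ?NE // mulVmx.
Qed.

Lemma general_has_frame : (exists delta, has_frame c delta) -> general (has_frame c).
Proof.
move=> ne; have [f rf fE] := definable_exists 64 4265 definable_frame_data.
have holdsE (x : 'cV[k]_64) : GRing.holds (env x) f <-> has_frame c x.
  split=> [/fE[e' ee' he']|hx]; last by apply/fE; apply: has_frame_frame_data.
  have -> : x = delta_of e'; last exact: frame_data_has_frame.
  by apply/colP => i; rewrite mxE -nth_env; apply: ee'; rewrite ltn_ord.
have [|O [Oo O0 OS]] := @definable_dense_open k 64 f rf.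
  move=> p px; apply: (has_frame_dense ne) => x /holdsE; exact: px.
by exists O; split=> // x /OS/holdsE.
Qed.

End FrameDefinable.

(** * Existence of an adapted frame *)

Section Congruence.
Variable k : numClosedFieldType.

(** A nonzero diagonal entry is moved to the corner and scaled by a square root. If the diagonal is
    zero, some B i j is not, and the sum of the two coordinate vectors has value 2 B i j. *)
Lemma congr_corner n (B : 'M[k]_n.+1) : B^T = B -> B \in unitmx ->
  exists2 P, P \in unitmx & (P^T *m B *m P) 0 0 = 1.
Proof.
move=> BT Bu.
suff [P Pu b0] : exists2 P, P \in unitmx & (P^T *m B *m P) 0 0 != 0.
  set b := (P^T *m B *m P) 0 0 in b0.
  have sb : sqrtC b != 0 by rewrite sqrtC_eq0.
  exists ((sqrtC b)^-1 *: P); first by rewrite unitmxZ // unitfE invr_eq0.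
  rewrite [(_ *: P)^T]linearZ /= -!scalemxAl -scalemxAr scalerA mxE -/b.
  by rewrite -invfM -expr2 sqrtCK mulVf.
have congE (M P : 'M[k]_n.+1) i : (P^T *m M *m P) i i = ((col i P)^T *m M *m col i P) 0 0.
  rewrite !mxE; apply: eq_bigr => a _; rewrite !mxE; congr (_ * _).
  by apply: eq_bigr => b _; rewrite !mxE.
have dd (M : 'M[k]_n.+1) i j :
    ((delta_mx i 0 : 'cV[k]_n.+1)^T *m M *m (delta_mx j 0 : 'cV[k]_n.+1)) 0 0 = M i j.
  by rewrite -colE trmx_delta -rowE !mxE.
have diag (M : 'M[k]_n.+1) (i : 'I_n.+1) : M i i != 0 ->
    exists2 P, P \in unitmx & (P^T *m M *m P) 0 0 != 0.
  move=> Mi; exists (tperm_mx 0 i); first exact: unitmx_perm.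
  rewrite congE; have -> : col 0 (tperm_mx 0 i) = delta_mx i 0 :> 'cV[k]_n.+1.
    apply/colP => a; rewrite !mxE eqxx andbT; congr (_%:R); congr nat_of_bool.
    by rewrite -{2}(tpermR 0 i) (inj_eq (@perm_inj _ _)).
  by rewrite dd.
have [/existsP[i Bi]|/existsPn Bd] := boolP [exists i, B i i != 0]; first exact: diag Bi.
have {}Bd i : B i i = 0 by apply/eqP; have := Bd i; rewrite negbK.
have [i [j Bij]] : exists i j, B i j != 0.
  have : B != 0.
    apply: contraTneq Bu => ->; rewrite unitmxE -(scale0r (1%:M : 'M[k]_n.+1)) detZ expr0n mul0r.
    by rewrite unitr0.
  by case/matrix0Pn => i [j Bij]; exists i, j.
have ij : i != j by apply: contraNneq Bij => ->; rewrite Bd.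
have Pu : (1%:M + delta_mx j i : 'M[k]_n.+1) \in unitmx.
  have : (1%:M + delta_mx j i) *m (1%:M - delta_mx j i) = 1%:M :> 'M[k]_n.+1.
    rewrite mulmxBr mulmx1 mulmxDl mul1mx mul_delta_mx_cond (negPf ij) mulr0n addr0.
    by rewrite addrK.
  by case/mulmx1_unit.
have [|P' P'u P'0] := diag ((1%:M + delta_mx j i)^T *m B *m (1%:M + delta_mx j i)) i.
  rewrite congE; have -> : col i (1%:M + delta_mx j i) = delta_mx i 0 + delta_mx j 0 :> 'cV[k]_n.+1.
    by apply/colP => a; rewrite !mxE !eqxx !andbT.
  have addE (M N : 'M[k]_1) : (M + N) 0 0 = M 0 0 + N 0 0 by rewrite mxE.
  rewrite [(_ + _)^T]raddfD !(mulmxDl, mulmxDr) !addE !dd !Bd addr0 add0r.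
  have -> : B j i = B i j by rewrite -[in LHS]BT mxE.
  by rewrite -mulr2n mulrn_eq0.
exists ((1%:M + delta_mx j i) *m P'); first by rewrite unitmx_mul Pu.
by rewrite trmx_mul; move: P'0; rewrite !mulmxA.
Qed.

(** Completing the square: with corner 1, clearing the first row and column leaves the Schur
    complement, which is again symmetric and invertible. *)
Lemma sym_congr n (B : 'M[k]_n) : B^T = B -> B \in unitmx -> exists P : 'M[k]_n, P^T *m B *m P = 1%:M.
Proof.
elim: n B => [|n IH] B BT Bu.
  by exists 1%:M; rewrite [LHS]flatmx0 [RHS]flatmx0.
have [P0 P0u P00] := congr_corner BT Bu.
have Bu' : P0^T *m B *m P0 \in unitmx by rewrite !unitmx_mul unitmx_tr P0u Bu.
have [B1 B1def] : exists B1 : 'M[k]_(1 + n), B1 = P0^T *m B *m P0 by eexists.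
have B1T : B1^T = B1 by rewrite B1def !trmx_mul trmxK BT mulmxA.
have B100 : B1 0 0 = 1 by rewrite B1def.
pose w := dlsubmx B1; pose D := drsubmx B1.
have B1E : B1 = block_mx 1%:M w^T w D.
  rewrite -[LHS]submxK; congr block_mx.
    by apply/matrixP => i j; rewrite !ord1 !mxE -[RHS]B100; congr (B1 _ _); apply: val_inj.
  by rewrite /w trmx_dlsub B1T.
pose P1 : 'M[k]_(1 + n) := block_mx 1%:M (- w^T) 0 1%:M.
have B2E : P1^T *m B1 *m P1 = block_mx 1%:M 0 0 (D - w *m w^T).
  have wT : (- w^T)^T = - w by rewrite raddfN /= trmxK.
  rewrite /P1 tr_block_mx !trmx1 trmx0 wT B1E !mulmx_block.
  rewrite !(mul1mx, mulmx1, mul0mx, mulmx0, addr0, add0r, mulmxN, mulNmx) addNr.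
  rewrite ?addNr ?mul0mx ?oppr0 ?add0r ?(addrC (- (w *m w^T))) //.
have DT : (D - w *m w^T)^T = D - w *m w^T.
  by rewrite raddfB /= trmx_mul trmxK /D trmx_drsub B1T.
have Du : D - w *m w^T \in unitmx.
  have : P1^T *m B1 *m P1 \in unitmx.
    have B1u : B1 \in unitmx by rewrite B1def.
    rewrite !unitmx_mul !unitmx_tr B1u andbT /= andbb unitmxE.
    by rewrite det_ublock !det1 mulr1 unitr1.
  by rewrite B2E unitmxE det_ublock det1 mul1r -unitmxE.
have [P2 P2E] := IH _ DT Du.
pose P3 : 'M[k]_(1 + n) := block_mx 1%:M 0 0 P2.
exists (P0 *m (P1 *m P3) : 'M[k]_(1 + n)).
transitivity (P3^T *m (P1^T *m B1 *m P1) *m P3).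
  by rewrite B1def !trmx_mul !mulmxA.
rewrite B2E /P3 tr_block_mx !trmx1 !trmx0 !mulmx_block.
rewrite !(mul1mx, mulmx1, mul0mx, mulmx0, addr0, add0r) P2E.
by rewrite -scalar_mx_block.
Qed.

End Congruence.

(** * The Fock model with integer coefficients, made for computation *)

Definition create (r : nat) : nat := (r %/ 3 * 6 + r %% 3)%N.
Definition annihilate (r : nat) : nat := (create r + 3)%N.

(* A formal sum of products of creation operators applied to the vacuum. *)
Definition fsum := seq (int * seq nat).

(** Here [r] is the mode, from 0 to 5, of the frame vector [i]; vectors of Xi create and their duals
    in Yi annihilate. A new mode is inserted behind the smaller ones, so increasing lists stay
    increasing and the sign counts the modes passed. The vector n fixes the vacuum and anticommutes
    with creation, so it acts by parity. A killed term is kept with coefficient 0. *)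
Definition act_term (i : nat) (t : int * seq nat) : int * seq nat :=
  let: (a, rs) := t in
  let r := (i %/ 6 * 3 + i %% 3)%N in
  if i == 12%N then (if odd (size rs) then - a else a, rs)
  else if (i %% 6 < 3)%N then
    if r \in rs then (0, rs) else
    let p := count (fun x => x < r)%N rs in
    (if odd p then - a else a, take p rs ++ r :: drop p rs)
  else if r \in rs then (if odd (index r rs) then - a else a, rem r rs) else (0, rs).

Definition act (i : nat) (v : fsum) : fsum := map (act_term i) v.

Definition coord (v : fsum) (rs : seq nat) : int :=
  foldr (fun t a => if t.2 == rs then t.1 + a else a) 0 v.

Definition wf_term (t : int * seq nat) : bool := uniq t.2 && all (fun r => r < 6)%N t.2.

Fixpoint sublists (l : seq nat) : seq (seq nat) :=
  if l is r :: l' then sublists l' ++ map (cons r) (sublists l') else [:: [::]].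

Definition fock_basis : seq (seq nat) := sublists (iota 0 6).

(** The membership tests ensure that no term escapes the comparison of coordinates on
    [fock_basis]. *)
Definition same_coord (v v' : fsum) : bool :=
  [&& all (fun t => t.2 \in fock_basis) v, all (fun t => t.2 \in fock_basis) v' &
      all (fun rs => coord v rs == coord v' rs) fock_basis].

(** The four lists give the vacuum, the volume elements of the two blocks and their product, all
    invariant under sl(X1) x sl(X2). Let t be the coefficient of the product. Products of vectors of
    Y1 and Y2 only see that term, so t must be nonzero. Within one block, x n delta and the matching
    y y' delta span two basis vectors with determinant 1 + t in the first block and 1 - t in the
    second, up to sign. So t avoids 0, 1 and -1; for t = 2 the determinants 3 and 1 and the inverse
    1/2 explain the common denominator 6 of [spin_inverse]. *)
Definition base_spinor : fsum :=
  [:: (1, [::]); (1, [:: 0; 1; 2]%N); (1, [:: 3; 4; 5]%N); (2, iota 0 6)].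

Definition spin_fsum (p : nat) : fsum :=
  if (p < 60)%N then let q := nth (0, 0)%N off_pairs p in act q.1 (act q.2 base_spinor)
  else if p == 60%N then base_spinor
  else if p == 61%N then act 0 (act 3 base_spinor)
  else if p == 62%N then act 6 (act 9 base_spinor)
  else act 0 (act 3 (act 6 (act 9 base_spinor))).

(* Six times the q-th Fock basis vector is the combination of the columns of the
   spin matrix with coefficients in the q-th row. *)
Definition spin_inverse : seq (seq (nat * int)) :=
  [:: [:: (60%N, 6); (61%N, -6); (62%N, -6); (63%N, 6)]; [:: (53%N, 12); (54%N, 6)];
      [:: (52%N, 12); (55%N, -6)]; [:: (51%N, 12); (56%N, 6)]; [:: (50%N, 12); (57%N, 6)];
      [:: (49%N, 12); (58%N, -6)]; [:: (48%N, 12); (59%N, 6)]; [:: (62%N, 6); (63%N, -6)];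
      [:: (23%N, 4); (24%N, -2)]; [:: (19%N, 6)]; [:: (18%N, 6)]; [:: (20%N, 6)];
      [:: (17%N, 6)]; [:: (21%N, -6)]; [:: (22%N, 6)]; [:: (23%N, -2); (24%N, -2)];
      [:: (16%N, 4); (25%N, 2)]; [:: (12%N, 6)]; [:: (11%N, 6)]; [:: (13%N, 6)];
      [:: (10%N, 6)]; [:: (14%N, -6)]; [:: (15%N, 6)]; [:: (16%N, -2); (25%N, 2)];
      [:: (9%N, 4); (32%N, -2)]; [:: (28%N, -6)]; [:: (27%N, -6)]; [:: (29%N, -3)];
      [:: (26%N, -6)]; [:: (30%N, 3)]; [:: (31%N, -3)]; [:: (9%N, 2); (32%N, 2)];
      [:: (8%N, 4); (33%N, -2)]; [:: (4%N, 6)]; [:: (3%N, 6)]; [:: (5%N, 6)]; [:: (2%N, 6)];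
      [:: (6%N, -6)]; [:: (7%N, 6)]; [:: (8%N, -2); (33%N, -2)]; [:: (1%N, 4); (40%N, 2)];
      [:: (36%N, 6)]; [:: (35%N, 6)]; [:: (37%N, 3)]; [:: (34%N, 6)]; [:: (38%N, -3)];
      [:: (39%N, 3)]; [:: (1%N, 2); (40%N, -2)]; [:: (0%N, 4); (47%N, -2)]; [:: (43%N, -6)];
      [:: (42%N, -6)]; [:: (44%N, -3)]; [:: (41%N, -6)]; [:: (45%N, 3)]; [:: (46%N, -3)];
      [:: (0%N, 2); (47%N, 2)]; [:: (61%N, 6); (63%N, -6)]; [:: (53%N, -6); (54%N, -6)];
      [:: (52%N, -6); (55%N, 6)]; [:: (51%N, -6); (56%N, -6)]; [:: (50%N, -6); (57%N, -6)];
      [:: (49%N, -6); (58%N, 6)]; [:: (48%N, -6); (59%N, -6)]; [:: (63%N, 3)]].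

Definition scale_fsum (a : int) (v : fsum) : fsum := [seq (a * t.1, t.2) | t <- v].

Definition combination (l : seq (nat * int)) : fsum :=
  flatten [seq scale_fsum t.2 (spin_fsum t.1) | t <- l].

Lemma spin_inverse_check :
  all (fun q => same_coord (combination (nth [::] spin_inverse q))
                           [:: (6, nth [::] fock_basis q)]) (iota 0 64).
Proof. by vm_compute. Qed.

Lemma spin_inverse_lt : all (all (fun t => t.1 < 64)%N) spin_inverse.
Proof. by vm_compute. Qed.

Lemma wf_base : all wf_term base_spinor. Proof. by vm_compute. Qed.

Lemma wf_act_base : all (fun j => all wf_term (act j base_spinor)) (iota 0 13).
Proof. by vm_compute. Qed.

Lemma wf_act69_base : all wf_term (act 6 (act 9 base_spinor)) &&
  all wf_term (act 3 (act 6 (act 9 base_spinor))).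
Proof. by vm_compute. Qed.

Lemma sl_off_check : all (fun i => all (fun j =>
  [&& (i < j)%N, sl_pair i j & (i %% 3 != j %% 3)%N] ==>
  same_coord (act i (act j base_spinor)) [::]) (iota 0 13)) (iota 0 13).
Proof. by vm_compute. Qed.

Lemma sl_diag_check : all (fun i => all (fun j =>
  [&& (i < j)%N, sl_pair i j & (i %% 3 == j %% 3)%N] ==>
  same_coord (act i (act j base_spinor))
    (act (i %/ 6 * 6) (act (i %/ 6 * 6 + 3) base_spinor))) (iota 0 13)) (iota 0 13).
Proof. by vm_compute. Qed.

Lemma fock_basis_check : uniq fock_basis && (size fock_basis == 64)%N &&
  all (fun rs => all (fun r => r < 6)%N rs) fock_basis.
Proof. by vm_compute. Qed.

Opaque off_pairs.

(** * Realization of the Fock model in a given Clifford module *)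

Section Fock.
Variable k : numFieldType.
Variables (C : 'I_13 -> 'M[k]_64) (w : 'cV[k]_64).
Hypothesis CC : clifford_frame C.
Hypothesis w_neq0 : w != 0.
Hypothesis w_vacuum : forall r, (r < 6)%N -> C (inord (annihilate r)) *m w = 0.
Hypothesis w_last : C (inord 12) *m w = w.
Let A (i : nat) := C (inord i).

Lemma frame_anticomm i j : (i < 13)%N -> (j < 13)%N ->
  A i *m A j = (gram_weight i j)%:R%:M - A j *m A i.
Proof. by move=> i13 j13; rewrite /A clifford_frameC // !inordK. Qed.

Lemma fock_gram r s : (r < 6)%N -> (s < 6)%N ->
  [/\ (create r < 13)%N, (annihilate r < 13)%N, gram_weight (create r) (create s) = 0%N,
      gram_weight 12 (create s) = 0%N & gram_weight (annihilate r) (create s) = (r == s)].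
Proof.
move=> r6 s6.
have /allP/(_ r) : all (fun r => all (fun s => [&& (create r < 13)%N, (annihilate r < 13)%N,
  gram_weight (create r) (create s) == 0%N, gram_weight 12 (create s) == 0%N &
  gram_weight (annihilate r) (create s) == (r == s)]) (iota 0 6)) (iota 0 6) by [].
rewrite mem_iota r6 => /(_ isT)/allP/(_ s); rewrite mem_iota s6 => /(_ isT).
by case/and5P => ? ? /eqP ? /eqP ? /eqP ?.
Qed.

Definition fock (rs : seq nat) : 'cV[k]_64 := foldr (fun r v => A (create r) *m v) w rs.

Lemma create_anticomm r s : (r < 6)%N -> (s < 6)%N ->
  A (create r) *m A (create s) = - (A (create s) *m A (create r)).
Proof.
move=> r6 s6; have [cr _ g _ _] := fock_gram r6 s6; have [cs _ _ _ _] := fock_gram s6 r6.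
by rewrite frame_anticomm // g raddf0 sub0r.
Qed.

Lemma create_sq r : (r < 6)%N -> A (create r) *m A (create r) = 0.
Proof.
move=> r6; have := create_anticomm r6 r6; move: (_ *m _) => M /eqP.
rewrite -addr_eq0 -mulr2n => /eqP MM; apply/matrixP => i j; rewrite [RHS]mxE.
by move/matrixP/(_ i j): MM; rewrite mulmxnE mxE => /eqP; rewrite mulrn_eq0 /= => /eqP.
Qed.

Lemma create_fock r p rs : (r < 6)%N -> all (fun r => r < 6)%N rs -> (p <= size rs)%N ->
  A (create r) *m fock rs = (-1) ^+ p *: fock (take p rs ++ r :: drop p rs).
Proof.
move=> r6; elim: rs p => [|s rs IH] [|p] //=; rewrite ?scale1r //.
case/andP => s6 rs6 /IH{}IH; rewrite mulmxA create_anticomm // mulNmx -mulmxA IH //.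
by rewrite -scalemxAr exprS mulN1r scaleNr.
Qed.

Lemma create_fock0 r rs : (r < 6)%N -> all (fun r => r < 6)%N rs -> r \in rs ->
  A (create r) *m fock rs = 0.
Proof.
move=> r6; elim: rs => //= s rs IH /andP[s6 rs6]; rewrite inE mulmxA.
case/predU1P => [->|/IH{}IH]; first by rewrite create_sq // mul0mx.
by rewrite create_anticomm // mulNmx -mulmxA IH // mulmx0 oppr0.
Qed.

Lemma annihilate_create r s (v : 'cV[k]_64) : (r < 6)%N -> (s < 6)%N ->
  A (annihilate r) *m (A (create s) *m v) =
  (r == s)%:R *: v - A (create s) *m (A (annihilate r) *m v).
Proof.
move=> r6 s6; have [_ ar _ _ g] := fock_gram r6 s6; have [cs _ _ _ _] := fock_gram s6 r6.
by rewrite mulmxA frame_anticomm // g mulmxBl mul_scalar_mx mulmxA.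
Qed.

Lemma annihilate_fock0 r rs : (r < 6)%N -> all (fun r => r < 6)%N rs -> r \notin rs ->
  A (annihilate r) *m fock rs = 0.
Proof.
move=> r6; elim: rs => [|s rs IH] /=; first by rewrite w_vacuum.
case/andP => s6 rs6; rewrite inE negb_or => /andP[/negPf rs0 /IH{}IH].
by rewrite annihilate_create // rs0 scale0r sub0r IH // mulmx0 oppr0.
Qed.

Lemma annihilate_fock r rs : (r < 6)%N -> all (fun r => r < 6)%N rs -> uniq rs -> r \in rs ->
  A (annihilate r) *m fock rs = (-1) ^+ index r rs *: fock (rem r rs).
Proof.
move=> r6; elim: rs => //= s rs IH /andP[s6 rs6] /andP[srs u]; rewrite inE annihilate_create //.
have [e|rs0] := eqVneq r s.
  by move=> _; rewrite annihilate_fock0 ?mulmx0 ?subr0 // e.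
move=> /= /IH{}IH.
by rewrite scale0r sub0r IH // -scalemxAr exprS mulN1r scaleNr.
Qed.

Lemma last_fock rs : all (fun r => r < 6)%N rs ->
  A 12 *m fock rs = (-1) ^+ size rs *: fock rs.
Proof.
elim: rs => [|s rs IH] /=; first by rewrite w_last scale1r.
case/andP => s6 rs6; have [cs _ _ g _] := fock_gram s6 s6.
rewrite mulmxA frame_anticomm // g raddf0 sub0r mulNmx -mulmxA IH // -scalemxAr.
by rewrite exprS mulN1r scaleNr.
Qed.

Definition ev (v : fsum) : 'cV[k]_64 := \sum_(t <- v) t.1%:~R *: fock t.2.

Lemma sign_intr (a : int) p : (if odd p then - a else a)%:~R = a%:~R * (-1) ^+ p :> k.
Proof. by rewrite -signr_odd; case: (odd p); rewrite ?mulr1 // mulrN1 rmorphN. Qed.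

Lemma act_index_split (i : nat) : (i < 13)%N -> i != 12%N ->
  let r := (i %/ 6 * 3 + i %% 3)%N in
  (r < 6)%N && (i == if (i %% 6 < 3)%N then create r else annihilate r).
Proof.
move=> i13 i12; have /allP/(_ i) : all (fun i => (i != 12)%N ==>
  let r := (i %/ 6 * 3 + i %% 3)%N in
  (r < 6)%N && (i == if (i %% 6 < 3)%N then create r else annihilate r)) (iota 0 13) by [].
by rewrite mem_iota i13 i12 => /(_ isT).
Qed.

Lemma ev_act i v : (i < 13)%N -> all wf_term v -> ev (act i v) = A i *m ev v.
Proof.
move=> i13; rewrite /ev /act big_map mulmx_sumr big_seq [RHS]big_seq => /allP wf.
apply: eq_bigr => -[a rs] /wf /andP[/= u rs6]; rewrite -scalemxAr.
case: eqP => [->|/eqP i12] /=; first by rewrite last_fock // scalerA sign_intr.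
have := act_index_split i13 i12; set r := (_ + _)%N => /andP[r6 /eqP iE].
case: ifP => i3; rewrite i3 in iE; rewrite [in RHS]iE.
  case: ifP => rrs /=; first by rewrite scale0r create_fock0 ?scaler0.
  by rewrite (@create_fock _ (count (fun x => x < r)%N rs)) ?count_size // scalerA sign_intr.
case: ifP => rrs /=; last by rewrite scale0r annihilate_fock0 ?scaler0 // rrs.
by rewrite annihilate_fock // scalerA sign_intr.
Qed.

Lemma mem_sublists l rs : rs \in sublists l -> {subset rs <= l}.
Proof.
elim: l rs => [|r l IH] rs /=; first by rewrite inE => /eqP ->.
rewrite mem_cat => /orP[/IH h x /h|/mapP[rs' /IH h ->] x]; rewrite !inE; first by move=> ->; rewrite orbT.
by case/predU1P => [->|/h ->]; rewrite ?eqxx ?orbT.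
Qed.

(** Annihilating the first mode [r] kills the terms without it and strips it from the others, so
    induction shows that the coefficients of lists containing [r] vanish; then those of the
    remaining lists do. *)
Lemma sublists_indep l (z : seq nat -> k) : uniq l -> all (fun r => r < 6)%N l ->
  \sum_(rs <- sublists l) z rs *: fock rs = 0 -> forall rs, rs \in sublists l -> z rs = 0.
Proof.
elim: l z => [|r l IH] z /=.
  move=> _ _; rewrite big_seq1 => /eqP; rewrite scaler_eq0 (negPf w_neq0) orbF => /eqP z0 rs.
  by rewrite inE => /eqP ->.
case/andP => rl ul /andP[r6 l6]; rewrite big_cat big_map /= => sum0.
have lt6 rs : rs \in sublists l -> all (fun r => r < 6)%N rs.
  by move=> /mem_sublists h; apply/allP => x /h; apply: (allP l6).
have nr rs : rs \in sublists l -> r \notin rs.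
  by move=> /mem_sublists h; apply: contra rl; apply: h.
have z1 : forall rs, rs \in sublists l -> z (r :: rs) = 0.
  apply: (IH (fun rs => z (r :: rs))) => //.
  have := congr1 (mulmx (A (annihilate r))) sum0; rewrite mulmx0 mulmxDr !mulmx_sumr.
  rewrite big_seq big1 ?add0r => [e|rs rsl]; last first.
    by rewrite -scalemxAr annihilate_fock0 ?scaler0 ?lt6 ?nr.
  rewrite -[RHS]e big_seq [RHS]big_seq; apply: eq_bigr => rs rsl.
  rewrite -scalemxAr annihilate_create //.
  by rewrite eqxx scale1r annihilate_fock0 ?mulmx0 ?subr0 ?lt6 ?nr.
have z0 : forall rs, rs \in sublists l -> z rs = 0.
  apply: IH => //; rewrite -[RHS]sum0 [X in _ = _ + X]big_seq [X in _ = _ + X]big1 ?addr0 // => rs rsl.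
  by rewrite z1 // scale0r.
by move=> rs; rewrite mem_cat => /orP[/z0|/mapP[rs' /z1 ? ->]].
Qed.

Lemma ev_coord v : all (fun t => t.2 \in fock_basis) v ->
  ev v = \sum_(rs <- fock_basis) (coord v rs)%:~R *: fock rs.
Proof.
have [/andP[ub _] _] := andP fock_basis_check.
rewrite /ev; elim: v => [|[a rs] v IH] /=.
  by rewrite big_nil big1 // => rs _; rewrite scale0r.
case/andP => rsb /IH{}IH; rewrite big_cons IH (bigD1_seq rs) //= [RHS](bigD1_seq rs) //=.
rewrite eqxx intrD scalerDl addrA; congr (_ + _ + _); apply: eq_bigr => rs' /negPf rr.
by rewrite eq_sym rr.
Qed.

Lemma ev_same_coord v v' : same_coord v v' -> ev v = ev v'.
Proof.
case/and3P => vb vb' /allP vv; rewrite !ev_coord // big_seq [RHS]big_seq.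
by apply: eq_bigr => rs /vv/eqP ->.
Qed.

Lemma ev_combination l :
  ev (combination l) = \sum_(t <- l) t.2%:~R *: ev (spin_fsum t.1).
Proof.
elim: l => [|t l IH]; first by rewrite /ev !big_nil.
rewrite big_cons -IH /ev /combination /= big_cat; congr (_ + _).
rewrite big_map scaler_sumr; apply: eq_bigr => u _ /=.
by rewrite scalerA intrM.
Qed.

Let delta := ev base_spinor.

Lemma ev_act2 i j : (i < 13)%N -> (j < 13)%N ->
  A i *m A j *m delta = ev (act i (act j base_spinor)).
Proof.
move=> i13 j13; rewrite !ev_act ?wf_base -?mulmxA //.
by have /allP/(_ j) := wf_act_base; rewrite mem_iota; apply.
Qed.

Lemma spin_colE p : (p < 64)%N -> spin_col C delta p = ev (spin_fsum p).
Proof.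
move=> p64; rewrite /spin_col /spin_fsum -!/(A _).
case: ifP => [p60|_].
  by have [/ltn_trans ij j13 _] := off_pairsP p60; rewrite ev_act2 ?ij.
do 3!(case: ifP => _; first by rewrite // ev_act2).
have /andP[wf1 wf2] := wf_act69_base.
by rewrite ev_act2 // -mulmxA -!ev_act.
Qed.

Lemma fock_dual0 (v : 'rV[k]_64) : (forall rs, rs \in fock_basis -> v *m fock rs = 0) -> v = 0.
Proof.
have [/andP[ub /eqP sb] /allP b6] := andP fock_basis_check => v0.
pose F : 'M[k]_64 := \matrix_(i, q) fock (nth [::] fock_basis q) i 0.
have Fu : F \in unitmx.
  rewrite -unitmx_tr unitmxE unitfE; apply/det0P => -[z z0 zF].
  have sum0 : \sum_(rs <- fock_basis) z 0 (inord (index rs fock_basis)) *: fock rs = 0.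
    rewrite (big_nth [::]) sb big_mkord; apply/colP => i; rewrite summxE [RHS]mxE.
    have /rowP/(_ i) := zF; rewrite !mxE => {2}<-; apply: eq_bigr => q _.
    by rewrite !mxE index_uniq ?sb // inord_val.
  have := sublists_indep (isT : uniq (iota 0 6)) isT sum0 => zz.
  case/eqP: z0; apply/rowP => q; rewrite mxE -(zz (nth [::] fock_basis q)) ?mem_nth ?sb //.
  by rewrite index_uniq ?sb // inord_val.
have vF : v *m F = 0.
  apply/rowP => q; have := v0 (nth [::] fock_basis q); rewrite mem_nth ?sb // => /(_ isT)/rowP/(_ 0).
  by rewrite !mxE => {2}<-; apply: eq_bigr => i _; rewrite mxE.
by rewrite -[v](mulmxK Fu) vF mul0mx.
Qed.

(** Invariance is checked by integer computation. For invertibility, a row vector killing all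
    columns of the spin matrix kills six times each Fock basis vector by [spin_inverse_check], hence
    is zero. *)
Lemma fock_adapted : adapted C delta.
Proof.
split=> //.
  split=> [i j ij sl ij3|i j i' j' ij sl ij3 ij' sl' ij3' i6].
    have := @forall_ord13_2 _ sl_off_check i j; rewrite ij sl ij3 => /ev_same_coord.
    by rewrite -ev_act2 // /A !inord_val => ->; rewrite /ev big_nil.
  have h (a b : 'I_13) : (a < b)%N -> sl_pair a b -> (a %% 3 = b %% 3)%N ->
      C a *m C b *m delta =
      ev (act (a %/ 6 * 6) (act (a %/ 6 * 6 + 3) base_spinor)).
    move=> ab sab ab3; have := @forall_ord13_2 _ sl_diag_check a b.
    rewrite ab sab ab3 eqxx => /ev_same_coord <-.
    by rewrite -ev_act2 // /A !inord_val.
  by rewrite !h // i6.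
rewrite unitmxE unitfE; apply/det0P => -[v v0 vM]; case/eqP: v0.
have vcol p : (p < 64)%N -> v *m ev (spin_fsum p) = 0.
  move=> p64; rewrite -spin_colE // -[p]/(nat_of_ord (Ordinal p64)) -col_spin_mx.
  by rewrite colE mulmxA vM mul0mx.
apply: fock_dual0 => rs rsb.
have [/andP[ub /eqP sb] _] := andP fock_basis_check.
have q64 : (index rs fock_basis < 64)%N by rewrite -sb index_mem.
have /allP/(_ (index rs fock_basis)) := spin_inverse_check; rewrite mem_iota q64 => /(_ isT).
rewrite nth_index // => /ev_same_coord; rewrite [RHS]big_seq1 => comb6.
have : v *m (6%:~R *: fock rs) = 0.
  rewrite -comb6 ev_combination mulmx_sumr big_seq big1 // => t tl.
  rewrite -scalemxAr vcol ?scaler0 //.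
  have /allP/(_ (nth [::] spin_inverse (index rs fock_basis))) := spin_inverse_lt.
  by rewrite mem_nth // => /(_ isT)/allP/(_ t tl).
by rewrite -scalemxAr => /eqP; rewrite scaler_eq0 intr_eq0 => /eqP.
Qed.

End Fock.

(** The annihilators anticommute and square to zero: starting from any nonzero vector, each one is
    applied in turn unless it already kills the current vector. Since n anticommutes with them and
    has square 1, the sum of w and n w is a fixed vacuum unless it is zero, in which case w itself
    has eigenvalue -1. *)
Lemma exists_vacuum (k : numFieldType) (C : 'I_13 -> 'M[k]_64) : clifford_frame C ->
  exists w : 'cV[k]_64, exists s : k, [/\ w != 0, s * s = 1,
    forall r, (r < 6)%N -> C (inord (annihilate r)) *m w = 0 & C (inord 12) *m w = s *: w].
Proof.
move=> CC.
have gram r t : (r < 6)%N -> (t < 6)%N -> [/\ (annihilate r < 13)%N,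
    gram_weight (annihilate r) (annihilate t) = 0%N & gram_weight (annihilate r) 12 = 0%N].
  move=> r6 t6.
  have /allP/(_ r) : all (fun r => all (fun t => [&& (annihilate r < 13)%N,
    gram_weight (annihilate r) (annihilate t) == 0%N & gram_weight (annihilate r) 12 == 0%N])
    (iota 0 6)) (iota 0 6) by [].
  rewrite mem_iota r6 => /(_ isT)/allP/(_ t); rewrite mem_iota t6 => /(_ isT).
  by case/and3P => ? /eqP ? /eqP ?.
have anti i j v : gram_weight (inord i : 'I_13) (inord j : 'I_13) = 0%N ->
    C (inord i) *m (C (inord j) *m v) = - (C (inord j) *m (C (inord i) *m v)) :> 'cV[k]_64.
  by move=> g; rewrite mulmxA clifford_frameC // g raddf0 sub0r mulNmx mulmxA.
have [w w0 wv] : exists2 w : 'cV[k]_64, w != 0 &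
    forall r, (r < 6)%N -> C (inord (annihilate r)) *m w = 0.
  suff h m : (m <= 6)%N -> exists2 w : 'cV[k]_64, w != 0 &
      forall r, (r < m)%N -> C (inord (annihilate r)) *m w = 0 by apply: (h 6%N).
  elim: m => [_|m IH m6]; first by exists (const_mx 1) => //; apply/eqP => /colP/(_ 0);
    rewrite !mxE => /eqP; rewrite oner_eq0.
  have [w w0 wv] := IH (ltnW m6).
  have [mw|mw] := eqVneq (C (inord (annihilate m)) *m w) 0.
    by exists w => // r; rewrite ltnS leq_eqVlt => /predU1P[->|/wv].
  exists (C (inord (annihilate m)) *m w) => // r; rewrite ltnS leq_eqVlt.
  have [am g _] := gram _ _ m6 m6.
  case/predU1P => [->|rm].
    rewrite mulmxA clifford_frame_sq // inordK // g mul0r raddf0 mul0mx //.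
  have r6 := ltn_trans rm m6; have [ar gr _] := gram _ _ r6 m6.
  by rewrite anti ?inordK // wv // mulmx0 oppr0.
pose n := C (inord 12); have nn (v : 'cV[k]_64) : n *m (n *m v) = v.
  rewrite mulmxA clifford_frame_sq // inordK // -[gram_weight 12 12]/2%N divff ?pnatr_eq0 //.
  by rewrite mul1mx.
have nv r : (r < 6)%N -> C (inord (annihilate r)) *m (n *m w) = 0.
  move=> r6; have [ar _ g] := gram _ _ r6 r6.
  by rewrite anti ?inordK // wv // mulmx0 oppr0.
have [wn|wn] := eqVneq (w + n *m w) 0.
  exists w, (-1); split=> //; first by rewrite mulrNN mulr1.
  by apply/eqP; rewrite scaleN1r -addr_eq0 addrC wn.
exists (w + n *m w), 1; split=> //; first by rewrite mulr1.
  by move=> r r6; rewrite mulmxDr wv // nv // addr0.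
by rewrite -/n mulmxDr nn scale1r addrC.
Qed.

Section Existence.
Variables (k : numClosedFieldType) (Q : 'M[k]_13) (c : {linear 'cV[k]_13 -> 'M[k]_64}).
Hypotheses (Q_nd : nondegenerate_gram Q) (cliff : clifford_action Q c).

Lemma gram_polar_unit : Q + Q^T \in unitmx.
Proof.
have [QT Qu] := Q_nd; rewrite QT -mulr2n -scaler_nat unitmxZ //.
by rewrite unitfE pnatr_eq0.
Qed.

(** The polar form of [Q] and the prescribed Gram matrix are both congruent to the identity, hence
    to each other. *)
Lemma exists_clifford_frame : exists G : 'M[k]_13, clifford_frame (fun i => c (col i G)).
Proof.
have BT : (Q + Q^T)^T = Q + Q^T by rewrite raddfD /= trmxK addrC.
have gT : (gram13 k)^T = gram13 k.
  by apply/matrixP => i j; rewrite !mxE gram_weight_sym.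
have [P1 P1E] := sym_congr BT gram_polar_unit.
have [P2 P2E] := sym_congr gT (gram13_unit k).
have P2u : P2 \in unitmx by have [] := mulmx1_unit P2E.
have P2E' : gram13 k = (invmx P2)^T *m invmx P2.
  apply: (can_inj (mulmxK P2u)); rewrite mulmxKV //.
  apply: (can_inj (mulKmx (_ : P2^T \in unitmx))); first by rewrite unitmx_tr.
  by rewrite mulmxA P2E -trmx_mul mulVmx // trmx1.
exists (P1 *m invmx P2) => i j; rewrite (clifford_polarization cliff).
have -> : ((col i (P1 *m invmx P2))^T *m (Q + Q^T) *m col j (P1 *m invmx P2)) 0 0
    = ((P1 *m invmx P2)^T *m (Q + Q^T) *m (P1 *m invmx P2)) i j.
  rewrite mxE [RHS]mxE; apply: eq_bigr => a _; rewrite [X in _ * X]mxE; congr (_ * _).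
  by rewrite mxE [RHS]mxE; apply: eq_bigr => b _; rewrite [in LHS]mxE [in LHS]mxE [in RHS]mxE.
have -> : (P1 *m invmx P2)^T *m (Q + Q^T) *m (P1 *m invmx P2) =
    (invmx P2)^T *m (P1^T *m (Q + Q^T) *m P1) *m invmx P2.
  by rewrite trmx_mul !mulmxA.
by rewrite P1E mulmx1 -P2E' mxE.
Qed.

Lemma exists_has_frame : exists delta, has_frame c delta.
Proof.
have [G CC] := exists_clifford_frame.
have [w [s [w0 ss wv wn]]] := exists_vacuum CC.
(* Replacing n by s n makes it fix the vacuum, as the Fock model requires; since s squares to 1 and
   n is orthogonal to the other frame vectors, the Clifford relations persist. The sign tells which
   of the two Clifford modules of dimension 64 is given. *)
pose e (i : 'I_13) : k := if i == 12%N :> nat then s else 1.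
pose G2 : 'M[k]_13 := \matrix_(a, b) (e b * G a b).
have G2E i : c (col i G2) = e i *: c (col i G).
  by rewrite -linearZ; congr (c _); apply/colP => a; rewrite !mxE.
have frame2 : clifford_frame (fun i => c (col i G2)).
  move=> i j; rewrite !G2E -!scalemxAl -!scalemxAr !scalerA (mulrC (e j)) -scalerDr CC.
  have := @forall_ord13_2 (fun i j => ((i == 12) != (j == 12))%N ==>
    (gram_weight i j == 0%N)) isT i j.
  rewrite /e; case: (nat_of_ord i == 12%N); case: (nat_of_ord j == 12%N) => /=.
  - by rewrite ss scale1r.
  - by move/eqP->; rewrite raddf0 scaler0.
  - by move/eqP->; rewrite raddf0 scaler0.
  - by rewrite mulr1 scale1r.
exists (ev (fun i => c (col i G2)) w base_spinor), G2.
apply: fock_adapted => // [r r6|]; last by rewrite G2E /e inordK // eqxx -scalemxAl wn scalerA ss scale1r.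
rewrite G2E /e inordK; last by have /allP/(_ r) : all (fun r => annihilate r < 13)%N (iota 0 6) by [];
  rewrite mem_iota r6 => /(_ isT).
have /allP/(_ r) : all (fun r => annihilate r != 12)%N (iota 0 6) by [].
by rewrite mem_iota r6 => /(_ isT)/negPf ->; rewrite scale1r wv.
Qed.

End Existence.

Theorem proposition34 (R : realType) (Q : 'M[complex R]_13)
    (c : {linear 'cV[complex R]_13 -> 'M[complex R]_64})
    (Q_nondegenerate : nondegenerate_gram Q) (c_clifford : clifford_action Q c) :
  general (fun delta : 'cV[complex R]_64 =>
    exists Z1 Z2 : subkfunctor (zero_locus Q c delta),
      [/\ disjoint_union Z1 Z2, kiso Z1 (Fl3 (complex R))
        & kiso Z2 (Fl3 (complex R))]).
Proof.
have [O [Oo O0 OS]] := general_has_frame (exists_has_frame Q_nondegenerate c_clifford).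
exists O; split=> // delta /OS.
exact: (has_frame_zero_locus c_clifford (gram_polar_unit Q_nondegenerate)).
Qed.
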